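(* Let $N$ be a renewal point process on $[0,T]$, $T<\infty$, with a spacing density $f$ such that $f$ is continuous on $[0,+\infty)$ and $f>0$ on $(a,C)$ for some $a\in[0,T]$ and $C\in(T,+\infty]$, and let $$G:=\int_0^Tg(s)\,N(\mathrm ds),\quad g\in L^2([0,T]).$$ Assume further that there exists $\overline h>0$ such that $$\sup_{z\in[0,T]}\sup_{x\in[z,T]}\frac{f(x-z)}{f(x)}\le\overline h.$$ Set $$\beta:=\max\biggl(\frac{\sup_{x\in[0,T]}f(x)}{\int_T^Cf(x)\,\mathrm dx},\ \sup_{x\in[0,C)}f(x)+\frac{\bigl(\sup_{x\in[0,T]}f(x)\bigr)^2}{\min_{x\in[a,T]}f(x)}\biggr).$$ Let $g_1\in L^2([0,T])$ be such that $|g(t)|\le g_1(t)$, $t\in[0,T]$, let $g_2\in L^2([0,T])$ be such that $$\sqrt{2\Bigl(\overline h^2+\Bigl(\int_T^Cf(x)\,\mathrm dx\Bigr)^{-2}-1\Bigr)}\biggl[\beta\int_t^Tg(s)^2\,\mathrm ds+\beta^2\Bigl(\int_t^T|g(s)|\,\mathrm ds\Bigr)^2\biggr]^{1/2}\le g_2(t),\quad t\in[0,T],$$ and set $h:=g_1+g_2$. Then, with $d(x,y):=|x-y|$ on $\mathbb R$, $$c(\mathcal T_d(\sigma,\mathcal L(G)))\le H(\sigma\mid\mathcal L(G))\quad\text{for any }\sigma\in M_1(\mathbb R,d),$$ where $\mathcal L(G)$ is the law of $G$, $c:=\Lambda^{\odot}$ and $\Lambda(\theta):=\int_0^T\bigl(\mathrm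 e^{\theta h(t)}-\theta h(t)-1\bigr)\beta\,\mathrm dt$, $\theta\in\mathbb R_+$. Moreover, for any $M>0$ such that $\|g_1+g_2\|_\infty\le M$, $$c(x)\ge\frac{x+M^{-1}V}{M}\ln\Bigl(1+\frac{x}{M^{-1}V}\Bigr)-\frac xM,\quad x\in\mathbb R_+,\qquad V:=\int_0^Th(t)^2\beta\,\mathrm dt.$$
   Context: A renewal point process on $[0,T]$ with spacing density $f$ is the restriction to $[0,T]$ of the point process with points $T_n=\sum_{i=1}^n\tau_i$, $n\ge1$, where $(\tau_i)$ are i.i.d. with probability density $f$ on $[0,\infty)$; $N$ is the associated counting measure. Conventions: $0/0:=0$, and a positive number divided by $0$ is $+\infty$. For the metric $d$ on $\mathbb R$, $\mathcal T_d(\sigma_1,\sigma_2):=\inf_\rho\int d(x,y)\,\rho(\mathrm dx\times\mathrm dy)$, the infimum being over probability measures $\rho$ on $\mathbb R\times\mathbb R$ with first marginal $\sigma_1$ and second marginal $\sigma_2$. $M_1(\mathbb R,d)$ is the set of Borel probability measures $\sigma$ on $\mathbb R$ with $\int d(x_0,x)\,\sigma(\mathrm dx)<\infty$ for some $x_0$. $H(\sigma_1\mid\sigma_2):=\int\log(\mathrm d\sigma_1/\mathrm d\sigma_2)\,\mathrm d\sigma_1$ if $\sigma_1\ll\sigma_2$ and $+\infty$ otherwise. The monotone conjugate of a measurable $k:\mathbb R_+\to[0,\infty]$ is $k^{\odot}(x):=\sup_{\theta\ge0}(\theta x-k(\theta))$, $x\in\mathbb R_+$. *)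

(* Defs.v *)
From HB Require Import structures.
From mathcomp Require Import all_boot all_order all_algebra finmap.
From mathcomp Require Import all_classical all_reals all_analysis.
From mathcomp Require Import measurable_realfun ess_sup_inf.

Set Implicit Arguments.
Unset Strict Implicit.
Unset Printing Implicit Defensive.

Import Order.TTheory GRing.Theory Num.Theory.
Import numFieldNormedType.Exports.

Local Open Scope classical_set_scope.
Local Open Scope ring_scope.

Section renewal.
Context {d : measure_display} {Omega : measurableType d} {R : realType}.
Variable P : probability Omega R.

Definition mutually_independent (X : nat -> {RV P >-> R}) : Prop :=
  forall (J : {fset nat}) (B : nat -> set R),
    (forall i, i \in J -> measurable (B i)) ->
    P (\bigcap_(i in [set` J]) (X i @^-1` B i)) =
    (\prod_(i <- J) P (X i @^-1` B i))%E.

(* Only the values of f on [0, +oo[ are used: f stands for a density that     *)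
(* vanishes on ]-oo, 0[.                                                      *)
Definition has_density_on_nneg (mu : set R -> \bar R) (f : R -> R) : Prop :=
  (forall x, 0 <= x -> 0 <= f x) /\
  forall A : set R, measurable A ->
    mu A = (\int[lebesgue_measure]_(x in A `&` `[0%R, +oo[) (f x)%:E)%E.

Definition iid_spacings (f : R -> R) (tau : nat -> {RV P >-> R}) : Prop :=
  mutually_independent tau /\
  forall n, has_density_on_nneg (distribution P (tau n)) f.

(* Indices are shifted by one: tau i and renewal_time tau n are the           *)
(* tau_(i+1) and T_(n+1) of the usual numbering that starts at 1.             *)
Definition renewal_time (tau : nat -> {RV P >-> R}) (n : nat) (w : Omega) : R :=
  \sum_(i < n.+1) tau i w.

Definition renewal_measure (T : R) (tau : nat -> {RV P >-> R}) (w : Omega) :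
    {measure set R -> \bar R} :=
  mrestr (mseries (fun n => \d_(renewal_time tau n w)) 0)
         (measurable_itv `[0%R, T]).

Definition renewal_integral (T : R) (tau : nat -> {RV P >-> R})
    (g : {mfun R >-> R}) (w : Omega) : R :=
  \int[renewal_measure T tau w]_(s in `[0%R, T]) g s.

Lemma measurable_renewal_time tau n : measurable_fun setT (renewal_time tau n).
Proof. exact: measurable_sum. Qed.

Let ge0_renewal_integral (T : R) (tau : nat -> {RV P >-> R}) (F : R -> \bar R)
    (w : Omega) :
  measurable_fun setT F -> (forall x, 0 <= F x)%E ->
  (\int[renewal_measure T tau w]_(s in `[0%R, T]) F s =
   \sum_(n <oo) (\1_(`[0%R, T]) (renewal_time tau n w))%:E *
                F (renewal_time tau n w))%E.
Proof.
move=> mF F0.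
have mFT : measurable_fun `[0%R, T] F by exact: measurable_funTS.
rewrite (@eq_measure_integral _ _ _ _
  (mseries (fun n => \d_(renewal_time tau n w)) 0)); last first.
  by move=> A mA AT; rewrite /renewal_measure/= /mrestr setIidl.
rewrite ge0_integral_measure_series//.
by apply: eq_eseriesr => n _; rewrite integral_dirac.
Qed.

Let measurable_ge0_renewal_integral (T : R) (tau : nat -> {RV P >-> R})
    (F : R -> \bar R) :
  measurable_fun setT F -> (forall x, 0 <= F x)%E ->
  measurable_fun setT
    (fun w => \int[renewal_measure T tau w]_(s in `[0%R, T]) F s)%E.
Proof.
move=> mF F0; under eq_fun do rewrite ge0_renewal_integral//.
apply: ge0_emeasurable_sum => [n w _ _|n _].
  by rewrite mule_ge0.
apply: emeasurable_funM.
  apply/measurable_EFinP/measurableT_comp; last exact: measurable_renewal_time.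
  exact: measurable_indic.
exact: measurableT_comp mF (measurable_renewal_time _ _).
Qed.

Lemma measurable_renewal_integral T tau g :
  measurable_fun setT (renewal_integral T tau g).
Proof.
apply: measurableT_comp => //.
under eq_fun do rewrite integralE.
have mg : measurable_fun setT (EFin \o g) by exact/measurable_EFinP.
apply: emeasurable_funB; apply: measurable_ge0_renewal_integral => //.
- exact: measurable_funepos.
- exact: measurable_funeneg.
Qed.

HB.instance Definition _ T tau g := isMeasurableFun.Build _ _ _ _
  (renewal_integral T tau g) (measurable_renewal_integral T tau g).

End renewal.

Section transport_entropy.
Local Open Scope ereal_scope.
Local Open Scope charge_scope.
Context {R : realType}.

Definition coupling (sigma1 sigma2 : probability R R)
    (rho : probability (R * R)%type R) : Prop :=
  (forall A : set R, measurable A -> rho (A `*` setT) = sigma1 A) /\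
  (forall B : set R, measurable B -> rho (setT `*` B) = sigma2 B).

Definition transport_cost (d : R -> R -> R) (sigma1 sigma2 : probability R R) :
    \bar R :=
  ereal_inf [set \int[rho]_z (d z.1 z.2)%:E |
             rho in [set rho | coupling sigma1 sigma2 rho]].

Definition finite_first_moment (d : R -> R -> R) (sigma : probability R R) :=
  exists x0 : R, \int[sigma]_x (d x0 x)%:E < +oo.

Definition relative_entropy (sigma1 sigma2 : probability R R) : \bar R :=
  if `[< sigma1 `<< sigma2 >]
  then \int[sigma1]_x
         lne (('d (charge_of_finite_measure sigma1) '/d sigma2) x)
  else +oo.

(* Extended to x = +oo because a transport cost may a priori be infinite.     *)
Definition monotone_conjugate (k : R -> \bar R) (x : \bar R) : \bar R :=
  ereal_sup [set theta%:E * x - k theta | theta in [set theta | (0 <= theta)%R]].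

End transport_entropy.

Section constants.
Local Open Scope ereal_scope.
Context {R : realType}.
Implicit Types (f g h : R -> R) (T : R) (C : \bar R).

Definition lebesgue_on (T : R) :
    {measure set (measurableTypeR R) -> \bar R} :=
  mrestr lebesgue_measure (measurable_itv `[0%R, T]).

Definition tail_mass f T C : \bar R :=
  \int[lebesgue_measure]_(x in [set x | T%:E < x%:E < C]) (f x)%:E.

(* The inverse on \bar R satisfies 0^-1 = +oo and 0 * +oo = 0, so that 0 / 0  *)
(* is 0 and x / 0 is +oo for x > 0, here and everywhere below.                *)
Definition sup_ratio f T : \bar R :=
  ereal_sup [set ereal_sup [set (f (x - z))%:E / (f x)%:E | x in `[z, T]]
            | z in `[0%R, T]].

Definition renewal_beta f a T C : \bar R :=
  let supT := ereal_sup [set (f x)%:E | x in `[0%R, T]] in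
  let supC := ereal_sup [set (f x)%:E | x in [set x | 0 <= x%:E < C]] in
  let mina := ereal_inf [set (f x)%:E | x in `[a, T]] in
  maxe (supT / tail_mass f T C) (supC + supT ^+ 2 / mina).

Definition g2_lower_bound f g hbar (beta : \bar R) T C (t : R) : \bar R :=
  sqrte (2%:E * (hbar%:E ^+ 2 + (tail_mass f T C ^+ 2)^-1 - 1)) *
  sqrte (beta * \int[lebesgue_measure]_(s in `[t, T]) (g s ^+ 2)%:E +
         beta ^+ 2 * (\int[lebesgue_measure]_(s in `[t, T]) (`|g s|)%:E) ^+ 2).

Definition Lambda h (beta : \bar R) T (theta : R) : \bar R :=
  \int[lebesgue_measure]_(t in `[0%R, T])
    ((expR (theta * h t) - theta * h t - 1)%:E * beta).

Definition variance_bound h (beta : \bar R) T : \bar R :=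
  \int[lebesgue_measure]_(t in `[0%R, T]) ((h t ^+ 2)%:E * beta).

End constants.

(* Main.v *)
Require Import Defs.
From HB Require Import structures.
From mathcomp Require Import all_boot all_order all_algebra finmap.
From mathcomp Require Import all_classical all_reals all_analysis.
From mathcomp Require Import measurable_realfun ess_sup_inf.
From mathcomp Require Import ring lra.

Set Implicit Arguments.
Unset Strict Implicit.
Unset Printing Implicit Defensive.

Import Order.TTheory GRing.Theory Num.Theory.
Import numFieldNormedType.Exports.

Local Open Scope classical_set_scope.
Local Open Scope ring_scope.

(** By duality, the transport inequality follows from the exponential moment bound
E exp (theta (phi(G) - E phi(G))) <= exp (Lambda theta), for phi Lipschitz with
constant 1 and theta >= 0; the lower bound on the conjugate is elementary.

Exponential moments.  Let t be the tail mass and b = (sup f) / t, where the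
supremum is over [0, T]; then b <= beta, and b bounds the hazard rate of the
spacings on [0, T].  Let v(s, x) be the mean of phi(x + integral of g over the
points after s) when s is a renewal time.  Conditionally on a last renewal at s
and on no point in (s, r], the mean of phi(G) is the ratio of [aged_value] to
[survival], while a point at r turns it into v(r, x + g r).  The martingale of
conditional means thus jumps by at most
|g r| + |v(r, x) - aged_value s x r / survival s r|.
The second term compares a process renewed at r with one of age r - s.  The
densities p and q of their next point satisfy p <= hbar q, so a chi-square
estimate together with a second moment bound controls this term by the lower
bound imposed on g2 ([aged_value_dist]): jumps at time r are at most h r.  With
kappa x = e^x - x - 1, jumps at most h and intensity at most b, the process
exp (theta M_r + integral over [r, T] of b kappa (theta h))
is a supermartingale.  Between two points this is a computation of a derivative
([expR_one_jump]), which [potential_supermartingale] iterates over the points by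
independence of the spacings; almost surely the points leave [0, T], and Fatou's
lemma concludes ([expR_renewal_integral_le]).  The function v is obtained as the
solution of its renewal equation ([value_function_exists]), so conditional
expectations never appear.

Transport.  On the line the coupling by quantile functions is explicit, and the
distance between two quantiles is the increment of a single Lipschitz function,
whose slope is the sign of the difference of the distribution functions
([quantile_dist]).  Hence the cost is at most the difference of the means of
this function ([transport_cost_le]), and the Donsker-Varadhan inequality with
theta (phi - E phi) - Lambda theta bounds theta times that difference
([transport_entropy_le]).  The exponential bounds are centred at v(0, 0), which is
at most the mean of phi(G) by their behaviour near theta = 0
([le_mean_of_expR_bounds]).

Conjugate.  As kappa (e y) <= e^2 kappa y for e in [0, 1] and y >= 0, a bound
h <= M gives Lambda theta <= V kappa (theta M) / M^2, and the value of the
conjugate is tested at theta = ln (1 + x M / V) / M ([bennett_le_conjugate]). *)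

(** * Calculus of absolutely continuous functions *)

Lemma measurable_ler_indicator d (U : measurableType d) (R : realType) (u v : U -> R) :
  measurable_fun setT u -> measurable_fun setT v ->
  measurable_fun setT (fun x => (u x <= v x)%R%:R : R).
Proof.
move=> mu mv; apply: (@measurableT_comp _ _ _ _ _ _ (fun b : bool => b%:R : R)) => //.
exact: measurable_fun_ler.
Qed.

Section parametric_integrals.
Context d1 d2 (T1 : measurableType d1) (T2 : measurableType d2) (R : realType).
Variable m2 : {sigma_finite_measure set T2 -> \bar R}.

Lemma measurable_integral_param (f : T1 * T2 -> \bar R) :
  measurable_fun setT f -> (forall z, (0 <= f z)%E) ->
  measurable_fun setT (fun x => \int[m2]_y f (x, y))%E.
Proof. by move=> mf f0; exact: (measurable_fun_fubini_tonelli_F f mf f0). Qed.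

Lemma measurable_Rintegral_param (D : set T2) (f : T1 * T2 -> R) :
  measurable D -> measurable_fun setT f ->
  measurable_fun setT (fun x => \int[m2]_(y in D) f (x, y)).
Proof.
move=> mD mf; apply: measurableT_comp => //.
pose F (z : T1 * T2) := ((f z * \1_D z.2)%:E)%E.
have mF : measurable_fun setT F.
  apply/measurable_EFinP; apply: measurable_funM => //.
  by apply: measurableT_comp => //; exact: measurable_indic.
rewrite (_ : (fun x => _) = fun x =>
    (\int[m2]_y (F^\+)%E (x, y) - \int[m2]_y (F^\-)%E (x, y))%E); last first.
  apply/funext => x; rewrite integral_mkcond integralE; congr (_ - _)%E;
    apply: eq_integral => y _; rewrite /F ?funeposE ?funenegE patchE/= indicE;
    by case: (y \in D); rewrite ?mulr1 ?mulr0.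
apply: emeasurable_funB; apply: measurable_integral_param => //.
- exact: measurable_funepos.
- exact: measurable_funeneg.
Qed.

End parametric_integrals.

Section primitives.
Context {R : realType}.
Notation mu := (@lebesgue_measure R).
Implicit Types (a b r : R) (A B : R -> R).

(** Absolute continuity with derivative [alpha], in integrated form: it is
stable under the operations below without any differentiability. *)
Definition primitive_on a b A (alpha : R -> R) :=
  mu.-integrable `[a, b] (EFin \o alpha) /\
  forall r, r \in `[a, b] -> A r = A a + \int[mu]_(y in `[a, r]) alpha y.

Lemma integrable_itvccl a b r (alpha : R -> R) : r <= b ->
  mu.-integrable `[a, b] (EFin \o alpha) -> mu.-integrable `[a, r] (EFin \o alpha).
Proof. by move=> rb; apply: integrableS => //; apply: subset_itvl; rewrite bnd_simp. Qed.

Lemma integrable_itvccr a b r (alpha : R -> R) : a <= r ->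
  mu.-integrable `[a, b] (EFin \o alpha) -> mu.-integrable `[r, b] (EFin \o alpha).
Proof. by move=> rb; apply: integrableS => //; apply: subset_itvr; rewrite bnd_simp. Qed.

Lemma Rintegral_itvcc_cat a r b (alpha : R -> R) : a <= r -> r <= b ->
  mu.-integrable `[a, b] (EFin \o alpha) ->
  \int[mu]_(y in `[a, b]) alpha y =
  \int[mu]_(y in `[a, r]) alpha y + \int[mu]_(y in `[r, b]) alpha y.
Proof.
move=> ar rb ia.
rewrite -(@Rintegral_itv_obnd_cbnd _ r); last first.
  apply: (integrableS _ _ _ ia) => //.
  by apply: subset_itvr; rewrite bnd_simp.
by rewrite -(@Rintegral_itvB _ _ (BLeft a) (BRight b) r) ?bnd_simp// subrKC.
Qed.

Lemma Rintegral_itv1 a (alpha : R -> R) : \int[mu]_(y in `[a, a]) alpha y = 0.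
Proof. by rewrite set_itv1 Rintegral_set1. Qed.

Lemma Rintegral_indicator_from T s (u : R -> R) : 0 <= s ->
  \int[mu]_(r in `[0, T]) (u r * (s <= r)%R%:R) =
  \int[mu]_(r in `[s, T]) u r.
Proof.
move=> s0; rewrite [LHS]Rintegral_mkcond [RHS]Rintegral_mkcond.
apply: eq_Rintegral => r _; rewrite !patchE !mem_setE !in_itv/=.
case: (leP s r) => sr/=; first by rewrite (le_trans s0 sr)/= mulr1.
by rewrite mulr0 if_same.
Qed.

Let integrable_triangle (u v : R -> R) :
  mu.-integrable setT (EFin \o u) -> mu.-integrable setT (EFin \o v) ->
  (mu \x mu)%E.-integrable setT
    (fun z : R * R => (u z.1 * v z.2 * (z.2 <= z.1)%R%:R)%:E).
Proof.
move=> iu iv.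
have mu_ : measurable_fun setT u by apply/measurable_EFinP; exact: measurable_int iu.
have mv_ : measurable_fun setT v by apply/measurable_EFinP; exact: measurable_int iv.
have mf : measurable_fun setT (fun z : R * R => (u z.1 * v z.2 * (z.2 <= z.1)%R%:R)%:E).
  apply/measurable_EFinP; apply: measurable_funM.
    by apply: measurable_funM; exact: measurableT_comp.
  exact: measurable_ler_indicator.
apply/integrable12ltyP => //.
apply: (@le_lt_trans _ _ (\int[mu]_x (`|u x|%:E * \int[mu]_y `|v y|%:E))%E).
  apply: ge0_le_integral => //.
  - by move=> x _; apply: integral_ge0.
  - apply: (@measurable_integral_param _ _ _ _ _ mu (fun z => `|(u z.1 * v z.2 * (z.2 <= z.1)%R%:R)%:E|%E)) => //.
    exact: measurableT_comp.
  - apply: emeasurable_funM; last exact: measurable_cst.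
    by apply/measurable_EFinP; exact: measurableT_comp.
  - move=> x _; rewrite -ge0_integralZl//.
    + apply: ge0_le_integral => //.
      * apply: measurableT_comp => //.
        exact: (measurableT_comp mf (pair1_measurable x)).
      * apply: measurable_funeM; apply/measurable_EFinP; exact: measurableT_comp.
      * move=> y _ /=; rewrite ?abse_EFin -?EFinM lee_fin !normrM.
        by case: (y <= x) => /=; rewrite ?normr1 ?mulr1// normr0 mulr0 mulr_ge0.
    + by apply/measurable_EFinP; exact: measurableT_comp.
move/integrableP : iv => [_ iv]; move/integrableP : iu => [_ iu].
rewrite ge0_integralZr//; last 2 first.
- by apply/measurable_EFinP; exact: measurableT_comp.
- exact: integral_ge0.
by apply: lte_mul_pinfty => //; [exact: integral_ge0|rewrite ge0_fin_numE//; exact: integral_ge0].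
Qed.

(** Both sides are the integral of [alpha y * beta z] over the triangle
[a <= z <= y <= b]. *)
Lemma Rintegral_parts a b (alpha beta : R -> R) :
  mu.-integrable `[a, b] (EFin \o alpha) -> mu.-integrable `[a, b] (EFin \o beta) ->
  \int[mu]_(y in `[a, b]) (alpha y * \int[mu]_(z in `[a, y]) beta z) =
  \int[mu]_(y in `[a, b]) (beta y * \int[mu]_(z in `[y, b]) alpha z).
Proof.
move=> ia ib.
pose u := alpha \_ `[a, b]; pose v := beta \_ `[a, b].
have iu : mu.-integrable setT (EFin \o u).
  by rewrite -restrict_EFin; apply/integrable_restrict => //=; rewrite setTI.
have iv : mu.-integrable setT (EFin \o v).
  by rewrite -restrict_EFin; apply/integrable_restrict => //=; rewrite setTI.
have := Fubini (integrable_triangle iu iv).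
move=> /(congr1 fine)/=.
have -> : fine (\int[mu]_x \int[mu]_y (u x * v y * (y <= x)%R%:R)%:E)%E =
   \int[mu]_(y in `[a, b]) (alpha y * \int[mu]_(z in `[a, y]) beta z).
  rewrite Rintegral_mkcond/= /Rintegral; congr fine; apply: eq_integral => x _.
  rewrite patchE; case: ifPn => [xab|xab]; last first.
    rewrite integral0_eq// => y _.
    by rewrite /u patchE (negbTE xab) !mul0r.
  have /= := xab; rewrite inE/= in_itv/= => /andP[ax xb].
  have ibx : mu.-integrable `[a, x] (EFin \o beta) by exact: integrable_itvccl ib.
  rewrite EFinM /Rintegral fineK; last exact: integrable_fin_num.
  rewrite -integralZl//= [RHS]integral_mkcond/=.
  apply: eq_integral => y _; rewrite /u /v !patchE xab.
  rewrite !mem_setE !in_itv/=.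
  case: (leP a y) => //= ay; last by rewrite mulr0 mul0r.
  case: (leP y x) => //= yx; last by rewrite mulr0.
  by rewrite (le_trans yx xb) mulr1.
have -> : fine (\int[mu]_y \int[mu]_x (u x * v y * (y <= x)%R%:R)%:E)%E =
   \int[mu]_(y in `[a, b]) (beta y * \int[mu]_(z in `[y, b]) alpha z).
  rewrite [RHS]Rintegral_mkcond/= /Rintegral; congr fine; apply: eq_integral => y _.
  rewrite patchE; case: ifPn => [xab|xab]; last first.
    rewrite integral0_eq// => x _.
    by rewrite /v patchE (negbTE xab) mulr0 mul0r.
  have /= := xab; rewrite inE/= in_itv/= => /andP[ay yb].
  have iby : mu.-integrable `[y, b] (EFin \o alpha) by exact: integrable_itvccr ia.
  rewrite EFinM /Rintegral fineK; last exact: integrable_fin_num.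
  rewrite -integralZl//= [RHS]integral_mkcond/=.
  apply: eq_integral => x _; rewrite /u /v !patchE xab.
  rewrite !mem_setE !in_itv/=.
  case: (leP y x) => //= yx; last by rewrite mulr0.
  by rewrite (le_trans ay yx) mulr1/=; case: (leP x b) => xb; rewrite ?mul0r// mulrC.
by [].
Qed.

End primitives.

Section primitives2.
Context {R : realType}.
Notation mu := (@lebesgue_measure R).
Implicit Types (a b r : R) (A B : R -> R).

Lemma eq_primitive_on a b A B (alpha beta : R -> R) :
  {in `[a, b], A =1 B} -> {in `[a, b], alpha =1 beta} ->
  primitive_on a b A alpha -> primitive_on a b B beta.
Proof.
move=> AB ab [ia Aa]; split.
  apply: eq_integrable ia => // x; rewrite inE/= => xab.
  by rewrite ab.
move=> r rab; rewrite -AB// -AB; last first.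
  by move: rab; rewrite !in_itv/= lexx => /andP[ar rb]; exact: le_trans rb.
rewrite Aa//; congr (_ + _); apply: eq_Rintegral => y; rewrite inE/= => yar.
apply: ab; move: yar rab; rewrite !in_itv/= => /andP[-> yr] /andP[_ rb].
exact: le_trans rb.
Qed.

Lemma primitive_on_int a b c (alpha : R -> R) :
  mu.-integrable `[a, b] (EFin \o alpha) ->
  primitive_on a b (fun r => c + \int[mu]_(y in `[a, r]) alpha y) alpha.
Proof. by move=> ia; split=> // r rab; rewrite Rintegral_itv1 addr0. Qed.

Lemma primitive_on_cst a b c : primitive_on a b (cst c) (cst 0).
Proof.
split; first by apply: integrable0.
by move=> r _; rewrite Rintegral_cst//= mul0r addr0.
Qed.

Lemma primitive_onD a b A B (alpha beta : R -> R) :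
  primitive_on a b A alpha -> primitive_on a b B beta ->
  primitive_on a b (fun r => A r + B r) (fun r => alpha r + beta r).
Proof.
move=> [ia Aa] [ib Bb]; split; first exact: (integrableD _ ia ib).
move=> r rab; rewrite Aa// Bb// RintegralD//.
- by rewrite addrACA.
- by apply: integrable_itvccl ia; rewrite (itvP rab).
- by apply: integrable_itvccl ib; rewrite (itvP rab).
Qed.

Lemma primitive_onZ a b A (alpha : R -> R) c :
  primitive_on a b A alpha ->
  primitive_on a b (fun r => c * A r) (fun r => c * alpha r).
Proof.
move=> [ia Aa]; split; first exact: (integrableZl _ _ ia).
move=> r rab; rewrite Aa// RintegralZl//; last first.
  by apply: integrable_itvccl ia; rewrite (itvP rab).
by rewrite mulrDr.
Qed.

Lemma primitive_on_bounded a b A (alpha : R -> R) :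
  primitive_on a b A alpha ->
  exists2 M : R, 0 <= M & {in `[a, b], forall r, `|A r| <= M}.
Proof.
move=> [ia Aa]; exists (`|A a| + \int[mu]_(y in `[a, b]) `|alpha y|).
  by rewrite addr_ge0// Rintegral_ge0.
move=> r rab; rewrite Aa// (le_trans (ler_normD _ _))// lerD2l.
have rb : r <= b by rewrite (itvP rab).
have ar : a <= r by rewrite (itvP rab).
have iar := integrable_itvccl rb ia.
apply: (le_trans (le_normr_Rintegral _ _)) => //.
rewrite [leRHS](Rintegral_itvcc_cat ar rb) ?lerDl ?Rintegral_ge0//.
exact: (integrable_norm ia).
Qed.

Lemma primitive_on_continuous a b A (alpha : R -> R) : a <= b ->
  primitive_on a b A alpha -> {within `[a, b], continuous A}.
Proof.
move=> ab [ia Aa].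
apply: (@subspace_eq_continuous _ _ _
    (fun r => A a + \int[mu]_(y in `[a, r]) alpha y)).
  by move=> r; rewrite inE/= => rab; exact/esym/Aa.
move=> x; apply: cvgD; first exact: cvg_cst.
exact: parameterized_integral_continuous.
Qed.

Lemma primitive_on_measurable a b A (alpha : R -> R) : a <= b ->
  primitive_on a b A alpha -> measurable_fun `[a, b] A.
Proof.
move=> ab Aa; apply: subspace_continuous_measurable_fun => //.
exact: primitive_on_continuous Aa.
Qed.

Lemma integrable_bounded_mul a b A (u : R -> R) :
  mu.-integrable `[a, b] (EFin \o u) ->
  measurable_fun `[a, b] A ->
  (exists2 M : R, 0 <= M & {in `[a, b], forall r, `|A r| <= M}) ->
  mu.-integrable `[a, b] (EFin \o (fun r => u r * A r)).
Proof.
move=> iu mA [M M0 AM].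
apply: (le_integrable _ _ _ (integrableZl _ M iu)) => //.
  apply/measurable_EFinP; apply: measurable_funM => //.
  by apply/measurable_EFinP; exact: measurable_int iu.
move=> x xab /=; rewrite lee_fin !normrM mulrC ler_wpM2r//.
by rewrite (ger0_norm M0) AM.
Qed.

Lemma integrable_mul_primitive a b A (alpha u : R -> R) : a <= b ->
  mu.-integrable `[a, b] (EFin \o u) -> primitive_on a b A alpha ->
  mu.-integrable `[a, b] (EFin \o (fun r => u r * A r)).
Proof.
move=> ab iu Aa; apply: integrable_bounded_mul => //.
  exact: primitive_on_measurable Aa.
exact: primitive_on_bounded Aa.
Qed.

(** Integration by parts is applied to the integrals [I], [J] of [alpha], [beta],
which differ from [A], [B] by constants. *)
Lemma primitive_onM a b A B (alpha beta : R -> R) : a <= b ->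
  primitive_on a b A alpha -> primitive_on a b B beta ->
  primitive_on a b (fun r => A r * B r) (fun r => alpha r * B r + beta r * A r).
Proof.
move=> ab PA PB; have [ia Aa] := PA; have [ib Bb] := PB; split.
  exact: (integrableD _ (integrable_mul_primitive ab ia PB)
    (integrable_mul_primitive ab ib PA)).
move=> r rab; have rb : r <= b by rewrite (itvP rab).
have ar : a <= r by rewrite (itvP rab).
have iar := integrable_itvccl rb ia; have ibr := integrable_itvccl rb ib.
pose I := fun r => \int[mu]_(y in `[a, r]) alpha y.
pose J := fun r => \int[mu]_(y in `[a, r]) beta y.
have PI : primitive_on a r I alpha.
  by apply: eq_primitive_on (primitive_on_int 0 iar) => // x _; rewrite add0r.
have PJ : primitive_on a r J beta.
  by apply: eq_primitive_on (primitive_on_int 0 ibr) => // x _; rewrite add0r.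
have iaJ := integrable_mul_primitive ar iar PJ.
have ibI := integrable_mul_primitive ar ibr PI.
have sub y : y \in `[a, r] -> y \in `[a, b].
  by rewrite !in_itv/= => /andP[-> yr]; exact: le_trans rb.
rewrite (_ : \int[mu]_(y in _) _ =
    \int[mu]_(y in `[a, r]) (B a * alpha y + alpha y * J y +
      (A a * beta y + beta y * I y))); last first.
  apply: eq_Rintegral => y; rewrite inE/= => /sub yab.
  by rewrite (Aa y)// (Bb y)// /I /J; ring.
have iBa : mu.-integrable `[a, r] (EFin \o (fun y => B a * alpha y)).
  exact: (integrableZl _ _ iar).
have iAb : mu.-integrable `[a, r] (EFin \o (fun y => A a * beta y)).
  exact: (integrableZl _ _ ibr).
rewrite RintegralD//; [|exact: (integrableD _ iBa iaJ)|exact: (integrableD _ iAb ibI)].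
rewrite !RintegralD// !RintegralZl//.
have -> : \int[mu]_(x in `[a, r]) (alpha x * J x) =
    I r * J r - \int[mu]_(x in `[a, r]) (beta x * I x).
  rewrite /J Rintegral_parts// -RintegralZl//.
  rewrite -RintegralB//; last exact: (integrableZl _ _ ibr).
  apply: eq_Rintegral => y; rewrite inE/= => yar.
  rewrite {1}/I (@Rintegral_itvcc_cat _ a y r) ?(itvP yar)//.
  by rewrite /I; ring.
by rewrite (Aa r)// (Bb r)// /I /J; ring.
Qed.

Lemma primitive_onX a b A (alpha : R -> R) n : a <= b ->
  primitive_on a b A alpha ->
  primitive_on a b (fun r => A r ^+ n.+1) (fun r => alpha r * (n.+1%:R * A r ^+ n)).
Proof.
move=> ab PA; elim: n => [|n IH].
  apply: eq_primitive_on PA => r _; first by rewrite expr1.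
  by rewrite expr0 !mulr1.
apply: eq_primitive_on (primitive_onM ab PA IH) => r _; first by rewrite -exprS.
by rewrite !exprS -[in RHS]natr1; ring.
Qed.

(** The exponential series converges boundedly on the range of [K], so the
power rule passes to the limit under the integral sign. *)
Lemma primitive_on_exp a b K (k : R -> R) : a <= b ->
  primitive_on a b K k ->
  primitive_on a b (fun r => expR (K r)) (fun r => k r * expR (K r)).
Proof.
move=> ab PK; have [ik Kk] := PK.
have [M M0 KM] := primitive_on_bounded PK.
have mK := primitive_on_measurable ab PK.
have mE : measurable_fun `[a, b] (fun r => expR (K r)).
  by apply: measurableT_comp => //; exact: measurable_expR.
have iE : mu.-integrable `[a, b] (EFin \o (fun r => k r * expR (K r))).
  apply: integrable_bounded_mul => //; exists (expR M); first exact: expR_ge0.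
  move=> r rab; rewrite ger0_norm ?expR_ge0// ler_expR.
  by rewrite (le_trans (ler_norm _))// KM.
split=> // r rab.
have rb : r <= b by rewrite (itvP rab).
have ar : a <= r by rewrite (itvP rab).
pose S n x := series (exp_coeff (K x)) n.
have PS n : primitive_on a b (S n.+1) (fun x => k x * S n x).
  elim: n => [|n IH].
    apply: eq_primitive_on (primitive_on_cst a b 1) => // x _.
      by rewrite /S /series/= big_nat1 /exp_coeff/= expr0 divr1.
    by rewrite /S /series/= big_nil mulr0.
  have := primitive_onD IH (primitive_onZ (n.+1`!%:R^-1) (primitive_onX n ab PK)).
  apply: eq_primitive_on => x _; rewrite /S [in RHS]seriesSr//=.
    by rewrite /exp_coeff/= mulrC.
  rewrite mulrDr; congr (_ + _); rewrite /exp_coeff/=.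
  rewrite factS natrM invfM mulrCA; congr (_ * _).
  rewrite mulrACA mulVf ?mul1r ?pnatr_eq0//; last first.
  by rewrite mulrC.
have Scvg x : S n x @[n --> \oo] --> expR (K x) by exact: is_cvg_series_exp_coeff.
have SM n x : `|S n x| <= expR `|K x|.
  rewrite /S /series/= (le_trans (ler_norm_sum _ _ _))//.
  rewrite (_ : \sum_(0 <= i < n) _ = series (exp_coeff `|K x|) n); last first.
    rewrite /series/=; apply: eq_bigr => i _.
    by rewrite /exp_coeff/= normrM normrX (@ger0_norm _ (_^-1)).
  apply: (@nondecreasing_cvgn_le _ (series (exp_coeff `|K x|))).
    by apply: nondecreasing_series => i _ _; exact: exp_coeff_ge0.
  exact: is_cvg_series_exp_coeff.
have iar := integrable_itvccl rb ik.
have mkr : measurable_fun `[a, r] k.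
  by apply/measurable_EFinP; exact: measurable_int iar.
have mKr : measurable_fun `[a, r] K.
  apply: measurable_funS mK => //; apply: subset_itvl; by rewrite bnd_simp.
have kS n : measurable_fun `[a, r] (EFin \o (fun x => k x * S n x)).
  apply/measurable_EFinP; apply: measurable_funM => //.
  rewrite /S /series/=; apply: measurable_sum => i.
  apply: measurable_funM => //; exact: measurable_funX.
have mkE : measurable_fun `[a, r] (EFin \o (fun x => k x * expR (K x))).
  apply/measurable_EFinP; apply: measurable_funM => //.
  by apply: measurableT_comp => //; exact: measurable_expR.
have igM : mu.-integrable `[a, r] (EFin \o (fun x => expR M * `|k x|)).
  exact: (integrableZl _ (expR M) (integrable_norm iar)).
have [] := @dominated_convergence _ _ _ mu `[a, r]%classic (measurable_itv _)
    (fun n => EFin \o (fun x => k x * S n x)) (EFin \o (fun x => k x * expR (K x)))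
    (EFin \o (fun x => expR M * `|k x|)) kS mkE _ igM.
- apply: aeW => x _; apply: cvg_EFin; first by near=> n.
  by apply: cvgMr; exact: Scvg.
- apply: aeW => x n xar /=; rewrite lee_fin normrM mulrC ler_wpM2r//.
  rewrite (le_trans (SM _ _))// ler_expR KM//.
  by move: xar; rewrite /= !in_itv/= => /andP[-> xr]; exact: le_trans rb.
move=> ikE _; rewrite -(fineK (integrable_fin_num _ ikE))// => /fine_cvg Icvg.
have Icvg' : \int[mu]_(y in `[a, r]) (k y * S n y) @[n --> \oo] -->
  \int[mu]_(y in `[a, r]) (k y * expR (K y)) by exact: Icvg.
have Sr n : S n.+1 r = S n.+1 a + \int[mu]_(y in `[a, r]) (k y * S n y).
  by have [_ ->] := PS n.
have SScvg x : S n.+1 x @[n --> \oo] --> expR (K x).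
  by rewrite (cvg_shiftS (S ^~ x)).
have Srcvg : S n.+1 r @[n --> \oo] -->
    expR (K a) + \int[mu]_(y in `[a, r]) (k y * expR (K y)).
  by under eq_cvg do rewrite Sr; exact: cvgD (SScvg a) Icvg'.
exact: (cvg_unique _ (SScvg r) Srcvg).
Unshelve. all: by end_near. Qed.

End primitives2.

(** * The function behind Bennett type bounds, and one jump *)

Section kappa.
Context {R : realType}.
Implicit Types x y : R.

Definition kappa x := expR x - x - 1.

Lemma kappa_ge0 x : 0 <= kappa x.
Proof. by rewrite /kappa; have := expR_ge1Dx x; lra. Qed.

Lemma kappa0 : kappa (0 : R) = 0.
Proof. by rewrite /kappa expR0; lra. Qed.

(** With [e^y = e^x e^(y - x)], the increment is at least [(e^x - 1) (y - x)]. *)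
Lemma le_kappa x y : 0 <= x -> x <= y -> kappa x <= kappa y.
Proof.
move=> x0 xy; rewrite /kappa.
have E : expR y = expR x * expR (y - x) by rewrite -expRD; congr expR; lra.
have := expR_ge1Dx (y - x); have := expR_ge1Dx x; rewrite E.
set A := expR x; set B := expR _ => *; nra.
Qed.

Lemma ler_sinh x : 0 <= x -> 2 * x <= expR x - expR (- x).
Proof.
move=> x0.
pose F := fun t : R => expR t - expR (- t) - 2 * t.
have dF (t : R) : is_derive t 1 F (expR t + expR (- t) - 2).
  by apply: is_derive_eq; rewrite /GRing.scale/=; lra.
suff : F 0 <= F x by rewrite /F oppr0 subrr mulr0 !subr0 subr_ge0.
apply: (@ger0_derive1_ndecry _ F 0) => //.
- move=> t _; rewrite derive1E derive_val.
  have : 1 <= expR t * expR (- t) by rewrite -expRD subrr expR0.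
  have := expR_gt0 t; have := expR_gt0 (- t).
  move: (expR t) (expR _) => A B B0 A0 AB.
  by have := sqr_ge0 (A - B); nra.
- apply: continuous_subspaceT => t.
  by apply: differentiable_continuous; apply/derivable1_diffP.
Qed.

(** Negative jumps are no worse than positive ones of the same size, since
[kappa y - kappa (- y) = 2 (sinh y - y)]. *)
Lemma kappa_le x y : `|x| <= y -> kappa x <= kappa y.
Proof.
move=> xy; have [x0|x0] := leP 0 x.
  by apply: le_kappa => //; rewrite -(ger0_norm x0).
have y0 : 0 <= y by exact: le_trans xy.
apply: (@le_trans _ _ (kappa (- x))); last first.
  by apply: le_kappa; [lra|rewrite -(ler0_norm (ltW x0))].
have := @ler_sinh (- x); rewrite /kappa opprK => /(_ _)/wrap[]; lra.
Qed.

Lemma expR_convex0 (e x : R) : 0 <= e -> e <= 1 ->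
  expR (e * x) <= 1 - e + e * expR x.
Proof.
move=> e0 e1; have := convex_expR (Itv01 e0 e1) (x : R^o) 0.
rewrite !convRE /= expR0 mulr0 addr0 mulr1 [X in _ + X](_ : _ = 1 - e)//.
lra.
Qed.

(** The quotient [kappa x / x^2] increases; the form without division comes from
the derivative of the difference, which is nonnegative by convexity of [expR]. *)
Lemma kappaM_le (e x : R) : 0 <= e -> e <= 1 -> 0 <= x ->
  kappa (e * x) <= e ^+ 2 * kappa x.
Proof.
move=> e0 e1 x0; rewrite /kappa.
pose F := fun y : R => e ^+ 2 * (expR y - y - 1) - (expR (e * y) - e * y - 1).
have dF (y : R) : is_derive y 1 F (e * (e * (expR y - 1) - (expR (e * y) - 1))).
  by apply: is_derive_eq; rewrite /GRing.scale/=; ring.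
suff : F 0 <= F x by rewrite /F mulr0 expR0; lra.
apply: (@ger0_derive1_ndecry _ F 0) => //.
- move=> y _; rewrite derive1E derive_val mulr_ge0//.
  by have := expR_convex0 y e0 e1; lra.
- apply: continuous_subspaceT => y.
  by apply: differentiable_continuous; apply/derivable1_diffP.
Qed.

Lemma measurable_kappa : measurable_fun setT kappa.
Proof.
by apply: measurable_funB => //; apply: measurable_funB => //; exact: measurable_expR.
Qed.

End kappa.

Section one_step.
Context {R : realType}.
Notation mu := (@lebesgue_measure R).
Implicit Types (a b r : R) (A B : R -> R).

(** [E = exp (integral of p / P)] satisfies [(P E)' = 0], so [1 / P] is a multiple
of [E] and inherits its primitive. *)
Lemma primitive_onV a b P (p : R -> R) t : a <= b -> 0 < t ->
  primitive_on a b P (fun r => - p r) -> {in `[a, b], forall r, t <= P r} ->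
  primitive_on a b (fun r => (P r)^-1) (fun r => p r / P r ^+ 2).
Proof.
move=> ab t0 PP tP; have [ip _] := PP.
have P0 r : r \in `[a, b] -> 0 < P r by move=> /tP; exact: lt_le_trans.
have ip' : mu.-integrable `[a, b] (EFin \o p).
  apply: eq_integrable (integrableZl _ (-1) ip) => // x _ /=.
  by rewrite -EFinM mulN1r opprK.
have iq : mu.-integrable `[a, b] (EFin \o (fun r => p r * (P r)^-1)).
  apply: integrable_bounded_mul => //.
    apply: (eq_measurable_fun (fun r => expR (- ln (P r)))) => [r|].
      by rewrite inE/= => /P0 Pr0; rewrite expRN lnK ?posrE.
    apply: measurableT_comp; first exact: measurable_expR.
    apply: measurable_funN; apply: measurableT_comp => //.
    exact: primitive_on_measurable PP.
  exists t^-1; first by rewrite invr_ge0 ltW.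
  move=> r rab; rewrite normfV gtr0_norm ?P0// lef_pV2 ?posrE ?P0//; exact: tP.
have PE := primitive_on_exp ab (primitive_on_int 0 iq).
set E := (fun r => expR _) in PE.
have Ea : E a = 1 by rewrite /E Rintegral_itv1 addr0 expR0.
have [_ PEa] := primitive_onM ab PP PE.
have PEcst r : r \in `[a, b] -> P r * E r = P a.
  move=> rab; rewrite PEa// Ea mulr1 -[RHS]addr0; congr (_ + _).
  rewrite (@eq_Rintegral _ _ _ _ _ (cst 0)) ?Rintegral_cst// ?mul0r//.
  move=> y; rewrite inE/= => yar /=.
  have yab : y \in `[a, b].
    by move: yar rab; rewrite !in_itv/= => /andP[-> yr] /andP[_]; exact: le_trans.
  have /lt0r_neq0 Py0 := P0 _ yab.
  by rewrite -/(E y) [_ * P y]mulrAC divfK// mulNr addNr.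
have aab : a \in `[a, b] by rewrite in_itv/= lexx ab.
have EV r : r \in `[a, b] -> (P a)^-1 * E r = (P r)^-1.
  move=> rab; have := PEcst _ rab; have := P0 _ rab; have := P0 _ aab => a0 r0 <-.
  have E0 : E r != 0 by rewrite gt_eqF// expR_gt0.
  by field; rewrite E0 gt_eqF.
apply: eq_primitive_on (primitive_onZ (P a)^-1 PE) => r rab; first exact: EV.
rewrite mulrCA EV// expr2 invfM; ring.
Qed.

(** [p] is the density and [P] the survival function of the first point, which
yields the payoff [Y r] if it falls at [r] in [[a, b]] and [y] otherwise.
[N r / P r] is the mean payoff when that point is known to lie after [r], so
[Y r - N r / P r] is the jump of the martingale and [p / P] is its intensity.
The proof differentiates [P * expR (th * (N / P) + L)]. *)
Lemma expR_one_jump a b (P p Y N h k L : R -> R) (y beta th t : R) :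
  a <= b -> 0 < t -> 0 <= th ->
  primitive_on a b P (fun r => - p r) -> {in `[a, b], forall r, t <= P r} ->
  {in `[a, b], forall r, 0 <= p r <= beta * P r} ->
  measurable_fun `[a, b] Y ->
  primitive_on a b N (fun r => - (p r * Y r)) -> N b = P b * y ->
  primitive_on a b L (fun r => - k r) ->
  {in `[a, b], forall r, beta * kappa (th * h r) <= k r} ->
  {in `[a, b], forall r, `|Y r - N r / P r| <= h r} ->
  (\int[mu]_(r in `[a, b]) (p r * expR (th * Y r + L r))%:E +
   (P b * expR (th * y + L b))%:E <=
   (P a * expR (th * (N a / P a) + L a))%:E)%E.
Proof.
move=> ab t0 th0 PP tP ph mY PN Nb PL hk hY.
have P0 r : r \in `[a, b] -> 0 < P r by move=> /tP; exact: lt_le_trans.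
have PV := primitive_onV ab t0 PP tP.
have PZ := primitive_on_exp ab (primitive_onD
  (primitive_onZ th (primitive_onM ab PN PV)) PL).
have PD := primitive_onM ab PP PZ.
set Z := (fun r => expR _) in PZ PD.
set dD := (fun r => - p r * _ + _) in PD.
have [idD Da] := PD.
have bab : b \in `[a, b] by rewrite in_itv/= lexx ab.
have -> : P b * expR (th * y + L b) = P b * Z b.
  congr (_ * expR (_ * _ + _)).
  by have := P0 _ bab; rewrite Nb => /lt0r_neq0 Pb0; field.
rewrite -[expR (th * (N a / P a) + L a)]/(Z a).
have -> : P a * Z a = \int[mu]_(r in `[a, b]) (- dD r) + P b * Z b.
  have -> : \int[mu]_(r in `[a, b]) - dD r = - \int[mu]_(r in `[a, b]) dD r.
    rewrite -mulN1r -RintegralZl//; apply: eq_Rintegral => r _.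
    by rewrite mulN1r.
  have Db : P b * Z b = P a * Z a + \int[mu]_(r in `[a, b]) dD r := Da _ bab.
  by rewrite Db addrC addrK.
rewrite EFinD leeD2r// /Rintegral fineK; last first.
  apply: integrable_fin_num => //.
  apply: eq_integrable (integrableZl _ (-1) idD) => // x _ /=.
  by rewrite -EFinM mulN1r.
have mP := primitive_on_measurable ab PP.
have mL := primitive_on_measurable ab PL.
have [ip _] := PP.
have mp : measurable_fun `[a, b] p.
  rewrite (_ : p = (fun r => - (- p r))); last by apply/funext => r; rewrite opprK.
  apply: measurable_funN; apply/measurable_EFinP; exact: measurable_int ip.
apply: ge0_le_integral => //.
- by move=> r /= /ph/andP[p0 _]; rewrite lee_fin mulr_ge0 ?expR_ge0.
- apply/measurable_EFinP; apply: measurable_funM => //.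
  apply: measurableT_comp; first exact: measurable_expR.
  apply: measurable_funD => //; exact: measurable_funM.
- by apply/measurable_EFinP; apply: measurable_funN; apply/measurable_EFinP; exact: measurable_int idD.
move=> r /= rab; rewrite lee_fin.
have Pr0 := P0 _ rab; have /andP[p0 pb] := ph _ rab.
pose u := Y r - N r / P r.
have -> : expR (th * Y r + L r) = Z r * expR (th * u).
  rewrite /Z -expRD; congr expR; rewrite /u; ring.
(* [u] is the jump; the factor [k r * P r] pays for it. *)
have -> : - dD r = Z r * (p r * (1 + th * u) + k r * P r).
  rewrite /dD /u -/(Z r); move: (Z r) (p r) (N r) (Y r) (k r) (P r) Pr0.
  by move=> z q n v w c /lt0r_neq0 c0; field.
rewrite mulrCA ler_wpM2l ?expR_ge0//.
have : kappa (th * u) <= kappa (th * h r).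
  by apply: kappa_le; rewrite normrM (ger0_norm th0) ler_wpM2l// hY.
have := kappa_ge0 (th * h r); have := hk _ rab.
rewrite [X in _ -> _ -> X <= _ -> _]/kappa.
move: (kappa _) (expR _) => K e hK K0 eK.
have h1 : p r * K <= beta * P r * K by rewrite ler_wpM2r.
have h2 : beta * K * P r <= k r * P r by rewrite ler_wpM2r// ltW.
have h3 : p r * (e - th * u - 1) <= p r * K by rewrite ler_wpM2l.
lra.
Qed.

End one_step.

(** * Spacings: survival and hazard rate *)

Section translation.
Context {R : realType}.
Notation mu := (@lebesgue_measure R).

Let sub_fun (s : R) : measurableTypeR R -> measurableTypeR R := fun x => x - s.

Let measurable_sub_fun s : measurable_fun setT (sub_fun s).
Proof. exact: (@measurable_funB _ (measurableTypeR R)). Qed.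

Let pushforward_sub (s : R) (A : set R) : measurable A ->
  pushforward mu (sub_fun s) A = mu A.
Proof.
move=> mA; apply/esym/lebesgue_measure_unique => //= _ [[a b]] _ <-.
rewrite [RHS](_ : _ = mu `]a + s, b + s]); last first.
  rewrite /pushforward; congr (mu _); apply/seteqP; split => x/=;
  by rewrite !in_itv/= /sub_fun; lra.
rewrite !lebesgue_measure_itv/= !lte_fin ltrD2r.
by case: ifPn => // _; rewrite -!EFinB; congr (_%:E); lra.
Qed.

Lemma ge0_integral_translate (s : R) (k : R -> \bar R) :
  measurable_fun setT k -> (forall x, (0 <= k x)%E) ->
  (\int[mu]_x k (x - s)%R = \int[mu]_x k x)%E.
Proof.
move=> mk k0; rewrite [RHS](eq_measure_integral (pushforward mu (sub_fun s))).
  by rewrite ge0_integral_pushforward//; exact: measurable_sub_fun.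
by move=> A mA _; apply/esym; exact: pushforward_sub.
Qed.

End translation.

Section survival.
Context {R : realType}.
Notation mu := (@lebesgue_measure R).
Variables (f : R -> R) (T t b : R).
Hypothesis f_ge0 : forall x : R, 0 <= f x.
Hypothesis mf : measurable_fun setT f.
Hypothesis f_int : (\int[mu]_x (f x)%:E = 1)%E.
Hypothesis f_neg : forall x : R, x < 0 -> f x = 0.
Hypothesis t_gt0 : 0 < t.
Hypothesis f_tail : \int[mu]_(x in `[0, T]) f x <= 1 - t.
Hypothesis f_le : forall x : R, 0 <= x <= T -> f x <= b * t.

(** Probability that the first point after a renewal at [s] lies after [r]. *)
Definition survival (s r : R) := 1 - \int[mu]_(y in `[s, r]) f (y - s).

Lemma measurable_translate (s : R) : measurable_fun setT (fun y : R => f (y - s)).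
Proof. by apply: measurableT_comp => //; exact: measurable_funB. Qed.

Lemma integrable_density (s : R) : mu.-integrable setT (EFin \o (fun y : R => f (y - s))).
Proof.
apply/integrableP; split.
  by apply/measurable_EFinP; exact: measurable_translate.
have -> : (\int[mu]_x `|(EFin \o (fun y : R => f (y - s)%R)) x| =
    \int[mu]_x (f (x - s)%R)%:E)%E.
  by apply: eq_integral => x _ /=; rewrite ger0_norm.
rewrite (ge0_integral_translate s (k := EFin \o f)) ?f_int ?ltry//.
exact/measurable_EFinP.
Qed.

Lemma integrable_densityS (s : R) (D : set R) : measurable D ->
  mu.-integrable D (EFin \o (fun y : R => f (y - s))).
Proof. by move=> mD; exact: integrableS (integrable_density s). Qed.

Lemma density_mass_le1 (s : R) (D : set R) : measurable D ->
  \int[mu]_(y in D) f (y - s) <= 1.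
Proof.
move=> mD; rewrite -[leRHS]/(fine (1%:E : \bar R)) -f_int.
rewrite -(ge0_integral_translate s (k := EFin \o f)); last 2 first.
- exact/measurable_EFinP.
- by move=> x; rewrite lee_fin.
apply: fine_le.
- exact: (integrable_fin_num _ (integrable_densityS s mD)).
- exact: (integrable_fin_num _ (integrable_density s)).
apply: ge0_subset_integral => //.
- by apply/measurable_EFinP; exact: measurable_translate.
- by move=> y _; rewrite lee_fin.
Qed.

Lemma translate_mass (s r : R) : \int[mu]_(y in `[s, r]) f (y - s) =
  \int[mu]_(y in `[0, r - s]) f y.
Proof.
rewrite /Rintegral [in RHS]integral_mkcond -(ge0_integral_translate s); last 2 first.
- apply/(measurable_restrictT _ _).1 => //.
  by apply/measurable_EFinP; exact: measurable_funTS.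
- by move=> x; rewrite patchE; case: ifP => // _; rewrite lee_fin.
rewrite [in LHS]integral_mkcond; congr fine; apply: eq_integral => x _.
rewrite !patchE !mem_setE !in_itv/=.
by rewrite subr_ge0 lerD2r.
Qed.

Lemma survivalss s : survival s s = 1.
Proof. by rewrite /survival Rintegral_itv1 subr0. Qed.

Lemma survival_le1 s r : survival s r <= 1.
Proof. by rewrite /survival gerBl Rintegral_ge0. Qed.

Lemma survival_ge s r : 0 <= s -> r <= T -> t <= survival s r.
Proof.
move=> s0 rT; rewrite /survival translate_mass.
suff : \int[mu]_(y in `[0, r - s]) f y <= \int[mu]_(y in `[0, T]) f y.
  by move: f_tail; lra.
have I D : measurable D -> (\int[mu]_(x in D) (f x)%:E)%E \is a fin_num.
  move=> mD; apply: integrable_fin_num => //.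
  have := integrable_densityS 0 mD.
  by apply: eq_integrable => // x _ /=; rewrite subr0.
apply: fine_le; [exact: I|exact: I|].
apply: ge0_subset_integral => //.
- by apply/measurable_EFinP; exact: measurable_funTS.
- by move=> y _; rewrite lee_fin.
- by apply: subset_itvl; rewrite bnd_simp; lra.
Qed.

Lemma survival_primitive s r : primitive_on s r (survival s) (fun y : R => - f (y - s)).
Proof.
have is_ := integrable_densityS s (measurable_itv `[s, r]).
apply: eq_primitive_on (primitive_onD (primitive_on_cst s r 1)
    (primitive_onZ (-1) (primitive_on_int 0 is_))) => x _.
  by rewrite /survival/= add0r mulN1r.
by rewrite /= add0r mulN1r.
Qed.

Lemma survival_increment s r r' : s <= r -> r <= r' ->
  \int[mu]_(y in `[r, r']) f (y - s) = survival s r - survival s r'.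
Proof.
move=> sr rr'; rewrite /survival (@Rintegral_itvcc_cat _ s r r')//; first by lra.
exact: integrable_densityS.
Qed.

Lemma hazard_bound_ge0 : 0 <= T -> 0 <= b.
Proof.
move=> T0; have : f 0 <= b * t by apply: f_le; lra.
have := f_ge0 0; move=> f0 f0b; rewrite -(pmulr_lge0 _ t_gt0); lra.
Qed.

(** [f (r - s) <= b t] and the survival probability is at least [t]. *)
Lemma hazard_le s r : 0 <= s -> s <= r -> r <= T ->
  0 <= f (r - s) <= b * survival s r.
Proof.
move=> s0 sr rT; rewrite f_ge0/=.
have b0 : 0 <= b by apply: hazard_bound_ge0; lra.
apply: (le_trans (f_le _)); first by lra.
by rewrite ler_wpM2l// survival_ge.
Qed.

Lemma Rintegral_from (s : R) (u : R -> R) : 0 <= s -> s <= T ->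
  \int[mu]_(r in `[0, T]) (f (r - s) * u r) =
  \int[mu]_(r in `[s, T]) (f (r - s) * u r).
Proof.
move=> s0 sT; rewrite [LHS]Rintegral_mkcond [RHS]Rintegral_mkcond.
apply: eq_Rintegral => r _; rewrite !patchE !mem_setE !in_itv/=.
case: (leP s r) => sr/=; first by rewrite (le_trans s0 sr).
by rewrite f_neg ?mul0r ?if_same//; lra.
Qed.

End survival.

(** * The mean of a Lipschitz functional after a renewal *)

Section value_function.
Context {R : realType}.
Notation mu := (@lebesgue_measure R).
Variables (f : R -> R) (T t b : R).
Hypothesis f_ge0 : forall x : R, 0 <= f x.
Hypothesis mf : measurable_fun setT f.
Hypothesis f_int : (\int[mu]_x (f x)%:E = 1)%E.
Hypothesis f_neg : forall x : R, x < 0 -> f x = 0.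
Hypothesis t_gt0 : 0 < t.
Hypothesis f_tail : \int[mu]_(x in `[0, T]) f x <= 1 - t.
Hypothesis f_le : forall x : R, 0 <= x <= T -> f x <= b * t.
Hypothesis T_ge0 : 0 <= T.
Variables (g : R -> R).
Hypothesis mg : measurable_fun setT g.
Hypothesis ig : mu.-integrable `[0, T] (EFin \o g).

Let b_ge0 : 0 <= b. Proof. exact: hazard_bound_ge0 t_gt0 f_le T_ge0. Qed.

(** Bound on the mean of the integral of [|g|] over the points still to come. *)
Definition remaining (s : R) :=
  b * \int[mu]_(r in `[0, T]) (`|g r| * (s <= r)%R%:R).

Lemma measurable_remaining : measurable_fun setT remaining.
Proof.
apply: measurable_funM => //.
apply: (@measurable_Rintegral_param _ _ _ _ _ mu `[0, T]%classic
  (fun z : R * R => `|g z.2| * (z.1 <= z.2)%R%:R)) => //.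
apply: measurable_funM; last exact: measurable_ler_indicator.
by apply: measurableT_comp => //; exact: measurableT_comp.
Qed.

Lemma remaining_ge0 s : 0 <= remaining s.
Proof. by rewrite mulr_ge0// Rintegral_ge0// => r _; rewrite mulr_ge0. Qed.

Lemma remainingE s : 0 <= s -> remaining s = b * \int[mu]_(r in `[s, T]) `|g r|.
Proof. by move=> s0; congr (_ * _); exact: Rintegral_indicator_from. Qed.

Lemma remaining_after s : T <= s -> remaining s = 0.
Proof.
move=> Ts; rewrite remainingE ?(le_trans T_ge0)//.
move: Ts; rewrite le_eqVlt => /predU1P[<-|Ts].
  by rewrite Rintegral_itv1 mulr0.
by rewrite set_itv_ge ?Rintegral_set0 ?mulr0// bnd_simp -ltNge.
Qed.

Let ig_ s r : 0 <= s -> r <= T -> mu.-integrable `[s, r] (EFin \o (fun y => `|g y|)).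
Proof.
move=> s0 rT; apply: integrableS (integrable_norm ig) => //.
by apply: subset_itv; rewrite bnd_simp.
Qed.

Lemma remaining_le s r : 0 <= s -> s <= r -> remaining r <= remaining s.
Proof.
move=> s0 sr; have [Tr|rT] := leP T r.
  by rewrite remaining_after// remaining_ge0.
rewrite !remainingE ?(le_trans s0 sr)// ler_wpM2l//.
rewrite (@Rintegral_itvcc_cat _ s r T) ?(ltW rT) ?ig_//.
by rewrite lerDr Rintegral_ge0.
Qed.

Lemma remaining_primitive s : 0 <= s ->
  primitive_on s T remaining (fun r => - (b * `|g r|)).
Proof.
move=> s0.
have is_ := ig_ s0 (lexx T).
apply: eq_primitive_on (primitive_onD (primitive_on_cst s T (remaining s))
    (primitive_onZ (- b) (primitive_on_int 0 is_))) => r; rewrite in_itv/=.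
  move=> /andP[sr rT].
  rewrite add0r !remainingE ?(le_trans s0 sr)//.
  by rewrite (@Rintegral_itvcc_cat _ s r T) ?ig_//=; lra.
by move=> _; rewrite /= add0r mulNr.
Qed.

(** This bound is the renewal equation for the mean of the integral of [|g|], with
an inequality because the intensity of the points is at most [b]: the derivative
of [survival * remaining] is at most minus the integrand on the left. *)
Lemma remaining_supersolution s : 0 <= s -> s <= T ->
  \int[mu]_(r in `[s, T]) (f (r - s) * (`|g r| + remaining r)) <= remaining s.
Proof.
move=> s0 sT.
have PS := survival_primitive f_ge0 mf f_int s T.
have PR := remaining_primitive s0.
have [iPR PSR] := primitive_onM sT PS PR.
have Ts : T \in `[s, T] by rewrite in_itv/= sT lexx.
have := PSR T Ts; rewrite remaining_after// mulr0 survivalss mul1r.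
set I := \int[mu]_(y in _) _ => I0.
have -> : remaining s = \int[mu]_(r in `[s, T]) (-1 *
   (- f (r - s) * remaining r + - (b * `|g r|) * survival f s r)).
  by rewrite RintegralZl// -/I mulN1r; apply/eqP; rewrite -subr_eq0 opprK -I0.
have mr : measurable_fun `[s, T] remaining.
  by apply: measurable_funS measurable_remaining.
have gT r : s <= r -> r <= T -> `|f (r - s) * (`|g r| + remaining r)| <=
  `|-1 * (- f (r - s) * remaining r + - (b * `|g r|) * survival f s r)|.
  move=> sr rT; have /andP[h0 h1] := hazard_le f_ge0 mf f_int t_gt0 f_tail f_le s0 sr rT.
  have r0 := remaining_ge0 r; have g0 := normr_ge0 (g r).
  rewrite ger0_norm ?mulr_ge0 ?addr_ge0//.
  apply: (le_trans _ (ler_norm _)).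
  have := ler_wpM2r g0 h1; lra.
have iR : mu.-integrable `[s, T] (EFin \o (fun r => -1 *
   (- f (r - s) * remaining r + - (b * `|g r|) * survival f s r))).
  exact: (integrableZl _ _ iPR).
apply: le_Rintegral => //.
  apply: (le_integrable _ _ _ iR) => //.
    apply/measurable_EFinP; apply: measurable_funM.
      by apply: measurable_funS (measurable_translate mf s).
    apply: measurable_funD => //.
    by apply: measurable_funTS; exact: measurableT_comp.
  by move=> r /=; rewrite in_itv/= => /andP[sr rT]; rewrite lee_fin gT.
move=> r /=; rewrite in_itv/= => /andP[sr rT].
have := gT _ sr rT; rewrite ger0_norm; last first.
  by rewrite mulr_ge0 ?addr_ge0 ?remaining_ge0.
move=> /le_trans; apply.
have /andP[h0 h1] := hazard_le f_ge0 mf f_int t_gt0 f_tail f_le s0 sr rT.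
rewrite ger0_norm//.
have r0 := remaining_ge0 r; have g0 := normr_ge0 (g r).
have := ler_wpM2r g0 h1; have := mulr_ge0 h0 r0; have := mulr_ge0 h0 g0; lra.
Qed.

End value_function.

Lemma lipschitz1_measurable (R : realType) (phi : R -> R) :
  (forall x y : R, `|phi x - phi y| <= `|x - y|) -> measurable_fun setT phi.
Proof.
move=> phi_lip; apply: continuous_measurable_fun => x.
apply/cvgrPdist_le => e e0.
have := @cvgr_dist_le _ _ _ (nbhs x) (nbhs_filter x) id x cvg_id e e0.
by apply: filterS => y; exact: le_trans.
Qed.

Section value_function.
Context {R : realType}.
Notation mu := (@lebesgue_measure R).
Variables (f : R -> R) (T t b : R).
Hypothesis f_ge0 : forall x : R, 0 <= f x.
Hypothesis mf : measurable_fun setT f.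
Hypothesis f_int : (\int[mu]_x (f x)%:E = 1)%E.
Hypothesis f_neg : forall x : R, x < 0 -> f x = 0.
Hypothesis t_gt0 : 0 < t.
Hypothesis f_tail : \int[mu]_(x in `[0, T]) f x <= 1 - t.
Hypothesis f_le : forall x : R, 0 <= x <= T -> f x <= b * t.
Hypothesis T_ge0 : 0 <= T.
Variables (g : R -> R).
Hypothesis mg : measurable_fun setT g.
Hypothesis ig : mu.-integrable `[0, T] (EFin \o g).

Notation remaining := (remaining T b g).

Let b_ge0 : 0 <= b. Proof. exact: hazard_bound_ge0 t_gt0 f_le T_ge0. Qed.
Let rem0 s : 0 <= remaining s. Proof. exact: remaining_ge0 t_gt0 f_le T_ge0 _ _. Qed.

Let jump_dom (s r : R) := f (r - s) * (`|g r| + remaining r).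

Let f_le_itv s r : 0 <= s -> r <= T -> f (r - s) <= b * t.
Proof.
move=> s0 rT; have [rs|sr] := ltP r s.
  by rewrite f_neg ?mulr_ge0 ?(ltW t_gt0)//; lra.
by apply: f_le; lra.
Qed.

Let measurable_jump_dom s (D : set R) : measurable_fun D (jump_dom s).
Proof.
apply: measurable_funTS; apply: measurable_funM.
  exact: measurable_translate.
by apply: measurable_funD; [exact: measurableT_comp|exact: measurable_remaining].
Qed.

Let jump_dom_ge0 s r : 0 <= jump_dom s r.
Proof. by rewrite /jump_dom mulr_ge0 ?addr_ge0. Qed.

Let integrable_jump_dom s : 0 <= s -> mu.-integrable `[0, T] (EFin \o jump_dom s).
Proof.
move=> s0.
have i1 : mu.-integrable `[0, T]
    (EFin \o (fun r => b * t * (`|g r| + remaining 0))).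
  suff i0 : mu.-integrable `[0, T] (EFin \o (fun r => `|g r| + remaining 0)).
    exact: (integrableZl _ _ i0).
  suff ic : mu.-integrable `[0, T] (EFin \o cst (remaining 0)).
    exact: (integrableD _ (integrable_norm ig) ic).
  apply: measurable_bounded_integrable => //.
    exact: compact_finite_measure (@segment_compact _ _ _).
  exact: bounded_cst.
apply: (le_integrable _ _ _ i1) => //.
  by apply/measurable_EFinP; exact: measurable_jump_dom.
move=> r /=; rewrite in_itv/= => /andP[r0 rT].
rewrite lee_fin ger0_norm// ger0_norm ?mulr_ge0 ?addr_ge0 ?(ltW t_gt0)//.
apply: ler_pM; rewrite ?addr_ge0//.
  exact: f_le_itv.
by rewrite lerD2l; exact: (remaining_le f_ge0 t_gt0 f_le T_ge0 ig).
Qed.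

Let Rintegral_jump_dom s : 0 <= s ->
  \int[mu]_(r in `[0, T]) jump_dom s r <= remaining s.
Proof.
move=> s0; have [sT|Ts] := leP s T.
  rewrite /jump_dom (Rintegral_from f_neg)//.
  exact: (remaining_supersolution f_ge0 mf f_int t_gt0 f_tail f_le T_ge0 mg ig).
rewrite (@eq_Rintegral _ _ _ _ _ (cst 0)); first by rewrite Rintegral_cst//= mul0r.
move=> r; rewrite inE/= in_itv/= => /andP[r0 rT].
by rewrite /jump_dom f_neg ?mul0r//; lra.
Qed.

(** Right-hand side of the renewal equation satisfied by [v s x], the mean of
[phi (x + \int g dN)] over the points [N] after a renewal at [s]: condition on
the first of them, at [r]. *)
Definition value_step (phi : R -> R) (v : R -> R -> R) (s x : R) :=
  phi x + \int[mu]_(r in `[0, T]) (f (r - s) * (v r (x + g r) - phi x)).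

(** What the functionals [E[phi (x + \int g dN) | renewal at s]] have in common
with all their approximations. *)
Record admissible (phi : R -> R) (v : R -> R -> R) : Prop := Admissible {
  adm_measurable : measurable_fun setT (fun z : R * R => v z.1 z.2) ;
  adm_near : forall s x : R, 0 <= s -> `|v s x - phi x| <= remaining s ;
  adm_lip : forall s x y : R, 0 <= s -> `|v s x - v s y| <= `|x - y| }.

Variable phi : R -> R.
Hypothesis phi_lip : forall x y : R, `|phi x - phi y| <= `|x - y|.

Let mphi := lipschitz1_measurable phi_lip.

Lemma jump_le v x r : admissible phi v -> 0 <= r ->
  `|v r (x + g r) - phi x| <= `|g r| + remaining r.
Proof.
move=> av r0.
rewrite (_ : _ - _ = (v r (x + g r) - v r x) + (v r x - phi x)); last by lra.
rewrite (le_trans (ler_normD _ _))// lerD//; last exact: adm_near av _ _ _.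
rewrite (le_trans (adm_lip av _ _ r0))//.
by rewrite addrAC subrr add0r.
Qed.

Lemma measurable_jump v : admissible phi v ->
  measurable_fun setT (fun z : (R * R) * R => f (z.2 - z.1.1) *
    (v z.2 (z.1.2 + g z.2) - phi z.1.2)).
Proof.
move=> [mv _ _]; apply: measurable_funM.
  apply: measurableT_comp => //; apply: measurable_funB => //.
  exact: measurableT_comp.
apply: measurable_funB.
  apply: (@measurableT_comp _ _ _ _ _ _ (fun z : R * R => v z.1 z.2) _
    (fun z : R * R * R => (z.2, z.1.2 + g z.2))) => //.
  apply/measurable_fun_pairP; split; first exact: measurable_snd.
  apply: measurable_funD; first exact: measurableT_comp.
  exact: measurableT_comp.
apply: measurableT_comp => //; exact: measurableT_comp.
Qed.

Let jump_fun (v : R -> R -> R) (s x r : R) := f (r - s) * (v r (x + g r) - phi x).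

Let measurable_jump_fun v s x (D : set R) : admissible phi v ->
  measurable_fun D (jump_fun v s x).
Proof.
move=> av; apply: measurable_funTS.
exact: (measurableT_comp (measurable_jump av) (pair1_measurable (s, x))).
Qed.

Let jump_fun_le v s x r : admissible phi v -> 0 <= r ->
  `|jump_fun v s x r| <= jump_dom s r.
Proof.
move=> av r0; rewrite /jump_fun /jump_dom normrM (ger0_norm (f_ge0 _)).
by rewrite ler_wpM2l// jump_le.
Qed.

Lemma integrable_jump v s x : admissible phi v -> 0 <= s ->
  mu.-integrable `[0, T]
    (EFin \o (fun r : R => f (r - s) * (v r (x + g r) - phi x))).
Proof.
move=> av s0; apply: (le_integrable _ _ _ (integrable_jump_dom s0)) => //.
  by apply/measurable_EFinP; exact: measurable_jump_fun.
move=> r /=; rewrite in_itv/= => /andP[r0 rT].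
rewrite lee_fin [leRHS]ger0_norm//.
exact: jump_fun_le.
Qed.

(** The step preserves the distance [remaining] to [phi] because [remaining] is a
supersolution, and the Lipschitz constant because it averages [v] and [phi]. *)
Lemma admissible_step v : admissible phi v -> admissible phi (value_step phi v).
Proof.
move=> av; split.
- rewrite /value_step; apply: measurable_funD; first exact: measurableT_comp.
  exact: (@measurable_Rintegral_param _ _ _ _ _ mu `[0, T]%classic
    (fun z : (R * R) * R => f (z.2 - z.1.1) *
      (v z.2 (z.1.2 + g z.2) - phi z.1.2)) (measurable_itv _) (measurable_jump av)).
- move=> s x s0; rewrite /value_step addrAC subrr add0r.
  apply: (le_trans (le_normr_Rintegral _ (integrable_jump x av s0))) => //.
  apply: (le_trans _ (Rintegral_jump_dom s0)).
  apply: le_Rintegral => //; first exact: (integrable_norm (integrable_jump x av s0)).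
    exact: integrable_jump_dom.
  by move=> r /=; rewrite in_itv/= => /andP[r0 _]; exact: jump_fun_le.
- move=> s x y s0; rewrite /value_step.
  set I := \int[mu]_(r in _) _; set J := \int[mu]_(r in _) _.
  pose p := \int[mu]_(r in `[0, T]) f (r - s).
  have p1 : p <= 1 by apply: density_mass_le1.
  have p0 : 0 <= p by apply: Rintegral_ge0.
  have iff := integrable_densityS f_ge0 mf f_int s (measurable_itv `[0, T]).
  have ix := integrable_jump x av s0; have iy := integrable_jump y av s0.
  have : `|I - J + p * (phi x - phi y)| <= p * `|x - y|.
    have iz : mu.-integrable `[0, T] (EFin \o (fun r : R => f (r - s) * (phi x - phi y))).
      exact: (integrableZr _ _ iff).
    rewrite /I /J /p -RintegralB// -RintegralZr// -RintegralD//; last first.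
      exact: (integrableB _ ix iy).
    have iw : mu.-integrable `[0, T] (EFin \o (fun r : R =>
       f (r - s) * (v r (x + g r) - phi x) - f (r - s) * (v r (y + g r) - phi y) +
       f (r - s) * (phi x - phi y))).
      exact: (integrableD _ (integrableB _ ix iy) iz).
    apply: (le_trans (le_normr_Rintegral _ iw)) => //.
    rewrite -RintegralZr//; apply: le_Rintegral => //.
      exact: (integrable_norm iw).
      exact: (integrableZr _ _ iff).
    move=> r /=; rewrite in_itv/= => /andP[r0 _].
    rewrite -mulrBr -mulrDr normrM (ger0_norm (f_ge0 _)) ler_wpM2l//.
    have := adm_lip av (x + g r) (y + g r) r0.
    rewrite (_ : x + g r - _ = x - y); last by lra.
    by apply: le_trans; rewrite le_eqVlt; apply/orP; left; apply/eqP; congr `|_|; lra.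
  have h := phi_lip x y.
  rewrite (_ : phi x + I - (phi y + J) =
    (1 - p) * (phi x - phi y) + (I - J + p * (phi x - phi y))); last by ring.
  move=> H; rewrite (le_trans (ler_normD _ _))//.
  rewrite normrM ger0_norm ?subr_ge0//.
  have : (1 - p) * `|phi x - phi y| <= (1 - p) * `|x - y|.
    by rewrite ler_wpM2l// subr_ge0.
  lra.
Qed.

Lemma value_step_le v w : admissible phi v -> admissible phi w ->
  (forall s x : R, 0 <= s -> v s x <= w s x) ->
  forall s x : R, 0 <= s -> value_step phi v s x <= value_step phi w s x.
Proof.
move=> av aw vw s x s0; rewrite lerD2l; apply: le_Rintegral => //.
- exact: integrable_jump.
- exact: integrable_jump.
- move=> r /=; rewrite in_itv/= => /andP[r0 _].
  by rewrite ler_wpM2l// lerD2r vw.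
Qed.

Let v0 (s x : R) := phi x + remaining s.

Let adm0 : admissible phi v0.
Proof.
split.
- rewrite /v0; apply: measurable_funD; first exact: measurableT_comp.
  by apply: measurableT_comp => //; exact: measurable_remaining.
- by move=> s x s0; rewrite /v0 addrAC subrr add0r ger0_norm.
- by move=> s x y s0; rewrite /v0 opprD addrACA subrr addr0.
Qed.

Let vn n := iter n (value_step phi) v0.

Let admn n : admissible phi (vn n).
Proof. by elim: n => [//|n IH]; exact: admissible_step. Qed.

Let vnS_le n (s x : R) : 0 <= s -> vn n.+1 s x <= vn n s x.
Proof.
elim: n s x => [s x|n IH]; last first.
  by move=> s x; exact: value_step_le (admn _) (admn _) IH _ _.
move=> s0; rewrite /= lerD2l; apply: (le_trans _ (Rintegral_jump_dom s0)).
apply: le_Rintegral => //; first exact: integrable_jump.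
  exact: integrable_jump_dom.
move=> r /=; rewrite in_itv/= => /andP[r0 _].
exact: le_trans (ler_norm _) (jump_fun_le _ _ _ _).
Qed.

Let vn_cvg (s x : R) : 0 <= s -> cvgn (fun n => vn n s x).
Proof.
move=> s0; apply: nonincreasing_is_cvgn.
  by apply/nonincreasing_seqP => n; exact: vnS_le.
exists (phi x - remaining s) => _ [n _ <-].
by have := adm_near (admn n) x s0; rewrite ler_norml => /andP[]; lra.
Qed.

(** The step is monotone and its iterates start from the supersolution
[phi + remaining], so they decrease to a limit, which dominated convergence shows
to be a fixed point. *)
Theorem value_function_exists : exists2 v : R -> R -> R, admissible phi v &
  forall s x : R, 0 <= s -> v s x = value_step phi v s x.
Proof.
(* The iterates are controlled for [s >= 0] only, whereas measurability of the
   limit is wanted on the whole plane: hence the truncation of [s]. *)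
pose v (s x : R) := limn (fun n => vn n (Num.max s 0) x).
have vcvg (s x : R) : vn n (Num.max s 0) x @[n --> \oo] --> v s x.
  by apply: vn_cvg; rewrite le_max lexx orbT.
have vcvg0 (s x : R) : 0 <= s -> vn n s x @[n --> \oo] --> v s x.
  by move=> s0; have := vcvg s x; rewrite (max_idPl s0).
have av : admissible phi v.
  split.
  - apply: (@measurable_fun_cvg _ _ _ _
        (fun n (z : R * R) => vn n (Num.max z.1 0) z.2)) => // n.
    apply: (@measurableT_comp _ _ _ _ _ _ (fun z : R * R => vn n z.1 z.2) _
      (fun z : R * R => (Num.max z.1 0, z.2))); first exact: adm_measurable (admn n).
    apply/measurable_fun_pairP; split; last exact: measurable_snd.
    by apply: measurable_maxr; [exact: measurable_fst|exact: measurable_cst].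
  - move=> s x s0.
    have : `|vn n s x - phi x| @[n --> \oo] --> `|v s x - phi x|.
      by apply: cvg_norm; apply: cvgB (cvg_cst _); exact: vcvg0.
    move=> /cvgr_to_le; apply; apply: nearW => n.
    exact: adm_near (admn n) _ _ _.
  - move=> s x y s0.
    have : `|vn n s x - vn n s y| @[n --> \oo] --> `|v s x - v s y|.
      by apply: cvg_norm; apply: cvgB; exact: vcvg0.
    move=> /cvgr_to_le; apply; apply: nearW => n.
    exact: adm_lip (admn n) _ _ _ _.
exists v => // s x s0.
have vS : vn n.+1 s x @[n --> \oo] --> v s x.
  by rewrite (cvg_shiftS (fun n => vn n s x)); exact: vcvg0.
apply: (cvg_unique _ vS) => //.
rewrite /value_step /=; apply: cvgD; first exact: cvg_cst.
have [] := @dominated_convergence _ _ _ mu `[0, T]%classic (measurable_itv _)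
    (fun n => EFin \o jump_fun (vn n) s x) (EFin \o jump_fun v s x)
    (EFin \o jump_dom s) _ _ _ (integrable_jump_dom s0).
- by move=> n; apply/measurable_EFinP; exact: measurable_jump_fun.
- by apply/measurable_EFinP; exact: measurable_jump_fun.
- apply: aeW => r; rewrite /= in_itv/= => /andP[r0 _].
  apply: cvg_EFin; first by apply: nearW.
  apply: cvgMr; apply: cvgB; last exact: cvg_cst.
  exact: vcvg0.
- apply: aeW => r n; rewrite /= in_itv/= => /andP[r0 _].
  by rewrite lee_fin; exact: jump_fun_le.
move=> ij _; rewrite -(fineK (integrable_fin_num _ ij))// => /fine_cvg.
exact.
Qed.

End value_function.

(** * Effect of the age of the process on that mean *)

(** Discriminant form of the Cauchy-Schwarz inequality; optimal at [e = z / x]. *)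
Lemma le_sqrt_of_quadratic (R : realType) (x y z : R) : 0 < x ->
  (forall e, 0 < e -> 2 * e * z <= e ^+ 2 * x + y) -> z <= Num.sqrt (x * y).
Proof.
move=> x0 H; have [z0|z0] := leP z 0; first by rewrite (le_trans z0)// sqrtr_ge0.
have := H (z / x) (divr_gt0 z0 x0).
rewrite -(ler_pM2l x0).
have -> : x * (2 * (z / x) * z) = 2 * z ^+ 2 by field; exact: lt0r_neq0.
have -> : x * ((z / x) ^+ 2 * x + y) = z ^+ 2 + x * y by field; exact: lt0r_neq0.
move=> h; rewrite -[leLHS](ger0_norm (ltW z0)) -sqrtr_sqr ler_wsqrtr//.
lra.
Qed.

(** The weighted Young inequality behind the chi-square comparison of
two densities [p <= H * q], in a form that does not divide by [q]. *)
Lemma chi_square_pointwise (R : realType) (p q A H e : R) :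
  0 <= p -> 0 <= q -> 0 <= A -> 0 < e -> p <= H * q ->
  2 * e * (`|p - q| * A) <= e ^+ 2 * (H ^+ 2 * q - 2 * p + q) + q * A ^+ 2.
Proof.
move=> p0 q0 A0 e0 pH; move: (q0); rewrite le_eqVlt => /predU1P[q00|qp].
  have p00 : p = 0 by apply/le_anti; rewrite p0 andbT; move: pH; rewrite -q00 mulr0.
  by rewrite p00 -q00 subr0 normr0; lra.
rewrite -(ler_pM2l qp).
have h1 : p ^+ 2 <= H ^+ 2 * q ^+ 2 by rewrite -exprMn ler_sqr ?nnegrE// (le_trans p0).
have h2 : `|p - q| ^+ 2 = p ^+ 2 - 2 * p * q + q ^+ 2.
  by rewrite real_normK ?num_real//; ring.
have := sqr_ge0 (e * `|p - q| - q * A).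
have := ler_wpM2l (sqr_ge0 e) h1.
rewrite (_ : (e * `|p - q| - q * A) ^+ 2 = e ^+ 2 * `|p - q| ^+ 2 -
   q * (2 * e * (`|p - q| * A)) + q ^+ 2 * A ^+ 2); last by ring.
rewrite h2; lra.
Qed.

Section comparison.
Context {R : realType}.
Notation mu := (@lebesgue_measure R).
Variables (f : R -> R) (T t b : R).
Hypothesis f_ge0 : forall x : R, 0 <= f x.
Hypothesis mf : measurable_fun setT f.
Hypothesis f_int : (\int[mu]_x (f x)%:E = 1)%E.
Hypothesis f_neg : forall x : R, x < 0 -> f x = 0.
Hypothesis t_gt0 : 0 < t.
Hypothesis f_tail : \int[mu]_(x in `[0, T]) f x <= 1 - t.
Hypothesis f_le : forall x : R, 0 <= x <= T -> f x <= b * t.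
Hypothesis T_ge0 : 0 <= T.
Variables (g : R -> R).
Hypothesis mg : measurable_fun setT g.
Hypothesis ig : mu.-integrable `[0, T] (EFin \o g).
Hypothesis ig2 : mu.-integrable `[0, T] (EFin \o (fun r => g r ^+ 2)).
Variable hbar : R.
Hypothesis hbar_gt0 : 0 < hbar.
Hypothesis f_ratio : forall x z : R, 0 <= z -> z <= x -> x <= T ->
  f (x - z) <= hbar * f x.
Variable phi : R -> R.
Hypothesis phi_lip : forall x y : R, `|phi x - phi y| <= `|x - y|.
Variable v : R -> R -> R.
Hypothesis av : admissible T b g phi v.
Hypothesis v_fix : forall s x : R, 0 <= s -> v s x = value_step f T g phi v s x.

Notation remaining := (remaining T b g).
Notation survival := (survival f).

(** Twice a bound for the second moment of the integral of [|g|]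
over the points in [[r, T]]. *)
Definition second_moment (r : R) :=
  2 * (b * \int[mu]_(y in `[r, T]) g y ^+ 2 +
       (b * \int[mu]_(y in `[r, T]) `|g y|) ^+ 2).

Let b_ge0 : 0 <= b. Proof. exact: hazard_bound_ge0 t_gt0 f_le T_ge0. Qed.
Let rem0 s : 0 <= remaining s. Proof. exact: remaining_ge0 t_gt0 f_le T_ge0 _ _. Qed.
Let mphi := lipschitz1_measurable phi_lip.

Let surv_le1 s r : survival s r <= 1. Proof. exact: survival_le1. Qed.
Let surv_ge s r : 0 <= s -> r <= T -> t <= survival s r.
Proof. exact: survival_ge. Qed.
Let surv_gt0 s r : 0 <= s -> r <= T -> 0 < survival s r.
Proof. by move=> s0 rT; apply: lt_le_trans (surv_ge s0 rT). Qed.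

Let survE s r : 0 <= s -> s <= r -> r <= T ->
  \int[mu]_(y in `[r, T]) f (y - s) = survival s r - survival s T.
Proof. by move=> _; exact: survival_increment. Qed.

(** Mean of [phi] seen from [r] when the last point before [r] was [s],
multiplied by the probability that there is no point in [(s, r]].  With this
factor its derivative in [r] is [- f (r - s) * v r (x + g r)]. *)
Definition aged_value (s x r : R) :=
  survival s T * phi x + \int[mu]_(y in `[r, T]) (f (y - s) * v y (x + g y)).

Let integrable_fY s x r : 0 <= s -> 0 <= r -> mu.-integrable `[r, T]
   (EFin \o (fun y : R => f (y - s) * (v y (x + g y) - phi x))).
Proof.
move=> s0 r0; apply: (integrable_itvccr r0).
exact: (integrable_jump f_ge0 mf f_neg t_gt0 f_le T_ge0 mg ig phi_lip x av s0).
Qed.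

Let integrable_fv s x r : 0 <= s -> 0 <= r -> mu.-integrable `[r, T]
   (EFin \o (fun y : R => f (y - s) * v y (x + g y))).
Proof.
move=> s0 r0.
have if_ := integrable_densityS f_ge0 mf f_int s (measurable_itv `[r, T]).
apply: eq_integrable (integrableD _ (integrable_fY x s0 r0) (integrableZr _ (phi x) if_)) => //.
by move=> y _ /=; rewrite -EFinM -EFinD; congr (_%:E); ring.
Qed.

Lemma aged_valueE s x r : 0 <= s -> s <= r -> r <= T ->
  aged_value s x r = survival s r * phi x +
    \int[mu]_(y in `[r, T]) (f (y - s) * (v y (x + g y) - phi x)).
Proof.
move=> s0 sr rT; have r0 : 0 <= r by exact: le_trans sr.
have if_ := integrable_densityS f_ge0 mf f_int s (measurable_itv `[r, T]).
have -> : \int[mu]_(y in `[r, T]) (f (y - s) * (v y (x + g y) - phi x)) =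
   \int[mu]_(y in `[r, T]) (f (y - s) * v y (x + g y)) -
   (survival s r - survival s T) * phi x.
  rewrite -survE// -RintegralZr// -RintegralB//; last 2 first.
  - exact: integrable_fv.
  - exact: (integrableZr _ _ if_).
  by apply: eq_Rintegral => y _; rewrite mulrBr.
rewrite /aged_value; ring.
Qed.

Lemma aged_value_fresh s x : 0 <= s -> s <= T -> aged_value s x s = v s x.
Proof.
move=> s0 sT; rewrite aged_valueE// survivalss mul1r v_fix//.
by rewrite /value_step (Rintegral_from f_neg).
Qed.

(** With [p] and [q] the densities of the next point for ages [0] and [r - s], and
[A] the size of the effect of that point, the difference is at most the integral
of [|p - q| A].  The chi-square inequality bounds it by the square root of
[(hbar ^+ 2 * \int q - 2 * \int p + \int q) * \int q A^2].  The masses of [p] and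
[q] on [[r, T]] are [1 - d] and [1 - c], for survival probabilities [d], [c >= t],
which produces the constant [hbar ^+ 2 + t ^- 2 - 1]. *)
Lemma aged_value_dist s x r : 0 <= s -> s <= r -> r <= T ->
  `|v r x - aged_value s x r / survival s r| <=
  Num.sqrt ((hbar ^+ 2 + t ^- 2 - 1) * second_moment r).
Proof.
move=> s0 sr rT; have r0 : 0 <= r by exact: le_trans sr.
have F0 := surv_gt0 s0 rT; have F1 := surv_le1 s r; have Ft := surv_ge s0 rT.
set F := survival s r in F0 F1 Ft *.
have t1 : t <= 1 by exact: le_trans F1.
have tV1 : 1 <= t ^- 2 by rewrite invf_ge1 ?exprn_gt0// exprn_ile1// ltW.
pose p y := f (y - r); pose q y := F^-1 * f (y - s).
pose Y y := v y (x + g y) - phi x.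
pose A y := `|g y| + remaining y.
have ip : mu.-integrable `[r, T] (EFin \o p) by exact: integrable_densityS.
have iq : mu.-integrable `[r, T] (EFin \o q).
  exact: (integrableZl _ _ (integrable_densityS f_ge0 mf f_int s (measurable_itv `[r, T]))).
have ipY : mu.-integrable `[r, T] (EFin \o (fun y => p y * Y y)) by exact: integrable_fY.
have iqY : mu.-integrable `[r, T] (EFin \o (fun y => q y * Y y)).
  apply: eq_integrable (integrableZl _ F^-1 (integrable_fY x s0 r0)) => // y _ /=.
  by rewrite -EFinM mulrA.
have i2 : mu.-integrable `[r, T] (EFin \o (fun y => g y ^+ 2)).
  exact: integrable_itvccr ig2.
have -> : v r x - aged_value s x r / F = \int[mu]_(y in `[r, T]) (p y * Y y - q y * Y y).
  rewrite RintegralB// aged_valueE// -/F v_fix// /value_step (Rintegral_from f_neg)//.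
  rewrite (_ : \int[mu]_(y in `[r, T]) (q y * Y y) =
    F^-1 * \int[mu]_(y in `[r, T]) (f (y - s) * (v y (x + g y) - phi x))).
    by rewrite /p /Y; field; exact: lt0r_neq0.
  rewrite -RintegralZl//; last exact: integrable_fY.
  by apply: eq_Rintegral => y _; rewrite /q /Y mulrA.
have iD : mu.-integrable `[r, T] (EFin \o (fun y => p y * Y y - q y * Y y)).
  exact: (integrableB _ ipY iqY).
apply: le_sqrt_of_quadratic.
  by rewrite -addrA ltr_wpDr ?subr_ge0// exprn_gt0.
move=> e e0.
pose B y := e ^+ 2 * (hbar ^+ 2 + 1) * q y - 2 * e ^+ 2 * p y +
  (2 * b * g y ^+ 2 + 2 * remaining r ^+ 2 * q y).
have iB1 : mu.-integrable `[r, T] (EFin \o (fun y => e ^+ 2 * (hbar ^+ 2 + 1) * q y)).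
  exact: (integrableZl _ _ iq).
have iB2 : mu.-integrable `[r, T] (EFin \o (fun y => 2 * e ^+ 2 * p y)).
  exact: (integrableZl _ _ ip).
have iB3 : mu.-integrable `[r, T] (EFin \o (fun y => 2 * b * g y ^+ 2)).
  exact: (integrableZl _ _ i2).
have iB4 : mu.-integrable `[r, T] (EFin \o (fun y => 2 * remaining r ^+ 2 * q y)).
  exact: (integrableZl _ _ iq).
have iB12 : mu.-integrable `[r, T] (EFin \o (fun y =>
    e ^+ 2 * (hbar ^+ 2 + 1) * q y - 2 * e ^+ 2 * p y)).
  exact: (integrableB _ iB1 iB2).
have iB34 : mu.-integrable `[r, T] (EFin \o (fun y =>
    2 * b * g y ^+ 2 + 2 * remaining r ^+ 2 * q y)).
  exact: (integrableD _ iB3 iB4).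
have iB : mu.-integrable `[r, T] (EFin \o B) by exact: (integrableD _ iB12 iB34).
have DB : 2 * e * `|\int[mu]_(y in `[r, T]) (p y * Y y - q y * Y y)| <=
    \int[mu]_(y in `[r, T]) B y.
  apply: (@le_trans _ _ (2 * e * \int[mu]_(y in `[r, T]) `|p y * Y y - q y * Y y|)).
    by rewrite ler_pM2l ?mulr_gt0//; exact: le_normr_Rintegral.
  rewrite -RintegralZl//; last exact: (integrable_norm iD).
  apply: le_Rintegral => //; first exact: (integrableZl _ _ (integrable_norm iD)).
  move=> y /=; rewrite in_itv/= => /andP[ry yT].
  have y0 : 0 <= y by exact: le_trans ry.
  have sy : s <= y by exact: le_trans ry.
  have p0 : 0 <= p y by exact: f_ge0.
  have q0 : 0 <= q y by rewrite /q mulr_ge0// invr_ge0 ltW.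
  have A0 : 0 <= A y by rewrite addr_ge0.
  have pq : p y <= hbar * q y.
    have -> : p y = f ((y - s) - (r - s)) by congr f; lra.
    apply: (@le_trans _ _ (hbar * f (y - s))); first by apply: f_ratio; lra.
    rewrite ler_wpM2l ?(ltW hbar_gt0)// /q ler_peMl// invf_ge1//.
  have qb : q y <= b.
    rewrite /q mulrC ler_pdivrMr//.
    have /andP[_ h] := hazard_le f_ge0 mf f_int t_gt0 f_tail f_le s0 sr rT.
    apply: (le_trans (f_le _)); first by lra.
    by rewrite ler_wpM2l.
  have YA : `|Y y| <= A y.
    exact: (jump_le x av y0).
  have := chi_square_pointwise p0 q0 A0 e0 pq.
  have rr : remaining y <= remaining r.
    exact: (remaining_le f_ge0 t_gt0 f_le T_ge0 ig).
  have qA : q y * A y ^+ 2 <= 2 * b * g y ^+ 2 + 2 * remaining r ^+ 2 * q y.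
    have h1 : A y ^+ 2 <= 2 * g y ^+ 2 + 2 * remaining r ^+ 2.
      have : remaining y ^+ 2 <= remaining r ^+ 2 by rewrite ler_sqr ?nnegrE.
      have : `|g y| ^+ 2 = g y ^+ 2 by rewrite real_normK ?num_real.
      rewrite /A; have := sqr_ge0 (`|g y| - remaining y).
      rewrite sqrrB sqrrD; lra.
    have h2 := ler_wpM2l q0 h1.
    have h3 := ler_wpM2r (sqr_ge0 (g y)) qb.
    lra.
  rewrite -mulrBl normrM.
  have := ler_wpM2l (normr_ge0 (p y - q y)) YA.
  move=> hYA; have := ler_wpM2l (ltW e0) hYA.
  rewrite /B; lra.
apply: (le_trans DB).
rewrite /B RintegralD// RintegralB// RintegralD//.
rewrite 2?(@RintegralZl _ _ _ mu _ q)// (@RintegralZl _ _ _ mu _ p)//.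
rewrite (@RintegralZl _ _ _ mu _ (fun y => g y ^+ 2))//.
have Q : \int[mu]_(y in `[r, T]) q y = 1 - survival s T / F.
  rewrite /q RintegralZl//; last exact: integrable_densityS.
  by rewrite survE// -/F; field; exact: lt0r_neq0.
have Pm : \int[mu]_(y in `[r, T]) p y = 1 - survival r T.
  by rewrite /p survE// survivalss.
rewrite Q Pm.
have ST := surv_ge s0 (lexx T).
have qi : t <= survival s T / F.
  rewrite ler_pdivlMr//; apply: le_trans ST.
  by rewrite ler_piMr// ltW.
have pi0 : 0 <= survival r T by exact: ltW (surv_gt0 _ _).
have pi1 : survival r T <= 1 by [].
have R1 : remaining r = b * \int[mu]_(y in `[r, T]) `|g y| by exact: remainingE.
rewrite /second_moment -R1.
move: (survival s T / F) (survival r T) qi pi0 pi1 => c d tc d0 d1.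
have c0 : 0 < c by exact: lt_le_trans tc.
(* As [d <= 1], [c * (2 * d - c) = d ^+ 2 - (d - c) ^+ 2 <= 1]. *)
have key : 2 * d - c <= t ^- 2.
  apply: (@le_trans _ _ c^-1).
    rewrite -(ler_pM2l c0) mulfV ?lt0r_neq0//.
    have := sqr_ge0 (d - c); have : d ^+ 2 <= 1 by rewrite exprn_ile1.
    lra.
  apply: (@le_trans _ _ t^-1); first by rewrite lef_pV2 ?posrE.
  by rewrite lef_pV2 ?posrE ?exprn_gt0// expr2 ler_piMr// ltW.
set G2 := \int[mu]_(y in `[r, T]) _.
have cR : (1 - c) * remaining r ^+ 2 <= remaining r ^+ 2.
  by rewrite ler_piMl ?sqr_ge0//; lra.
have ce : (hbar ^+ 2 + 1) * (1 - c) - 2 * (1 - d) <= hbar ^+ 2 + t ^- 2 - 1.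
  have : 0 <= hbar ^+ 2 * c by rewrite mulr_ge0 ?sqr_ge0// ltW.
  lra.
have := ler_wpM2l (sqr_ge0 e) ce.
lra.
Qed.

Variables (h k : R -> R) (th : R).
Hypothesis th_ge0 : 0 <= th.
Hypothesis h_ge : forall r : R, 0 <= r -> r <= T ->
  `|g r| + Num.sqrt ((hbar ^+ 2 + t ^- 2 - 1) * second_moment r) <= h r.
Hypothesis ik : mu.-integrable `[0, T] (EFin \o k).
Hypothesis k_ge : forall r : R, 0 <= r -> r <= T -> b * kappa (th * h r) <= k r.

(** One step of the supermartingale: started from a renewal at [s], the exponential
evaluated at the next point, or at [phi x] if there is none before [T], has mean
at most its present value. *)
Lemma expR_first_point s x : 0 <= s -> s <= T ->
  (\int[mu]_(r in `[s, T])
     (f (r - s) * expR (th * v r (x + g r) + \int[mu]_(y in `[r, T]) k y))%:E +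
   (survival s T * expR (th * phi x))%:E <=
   (expR (th * v s x + \int[mu]_(y in `[s, T]) k y))%:E)%E.
Proof.
move=> s0 sT.
pose L r := \int[mu]_(y in `[r, T]) k y.
have iks : mu.-integrable `[s, T] (EFin \o k) by exact: integrable_itvccr ik.
have ifv := integrable_fv x s0 s0.
have := @expR_one_jump _ s T (survival s) (fun r => f (r - s))
  (fun r => v r (x + g r)) (aged_value s x) h k L (phi x) b th t sT t_gt0 th_ge0.
have LT : L T = 0 by rewrite /L Rintegral_itv1.
rewrite LT addr0 survivalss mul1r aged_value_fresh// divr1; apply.
- exact: survival_primitive.
- by move=> r; rewrite in_itv/= => /andP[sr rT]; exact: surv_ge.
- move=> r; rewrite in_itv/= => /andP[sr rT].
  exact: (hazard_le f_ge0 mf f_int t_gt0 f_tail f_le s0 sr rT).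
- apply: measurable_funTS.
  apply: (@measurableT_comp _ _ _ _ _ _ (fun z : R * R => v z.1 z.2) _
    (fun r : R => (r, x + g r))); first exact: adm_measurable av.
  apply/measurable_fun_pairP; split; first exact: measurable_id.
  by apply: measurable_funD => //; exact: measurable_cst.
- apply: eq_primitive_on (primitive_onD (primitive_on_cst s T (aged_value s x s))
    (primitive_onZ (-1) (primitive_on_int 0 ifv))) => r.
    rewrite in_itv/= => /andP[sr rT]; rewrite add0r /aged_value.
    by rewrite (@Rintegral_itvcc_cat _ s r T)//; lra.
  by move=> _ /=; rewrite add0r mulN1r.
- by rewrite /aged_value Rintegral_itv1 addr0.
- apply: eq_primitive_on (primitive_onD (primitive_on_cst s T (L s))
    (primitive_onZ (-1) (primitive_on_int 0 iks))) => r.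
    rewrite in_itv/= => /andP[sr rT]; rewrite add0r /L.
    by rewrite (@Rintegral_itvcc_cat _ s r T)//=; lra.
  by move=> _ /=; rewrite add0r mulN1r.
- move=> r; rewrite in_itv/= => /andP[sr rT]; apply: k_ge => //.
  exact: le_trans sr.
- move=> r; rewrite in_itv/= => /andP[sr rT].
  have r0 : 0 <= r by exact: le_trans sr.
  apply: (le_trans _ (h_ge r0 rT)).
  rewrite (_ : _ - _ = (v r (x + g r) - v r x) +
    (v r x - aged_value s x r / survival s r)); last by lra.
  rewrite (le_trans (ler_normD _ _))// lerD//; last exact: aged_value_dist.
  by rewrite (le_trans (adm_lip av _ _ r0))// addrAC subrr add0r.
Qed.

End comparison.

(** * Independence of the past *)

Section independence.
Context d (Omega : measurableType d) (R : realType) (P : probability Omega R).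

(** Mutual independence is indexed by [{fset nat}]; this is the set of the first
[n] indices. *)
Let first_indices (n : nat) : {fset nat} := iter n (fun J => (#|`J| |` J)%fset) fset0.

Let card_first_indices n : #|`first_indices n| = n /\
  (forall i, (i \in first_indices n) = (i < n)%N).
Proof.
elim: n => [|n [cn IH]]; first by split; [rewrite cardfs0|move=> i; rewrite in_fset0].
split=> [|i].
  by rewrite /= cardfsU1 cn -/(first_indices n) IH ltnn.
change (first_indices n.+1) with (#|`first_indices n| |` first_indices n)%fset.
by rewrite in_fset1U cn IH ltnS [in RHS]leq_eqVlt.
Qed.

Let big_first_indices n (F : nat -> \bar R) :
  (\prod_(i <- first_indices n) F i = \prod_(i < n) F i)%E.
Proof.
elim: n => [|n IH]; first by rewrite big_ord0 /= big_seq_fset0.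
have [cn Jn] := card_first_indices n.
rewrite big_ord_recr /= -/(first_indices n) cn big_fsetU1/= ?IH 1?muleC//.
by rewrite Jn ltnn.
Qed.

Variable X : nat -> {RV P >-> R}.
Hypothesis indX : mutually_independent X.

(** A pi-system generating the sigma-algebra of the first [n] variables. *)
Definition past (n : nat) : set (set Omega) :=
  [set E | exists2 B : nat -> set R, (forall i, measurable (B i)) &
    E = \bigcap_(i in `I_n) (X i @^-1` B i)].

Let mX i (B : set R) : measurable B -> measurable (X i @^-1` B).
Proof. by move=> mB; exact: measurable_funPTI. Qed.

Lemma past_measurable n : past n `<=` measurable.
Proof.
move=> _ [B mB ->]; apply: fin_bigcap_measurable => // i _.
exact: mX.
Qed.

Lemma probability_bigcap n (B : nat -> set R) : (forall i, measurable (B i)) ->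
  P (\bigcap_(i in `I_n) (X i @^-1` B i)) = (\prod_(i < n) P (X i @^-1` B i))%E.
Proof.
move=> mB; rewrite -(big_first_indices n (fun i => P (X i @^-1` B i))) -indX//.
rewrite (_ : [set` first_indices n] = `I_n)//.
by apply/seteqP; split => i /=; rewrite (card_first_indices n).2.
Qed.

(** Both sides are finite measures in [E] that agree on the pi-system. *)
Lemma past_independent n (E : set Omega) (A : set R) : <<s past n >> E ->
  measurable A -> P (E `&` X n @^-1` A) = (P E * P (X n @^-1` A))%E.
Proof.
move=> sE mA.
have mC := mX n mA.
have fC : P (X n @^-1` A) \is a fin_num by exact: fin_num_measure.
pose r : {nonneg R} := NngNum (fine_ge0 (measure_ge0 P (X n @^-1` A))).
have rE : r%:num%:E = P (X n @^-1` A) by rewrite /= fineK.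
suff : mrestr P mC E = mscale r P E by rewrite /mrestr /mscale/= fineK// muleC.
apply: (@g_sigma_algebra_measure_unique _ _ _ (past n) (@past_measurable n)
  (fun=> setT)) => //.
- by move=> _; exists (fun=> setT) => //; rewrite bigcapT.
- by rewrite bigcup_const//; exists 0%N.
- move=> _ _ [B mB ->] [B' mB' ->]; exists (fun i => B i `&` B' i).
    by move=> i; exact: measurableI.
  by rewrite -bigcapI; apply: eq_bigcapr => i _; rewrite preimage_setI.
- move=> _ [B mB ->].
  rewrite -[LHS]/(P (_ `&` X n @^-1` A)) -[RHS]/(r%:num%:E * P _)%E rE.
  rewrite [in RHS]probability_bigcap//.
  pose B' i := if (i < n)%N then B i else A.
  have mB' i : measurable (B' i) by rewrite /B'; case: ifP.
  have := @probability_bigcap n.+1 B' mB'.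
  have B'n : B' n = A by rewrite /B' ltnn.
  rewrite big_ord_recr/= B'n muleC.
  rewrite (eq_bigr (fun i : 'I_n => P (X i @^-1` B i))); last first.
    by move=> i _; rewrite /B' ltn_ord.
  move=> <-; congr (P _); apply/seteqP; split => w /=.
    move=> [h1 h2] i /=; rewrite /B' ltnS leq_eqVlt => /predU1P[->|iN].
      by rewrite ltnn.
    by rewrite iN; exact: h1.
  move=> h; split=> [i /= iN|].
    by have := h i; rewrite /= /B' iN => /(_ (ltnW iN)).
  by have := h n; rewrite /= /B' ltnn => /(_ (ltnSn n)).
- by move=> _; rewrite /mrestr (le_lt_trans (probability_le1 _ _))// ?ltry//; exact: measurableI.
Qed.

End independence.

Section independent_integral.
Context d (Omega : measurableType d) (R : realType) (P : probability Omega R).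
Context d' (U : measurableType d').

Lemma independent_integral (S : {mfun Omega >-> U}) (Y : {mfun Omega >-> R})
    (psi : U * R -> \bar R) :
  (forall A B, measurable A -> measurable B ->
    P (S @^-1` A `&` Y @^-1` B) = (P (S @^-1` A) * P (Y @^-1` B))%E) ->
  measurable_fun setT psi -> (forall z, (0 <= psi z)%E) ->
  (\int[P]_w psi (S w, Y w) =
   \int[P]_w \int[distribution P Y]_r psi (S w, r))%E.
Proof.
move=> ind mpsi psi0.
have mSY : measurable_fun setT (fun w => (S w, Y w)).
  by apply/measurable_fun_pairP; split; exact: measurable_funPT.
rewrite -(ge0_integral_pushforward mSY P (D := setT) (f := psi))//; last first.
rewrite (eq_measure_integral (distribution P S \x distribution P Y)%E); last first.
  move=> A mA _; apply/esym; apply: product_measure_unique => //.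
rewrite fubini_tonelli1// ge0_integral_distribution//.
- exact: measurable_fun_fubini_tonelli_F.
- by move=> y; exact: integral_ge0.
Qed.

End independent_integral.

Section density.
Context d (Omega : measurableType d) (R : realType) (P : probability Omega R).
Notation mu := (@lebesgue_measure R).
Variable Y : {mfun Omega >-> R}.

Let Y' : Omega -> measurableTypeR R := Y.

Let mY' : measurable_fun setT Y'. Proof. exact: (measurable_funPT Y). Qed.

#[local] HB.instance Definition _ := @isMeasurableFun.Build _ _ _ _ Y' mY'.

(** A density in the sense of values on measurable sets is a Radon-Nikodym
derivative, so the change of variables formula applies. *)
Lemma ge0_integral_density (f : R -> R) (k : R -> \bar R) :
  measurable_fun setT f -> (forall x, 0 <= f x) ->
  (forall A : set R, measurable A ->
    distribution P Y A = (\int[mu]_(x in A) (f x)%:E)%E) ->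
  measurable_fun setT k -> (forall x, (0 <= k x)%E) ->
  (\int[distribution P Y]_r k r = \int[mu]_r (k r * (f r)%:E))%E.
Proof.
move=> mf f0 fE mk k0.
have fE' A : measurable A -> distribution P Y' A = (\int[mu]_(x in A) (f x)%:E)%E.
  by move=> mA; exact: fE.
have dom : distribution P Y' `<< mu.
  apply/null_content_dominatesP => A mA A0; rewrite fE'//.
  by apply: null_set_integral => //; apply/measurable_EFinP; exact: measurable_funTS.
transitivity (\int[distribution P Y']_r k r)%E.
  by rewrite !ge0_integral_distribution.
rewrite -(Radon_Nikodym_SigmaFinite.change_of_variables dom)//.
apply: ae_eq_integral => //.
- apply: emeasurable_funM => //.
  exact: measurable_int (Radon_Nikodym_SigmaFinite.f_integrable dom).
- by apply: emeasurable_funM => //; exact/measurable_EFinP.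
apply: ae_eqe_mul2l.
apply: integral_ae_eq => //.
- exact: Radon_Nikodym_SigmaFinite.f_integrable.
- exact/measurable_EFinP.
- by move=> A _ mA; rewrite -Radon_Nikodym_SigmaFinite.f_integral//; exact: fE'.
Qed.

End density.

(** * The exponential supermartingale *)

Section renewal_state.
Context {R : realType}.
Variables (T : R) (g : R -> R).

(** The state is the time of the last point and the value accumulated so far by the
integral of [g].  Truncating the spacings at [0] keeps the times nonnegative for
every outcome, not only almost surely. *)
Definition next_state (z : R * R) (r : R) : R * R :=
  (z.1 + Num.max r 0,
   z.2 + g (z.1 + Num.max r 0) * (z.1 + Num.max r 0 <= T)%R%:R).

Fixpoint state (Om : Type) (X : nat -> Om -> R) (n : nat) (w : Om) : R * R :=
  if n is n'.+1 then next_state (state X n' w) (X n' w) else (0, 0).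

Lemma state_time_ge0 (Om : Type) (X : nat -> Om -> R) n w : 0 <= (state X n w).1.
Proof. by elim: n => //= n IH; rewrite addr_ge0// le_max lexx orbT. Qed.

Hypothesis mg : measurable_fun setT g.

Lemma measurable_next_state :
  measurable_fun setT (fun y : (R * R) * R => next_state y.1 y.2).
Proof.
have m1 : measurable_fun setT (fun y : (R * R) * R => y.1.1 + Num.max y.2 0).
  apply: measurable_funD; first exact: measurableT_comp.
  by apply: measurable_maxr; [exact: measurable_snd|exact: measurable_cst].
apply/measurable_fun_pairP; split => //.
apply: measurable_funD; first exact: measurableT_comp.
apply: measurable_funM; first exact: measurableT_comp.
by apply: measurable_ler_indicator => //; exact: measurable_cst.
Qed.

Lemma measurable_state d (Om : measurableType d) (X : nat -> Om -> R) n :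
  (forall i, (i < n)%N -> measurable_fun setT (X i)) ->
  measurable_fun setT (state X n).
Proof.
elim: n => [_|n IH mX]; first exact: measurable_cst.
apply: (@measurableT_comp _ _ _ _ _ _ (fun y : (R * R) * R => next_state y.1 y.2) _
  (fun w => (state X n w, X n w))); first exact: measurable_next_state.
apply/measurable_fun_pairP; split; last exact: mX.
by apply: IH => i iN; apply: mX; exact: ltnW.
Qed.

Context d (Omega : measurableType d) (P : probability Omega R).
Variable X : nat -> {RV P >-> R}.
Hypothesis indX : mutually_independent X.

Lemma state_independent n (A : set (R * R)) (B : set R) :
  measurable A -> measurable B ->
  P (state X n @^-1` A `&` X n @^-1` B) =
  (P (state X n @^-1` A) * P (X n @^-1` B))%E.
Proof.
move=> mA mB; apply: past_independent => //.
have mX i : (i < n)%N ->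
    measurable_fun (setT : set (g_sigma_algebraType (past X n))) (X i).
  move=> iN _ B' mB'; rewrite setTI.
  apply: sub_sigma_algebra.
  exists (fun j => if j == i then B' else setT); first by move=> j; case: ifP.
  apply/seteqP; split => w /=.
    by move=> XB j /= _; case: eqP => // ->.
  by move=> /(_ i iN); rewrite /= eqxx.
have := @measurable_state _ (g_sigma_algebraType (past X n)) X n mX.
by move=> /(_ measurableT A mA); rewrite setTI.
Qed.

End renewal_state.

Section supermartingale.
Context {R : realType}.
Notation mu := (@lebesgue_measure R).
Variables (f : R -> R) (T : R).
Hypothesis f_ge0 : forall x : R, 0 <= f x.
Hypothesis mf : measurable_fun setT f.
Hypothesis f_int : (\int[mu]_x (f x)%:E = 1)%E.
Hypothesis f_neg : forall x : R, x < 0 -> f x = 0.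
Hypothesis T_ge0 : 0 <= T.
Variables (g : R -> R) (phi : R -> R) (v : R -> R -> R) (k : R -> R) (th : R).
Hypothesis mg : measurable_fun setT g.
Hypothesis mk : measurable_fun setT k.
Hypothesis mv : measurable_fun setT (fun z : R * R => v z.1 z.2).
Hypothesis v_end : forall s x : R, T < s -> v s x = phi x.
Hypothesis first_point : forall s x : R, 0 <= s -> s <= T ->
  (\int[mu]_(r in `[s, T])
     (f (r - s) * expR (th * v r (x + g r) + \int[mu]_(y in `[r, T]) k y))%:E +
   (survival f s T * expR (th * phi x))%:E <=
   (expR (th * v s x + \int[mu]_(y in `[s, T]) k y))%:E)%E.

(** The indicator makes the exponent jointly measurable in the state. *)
Definition potential (z : R * R) : R :=
  expR (th * v z.1 z.2 + \int[mu]_(r in `[0, T]) (k r * (z.1 <= r)%R%:R)).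

Lemma measurable_potential : measurable_fun setT potential.
Proof.
apply: measurableT_comp; first exact: measurable_expR.
apply: measurable_funD; first by apply: measurable_funM => //; exact: measurable_cst.
apply: (@measurable_Rintegral_param _ _ _ _ _ mu `[0, T]%classic
  (fun z : (R * R) * R => k z.2 * (z.1.1 <= z.2)%R%:R)) => //.
apply: measurable_funM; first exact: measurableT_comp.
by apply: measurable_ler_indicator; [exact: measurableT_comp|exact: measurable_snd].
Qed.

Lemma potentialE s x : 0 <= s ->
  potential (s, x) = expR (th * v s x + \int[mu]_(y in `[s, T]) k y).
Proof. by move=> s0; rewrite /potential /= Rintegral_indicator_from. Qed.

Lemma potential_end s x : T < s -> potential (s, x) = expR (th * phi x).
Proof.
move=> Ts; rewrite potentialE ?(le_trans T_ge0 (ltW Ts))// v_end//.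
by rewrite set_itv_ge ?Rintegral_set0 ?addr0// bnd_simp -ltNge.
Qed.

Let kernel (z : R * R) (r : R) : \bar R :=
  ((potential (next_state T g z r))%:E * (f r)%:E)%E.

Let mkernel z : measurable_fun setT (kernel z).
Proof.
apply: emeasurable_funM; last exact/measurable_EFinP.
apply/measurable_EFinP; apply: measurableT_comp; first exact: measurable_potential.
exact: (measurableT_comp (measurable_next_state T mg) (pair1_measurable z)).
Qed.

(** If the last point lies in [[0, T]] this is the one-jump inequality, with all the
mass of the points beyond [T] collected in the survival term; after [T] the
potential no longer changes. *)
Lemma potential_step z : 0 <= z.1 ->
  (\int[mu]_r ((potential (next_state T g z r))%:E * (f r)%:E) <= (potential z)%:E)%E.
Proof.
case: z => s x /= s0.
rewrite -/(kernel (s, x)) -(ge0_integral_translate s (mkernel (s, x))); last first.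
  by move=> r; rewrite /kernel mule_ge0// lee_fin// expR_ge0.
have mfs : measurable_fun setT (fun r : R => f (r - s)) by exact: measurable_translate.
have kE r : (kernel (s, x) (r - s)%R =
    if (r <= T)%R then if (s <= r)%R then (f (r - s) * potential (r, x + g r))%:E else 0
    else if (s <= r)%R then (expR (th * phi x))%:E * (f (r - s)%R)%:E else 0)%E.
  rewrite /kernel /next_state /=; case: (leP s r) => sr; last first.
    by rewrite f_neg ?mule0 ?if_same// subr_lt0.
  rewrite (max_idPl _) ?subr_ge0// subrKC.
  case: (leP r T) => rT; first by rewrite mulr1 -EFinM mulrC.
  by rewrite mulr0 addr0 potential_end.
rewrite -(setUv `]-oo, T]%classic) ge0_integral_setU//=; last 4 first.
- exact: measurableC.
- apply: measurable_funTS.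
  by apply: (measurableT_comp (mkernel (s, x))); exact: measurable_funB.
- by move=> r _; rewrite /kernel mule_ge0// lee_fin// expR_ge0.
- by apply/disj_setPCl.
have tail : (\int[mu]_(r in ~` `]-oo, T]) kernel (s, x) (r - s)%R =
    (expR (th * phi x))%:E * \int[mu]_(r in ~` `]-oo, T]) (f (r - s)%R)%:E)%E.
  rewrite -ge0_integralZl//.
  - apply: eq_integral => r; rewrite inE/= in_itv/= => /negP; rewrite -ltNge => Tr.
    rewrite kE leNgt Tr/=; case: (leP s r) => // rs.
    by rewrite f_neg ?mule0// subr_lt0.
  - exact: measurableC.
  - by apply/measurable_EFinP; exact: measurable_funTS.
  - by move=> r _; rewrite lee_fin.
rewrite tail.
have mass : (\int[mu]_(r in `]-oo, T]) (f (r - s)%R)%:E +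
    \int[mu]_(r in ~` `]-oo, T]) (f (r - s)%R)%:E = 1)%E.
  rewrite -ge0_integral_setU//=.
  - rewrite setUv -f_int (ge0_integral_translate s (k := EFin \o f))//.
    exact/measurable_EFinP.
  - exact: measurableC.
  - by apply/measurable_EFinP; exact: measurable_funTS.
  - by move=> r _; rewrite lee_fin.
  - by apply/disj_setPCl.
have cut (u : R -> \bar R) : (forall r, r < s -> u r = 0%E) ->
    (\int[mu]_(r in `]-oo, T]) u r = \int[mu]_(r in `[s, T]) u r)%E.
  move=> u0; rewrite [LHS]integral_mkcond [RHS]integral_mkcond.
  apply: eq_integral => r _; rewrite !patchE !mem_setE !in_itv/=.
  by case: (leP s r) => //= rs; rewrite u0// if_same.
rewrite cut; last by move=> r rs; rewrite kE (lt_geF rs) if_same.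
have [sT|Ts] := leP s T.
  have -> : (\int[mu]_(r in `[s, T]) kernel (s, x) (r - s)%R = \int[mu]_(r in `[s, T])
     (f (r - s) * expR (th * v r (x + g r) + \int[mu]_(y in `[r, T]) k y)%R)%:E)%E.
    apply: eq_integral => r; rewrite inE/= in_itv/= => /andP[sr rT].
    by rewrite kE rT sr potentialE// (le_trans s0).
  rewrite potentialE//; apply: le_trans (first_point x s0 sT).
  rewrite leeD2l// EFinM muleC lee_wpmul2r ?lee_fin ?expR_ge0//.
  rewrite cut in mass; last by move=> r rs; rewrite f_neg// subr_lt0.
  have := mass; rewrite /survival.
  have : (\int[mu]_(r in `[s, T]) (f (r - s)%R)%:E)%E \is a fin_num.
    by apply: integrable_fin_num => //; exact: integrable_densityS.
  rewrite /Rintegral; set A := (\int[mu]_(r in `[s, T]) _)%E.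
  set B := (\int[mu]_(r in ~` _) _)%E.
  case: A B => [a| |] [c| |] //= _.
  by rewrite -EFinD => -[<-]; rewrite lee_fin; lra.
rewrite [X in (X + _)%E](_ : _ = 0%E) ?add0e; last first.
  by rewrite set_itv_ge ?integral_set0// bnd_simp -ltNge.
rewrite potential_end// -[leRHS]mule1 lee_wpmul2l ?lee_fin ?expR_ge0//.
by rewrite -mass leeDr// integral_ge0// => r _; rewrite lee_fin.
Qed.

Context d (Omega : measurableType d) (P : probability Omega R).
Variable X : nat -> {RV P >-> R}.
Hypothesis indX : mutually_independent X.
Hypothesis densX : forall n (A : set R), measurable A ->
  distribution P (X n) A = (\int[mu]_(x in A) (f x)%:E)%E.

Let stateX n : Omega -> R * R := state T g X n.

Let mstateX n : measurable_fun setT (stateX n).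
Proof. by apply: measurable_state. Qed.

(** The next spacing is independent of the state, so the integral over it may be
taken first, with the state fixed. *)
Lemma potential_supermartingale n :
  (\int[P]_w (potential (state T g X n w))%:E <= (potential (0, 0))%:E)%E.
Proof.
have mpot := measurable_potential.
elim: n => [|n IH].
  rewrite [leLHS](_ : _ = \int[P]_w cst (potential (0, 0))%:E w)%E//.
  rewrite integral_cst// -[leRHS]mule1 lee_wpmul2l ?lee_fin ?expR_ge0//.
  exact: probability_le1.
apply: le_trans IH.
pose psi (y : (R * R) * R) := (potential (next_state T g y.1 y.2))%:E.
have mpsi : measurable_fun setT psi.
  apply/measurable_EFinP; apply: measurableT_comp => //.
  exact: measurable_next_state.
have psi0 y : (0 <= psi y)%E by rewrite lee_fin expR_ge0.
pose S : {mfun Omega >-> (R * R)%type} :=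
  HB.pack (stateX n) (isMeasurableFun.Build _ _ _ _ (stateX n) (mstateX n)).
rewrite (@independent_integral _ _ _ P _ _ S (X n) psi)//; last first.
  by move=> A B mA mB; exact: state_independent.
apply: ge0_le_integral => //.
- by move=> w _; apply: integral_ge0.
- apply: (@measurableT_comp _ _ _ _ _ _
    (fun z : R * R => \int[distribution P (X n)]_r psi (z, r))%E _ (stateX n)) => //.
  exact: (measurable_fun_fubini_tonelli_F psi).
- by apply/measurable_EFinP; exact: measurableT_comp.
- move=> w _; rewrite (ge0_integral_density mf f_ge0 (densX n))//.
    by apply: potential_step; exact: state_time_ge0.
  exact: (measurableT_comp mpsi (pair1_measurable (stateX n w))).
Qed.

End supermartingale.

(** * From the states at the points to the renewal integral *)

Section renewal_integral_state.
Context d (Omega : measurableType d) (R : realType) (P : probability Omega R).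
Variables (T : R) (tau : nat -> {RV P >-> R}) (g : {mfun R >-> R}).
Hypothesis T_ge0 : 0 <= T.

Lemma renewal_measure_finite (w : Omega) (N : nat) (A : set R) :
  (forall n, (N <= n)%N -> T < renewal_time tau n w) ->
  measurable A -> A `<=` `[0, T] ->
  renewal_measure T tau w A = msum (fun n => \d_(renewal_time tau n w)) N A.
Proof.
move=> late mA AT; rewrite /renewal_measure /= /mrestr setIidl// /mseries /msum.
rewrite (nneseries_split 0 N) ?add0n//.
rewrite [X in (_ + X)%E]eseries0 ?adde0 ?big_mkord// => n Nn _.
rewrite /= /dirac indicE memNset// => /AT; rewrite /= in_itv/= => /andP[_].
by rewrite leNgt late.
Qed.

(** Once the measure is a finite sum of Dirac masses, the positive and negative
parts of [g] have finite integrals, and their sums recombine. *)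
Lemma renewal_integral_sum (w : Omega) (N : nat) :
  (forall n, (N <= n)%N -> T < renewal_time tau n w) ->
  (forall n, 0 <= renewal_time tau n w) ->
  renewal_integral T tau g w =
  \sum_(n < N) g (renewal_time tau n w) * (renewal_time tau n w <= T)%R%:R.
Proof.
move=> late t0; rewrite /renewal_integral /Rintegral.
rewrite (eq_measure_integral (msum (fun n => \d_(renewal_time tau n w)) N)); last first.
  by move=> A mA AT; exact: renewal_measure_finite.
have mg : measurable_fun `[0, T] (EFin \o g).
  by apply/measurable_EFinP; exact: measurable_funTS.
have part (u : R -> R) : measurable_fun `[0%R, T] (EFin \o u) -> (forall x : R, 0 <= u x) ->
   (\int[msum (fun n => \d_(renewal_time tau n w)) N]_(x in `[0%R, T]) (u x)%:E =
    (\sum_(n < N) (renewal_time tau n w <= T)%R%:R * u (renewal_time tau n w))%:E)%E.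
  move=> mu u0; rewrite ge0_integral_measure_sum//; last by move=> x _; rewrite lee_fin.
  rewrite -sumEFin; apply: eq_bigr => n _; rewrite integral_dirac// diracE.
  by rewrite mem_setE in_itv/= t0/= EFinM.
rewrite integralE.
rewrite (eq_integral (fun x => (Num.max (g x) 0)%:E)); last first.
  by move=> x _; rewrite funeposE EFin_max.
rewrite [X in (_ - X)%E](eq_integral (fun x => (Num.max (- g x) 0)%:E)); last first.
  by move=> x _; rewrite funenegE EFin_max.
rewrite !part; first last.
- by move=> x; rewrite le_max lexx orbT.
- apply/measurable_EFinP; apply: measurable_maxr; last exact: measurable_cst.
  exact/measurable_EFinP.
- by move=> x; rewrite le_max lexx orbT.
- apply/measurable_EFinP; apply: measurable_maxr; last exact: measurable_cst.
  by apply: measurable_funN; exact/measurable_EFinP.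
rewrite -EFinB /= -sumrB; apply: eq_bigr => n _; rewrite -mulrBr mulrC; congr (_ * _).
by case: (leP (g (renewal_time tau n w)) 0) => h; case: (leP (- g _) 0) => h'; lra.
Qed.

Lemma state_of_nonneg (w : Omega) n : (forall i, 0 <= tau i w) ->
  state T g (fun i => tau i : Omega -> R) n w =
  (\sum_(i < n) tau i w, \sum_(i < n) g (renewal_time tau i w) *
     (renewal_time tau i w <= T)%R%:R).
Proof.
move=> w0; elim: n => [|n IH]; first by rewrite /= !big_ord0.
rewrite /= IH /next_state /= (max_idPl (w0 n)) !big_ord_recr/=.
by rewrite /renewal_time big_ord_recr.
Qed.

Lemma renewal_integral_state (w : Omega) (N n : nat) : (forall i, 0 <= tau i w) ->
  T < (state T g (fun i => tau i : Omega -> R) N w).1 -> (N <= n)%N ->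
  T < (state T g (fun i => tau i : Omega -> R) n w).1 /\
  renewal_integral T tau g w = (state T g (fun i => tau i : Omega -> R) n w).2.
Proof.
move=> w0; rewrite !state_of_nonneg//= => TN Nn.
have grow m m' : (m <= m')%N -> \sum_(i < m) tau i w <= \sum_(i < m') tau i w.
  move=> mm'; rewrite -(subnKC mm') big_split_ord/= lerDl sumr_ge0//.
split; first by apply: lt_le_trans (grow _ _ Nn).
apply: renewal_integral_sum => m.
  move=> nm; apply: (lt_le_trans TN); apply: grow.
  by rewrite (leq_trans Nn)// (leq_trans nm).
by apply: sumr_ge0.
Qed.

Variable f : R -> R.
Hypothesis f_ge0 : forall x : R, 0 <= f x.
Hypothesis f_neg : forall x : R, x < 0 -> f x = 0.
Variable t : R.
Hypothesis t_gt0 : 0 < t.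
Hypothesis tail : forall n, (P (tau n @^-1` `]-oo, T]) <= (1 - t)%:E)%E.
Hypothesis nonneg : forall n, P (tau n @^-1` `]-oo, 0[) = 0%E.
Hypothesis ind : mutually_independent tau.

Lemma ae_spacings_ge0 : {ae P, forall w, forall i, 0 <= tau i w}.
Proof.
apply: ae_foralln => n; exists (tau n @^-1` `]-oo, 0[); split.
- exact: measurable_funPTI.
- exact: nonneg.
- by move=> w /=; rewrite in_itv/= => /negP; rewrite -ltNge.
Qed.

(** If the times never exceed [T] then neither does any spacing, and each of the
independent spacings does so with probability at most [1 - t < 1]. *)
Lemma ae_state_late : {ae P, forall w,
  exists N, T < (state T g (fun i => tau i : Omega -> R) N w).1}.
Proof.
pose E n := \bigcap_(i in `I_n) (tau i @^-1` `]-oo, T]%classic).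
have mE n : measurable (E n).
  by apply: fin_bigcap_measurable => // i _; exact: measurable_funPTI.
pose F := \bigcap_n (E n).
have mF : measurable F by apply: bigcap_measurableType.
have PE n : (P (E n) <= ((1 - t) ^+ n)%:E)%E.
  rewrite /E (probability_bigcap ind)//.
  elim: n => [|n IH]; first by rewrite big_ord0 expr0.
  rewrite big_ord_recr/= exprSr EFinM; apply: lee_pmul => //.
  by apply: prode_ge0.
have t1 : 0 <= 1 - t.
  by rewrite -lee_fin; apply: le_trans (tail 0%N); exact: measure_ge0.
exists F; split => //.
- apply/eqP; rewrite -measure_le0.
  have cvg0 : ((1 - t) ^+ n)%:E @[n --> \oo] --> 0%E.
    apply: cvg_EFin; first by apply: nearW.
    by apply: cvg_expr; rewrite ger0_norm// ltrBlDr ltrDl.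
  apply: (cvge_ge _ cvg0); apply: nearW => n.
  by apply: le_trans (PE n); rewrite le_measure ?inE//; exact: bigcap_inf.
- move=> w /= /forallNP nlate n _ i /= iN; rewrite in_itv/=.
  have := nlate i.+1; move=> /negP; rewrite -leNgt; apply: le_trans => /=.
  have := @state_time_ge0 _ T g _ (fun i => tau i : Omega -> R) i w.
  have : tau i w <= Num.max (tau i w) 0 by rewrite le_max lexx.
  lra.
Qed.

Variables (phi : R -> R) (v : R -> R -> R) (k : R -> R) (th : R).
Hypothesis mphi : measurable_fun setT phi.
Hypothesis mk : measurable_fun setT k.
Hypothesis mv : measurable_fun setT (fun z : R * R => v z.1 z.2).
Hypothesis v_end : forall s x : R, T < s -> v s x = phi x.
Hypothesis super : forall n, (\int[P]_w (potential T v k th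
  (state T g (fun i => tau i : Omega -> R) n w))%:E <= (potential T v k th (0, 0))%:E)%E.

(** Almost surely the potential is eventually constant, equal to
[expR (th * phi G)]; Fatou's lemma passes to the limit in the supermartingale. *)
Lemma expR_renewal_integral_le :
  (\int[P]_w (expR (th * phi (renewal_integral T tau g w)))%:E <=
   (potential T v k th (0, 0))%:E)%E.
Proof.
pose Z n w := (potential T v k th (state T g (fun i => tau i : Omega -> R) n w))%:E.
have mZ n : measurable_fun setT (Z n).
  apply/measurable_EFinP; apply: measurableT_comp; first exact: measurable_potential.
  exact: measurable_state.
have Z0 n w : (0 <= Z n w)%E by rewrite lee_fin expR_ge0.
have mG : measurable_fun setT (fun w => (expR (th * phi (renewal_integral T tau g w)))%:E).
  apply/measurable_EFinP; apply: measurableT_comp; first exact: measurable_expR.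
  apply: measurable_funM => //.
  by apply: measurableT_comp => //; exact: measurable_renewal_integral.
have liminf0 w : (0 <= limn_einf (Z ^~ w))%E.
  rewrite limn_einf_lim; apply: lime_ge; first exact: is_cvg_einfs.
  by apply: nearW => n; apply: le_ereal_inf_tmp => _ [m _ <-].
apply: (@le_trans _ _ (\int[P]_w limn_einf (Z ^~ w))%E).
  apply: ae_ge0_le_integral => //.
    rewrite /limn_einf; apply: measurableT_comp => //.
    by apply: measurable_fun_limn_esup => n; exact: measurableT_comp.
  apply: filterS2 ae_spacings_ge0 ae_state_late => w w0 [N TN] _.
  have Zcvg : Z n w @[n --> \oo] --> (expR (th * phi (renewal_integral T tau g w)))%:E.
    apply: cvg_near_cst; exists N => // n /= Nn.
    have [Tn ->] := renewal_integral_state w0 TN Nn.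
    rewrite /Z [X in potential _ _ _ _ X]surjective_pairing.
    by rewrite (potential_end T_ge0 k th v_end).
  by rewrite (cvg_limn_einf_sup Zcvg).1.
apply: le_trans (fatou P measurableT mZ _) _ => //.
rewrite limn_einf_lim; apply: lime_le; first exact: is_cvg_einfs.
apply: nearW => n; apply: le_trans (super n).
by apply: ereal_inf_lbound; exists n => //=.
Qed.

End renewal_integral_state.

Section exponential_moment.
Context d (Omega : measurableType d) (R : realType) (P : probability Omega R).
Notation mu := (@lebesgue_measure R).
Variables (f : R -> R) (T t b : R) (tau : nat -> {RV P >-> R}) (g : {mfun R >-> R}).
Hypothesis f_ge0 : forall x : R, 0 <= f x.
Hypothesis mf : measurable_fun setT f.
Hypothesis f_neg : forall x : R, x < 0 -> f x = 0.
Hypothesis t_gt0 : 0 < t.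
Hypothesis f_tail : \int[mu]_(x in `[0, T]) f x <= 1 - t.
Hypothesis f_le : forall x : R, 0 <= x <= T -> f x <= b * t.
Hypothesis T_ge0 : 0 <= T.
Hypothesis ig : mu.-integrable `[0, T] (EFin \o g).
Hypothesis ig2 : mu.-integrable `[0, T] (EFin \o (fun r => g r ^+ 2)).
Variable hbar : R.
Hypothesis hbar_gt0 : 0 < hbar.
Hypothesis f_ratio : forall x z : R, 0 <= z -> z <= x -> x <= T ->
  f (x - z) <= hbar * f x.
Hypothesis ind : mutually_independent tau.
Hypothesis dens : forall n (A : set R), measurable A ->
  distribution P (tau n) A = (\int[mu]_(x in A) (f x)%:E)%E.
Variable h : R -> R.
Hypothesis h_ge : forall r : R, 0 <= r -> r <= T ->
  `|g r| + Num.sqrt ((hbar ^+ 2 + t ^- 2 - 1) * second_moment T b g r) <= h r.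

Let f_int : (\int[mu]_x (f x)%:E = 1)%E.
Proof. by rewrite -(dens 0%N)//; exact: probability_setT. Qed.

Let mg : measurable_fun setT g. Proof. exact: measurable_funPT. Qed.

Let tail n : (P (tau n @^-1` `]-oo, T]) <= (1 - t)%:E)%E.
Proof.
have -> : P (tau n @^-1` `]-oo, T]) = (\int[mu]_(x in `[0%R, T]) (f x)%:E)%E.
  rewrite [LHS](dens n)//.
  rewrite [LHS]integral_mkcond [RHS]integral_mkcond; apply: eq_integral => x _.
  rewrite !patchE !mem_setE !in_itv/=.
  by case: (leP 0 x) => //= x0; rewrite f_neg// if_same.
have I : mu.-integrable `[0, T] (EFin \o f).
  have := integrable_densityS f_ge0 mf f_int 0 (measurable_itv `[0, T]).
  by apply: eq_integrable => // x _ /=; rewrite subr0.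
have fin : (\int[mu]_(x in `[0%R, T]) (f x)%:E)%E \is a fin_num.
  exact: integrable_fin_num.
by rewrite -(fineK fin) lee_fin.
Qed.

Let nonneg n : P (tau n @^-1` `]-oo, 0[) = 0%E.
Proof.
rewrite -[LHS]/(distribution P (tau n) `]-oo, 0[) (dens n)// integral0_eq// => x /=.
by rewrite in_itv/= => x0; rewrite f_neg.
Qed.

Lemma expR_moment_fixed_point (phi : R -> R) (v : R -> R -> R) (k : R -> R) (th : R) :
  (forall x y : R, `|phi x - phi y| <= `|x - y|) -> admissible T b g phi v ->
  (forall s x : R, 0 <= s -> v s x = value_step f T g phi v s x) ->
  0 <= th -> measurable_fun setT k -> mu.-integrable `[0, T] (EFin \o k) ->
  (forall r : R, 0 <= r -> r <= T -> b * kappa (th * h r) <= k r) ->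
  (\int[P]_w (expR (th * phi (renewal_integral T tau g w)))%:E <=
   (expR (th * v 0 0 + \int[mu]_(r in `[0, T]) k r))%:E)%E.
Proof.
move=> phi_lip av v_fix th0 mk ik k_ge.
have v_end (s x : R) : T < s -> v s x = phi x.
  move=> Ts; have s0 : 0 <= s by exact: le_trans (ltW Ts).
  have := adm_near av x s0.
  rewrite (remaining_after b T_ge0 g (ltW Ts)).
  by rewrite normr_le0 subr_eq0 => /eqP.
have mv := adm_measurable av.
have first_point s x : 0 <= s -> s <= T -> _ :=
  @expR_first_point _ f T t b f_ge0 mf f_int f_neg t_gt0 f_tail f_le T_ge0 g mg ig
    ig2 hbar hbar_gt0 f_ratio phi phi_lip v av v_fix h k th th0 h_ge ik k_ge s x.
have super := potential_supermartingale f_ge0 mf f_int f_neg T_ge0 mg mk mv v_end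
  first_point ind dens.
rewrite -(potentialE T v k th 0 (lexx 0)).
exact: (expR_renewal_integral_le T_ge0 t_gt0 tail nonneg ind
  (lipschitz1_measurable phi_lip) mk mv v_end super).
Qed.

(** The constant [m] does not depend on [th] and [k].  The second
bound is the first one for [- phi], whose value function is [- v]; together they
compare [m] with the mean of [phi G]. *)
Theorem expR_moment_two_sided (phi : R -> R) :
  (forall x y : R, `|phi x - phi y| <= `|x - y|) ->
  exists m : R, forall (k : R -> R) (th : R), 0 <= th ->
    measurable_fun setT k -> mu.-integrable `[0, T] (EFin \o k) ->
    (forall r : R, 0 <= r -> r <= T -> b * kappa (th * h r) <= k r) ->
    (\int[P]_w (expR (th * (phi (renewal_integral T tau g w) - m)))%:E <=
     (expR (\int[mu]_(r in `[0, T]) k r))%:E)%E /\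
    (\int[P]_w (expR (th * (m - phi (renewal_integral T tau g w))))%:E <=
     (expR (\int[mu]_(r in `[0, T]) k r))%:E)%E.
Proof.
move=> phi_lip.
have [v av v_fix] := value_function_exists f_ge0 mf f_int f_neg t_gt0 f_tail f_le
  T_ge0 mg ig phi_lip.
have mG : measurable_fun setT (renewal_integral T tau g).
  exact: measurable_renewal_integral.
exists (v 0 0) => k th th0 mk ik k_ge.
have shift (psi : R -> R) (m : R) : measurable_fun setT psi ->
    (\int[P]_w (expR (th * psi (renewal_integral T tau g w)))%:E <=
      (expR (th * m + \int[mu]_(r in `[0, T]) k r))%:E)%E ->
    (\int[P]_w (expR (th * (psi (renewal_integral T tau g w) - m)))%:E <=
      (expR (\int[mu]_(r in `[0, T]) k r))%:E)%E.
  move=> mpsi le.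
  have -> : (\int[P]_w (expR (th * (psi (renewal_integral T tau g w) - m)))%:E =
      (expR (- (th * m)))%:E * \int[P]_w (expR (th * psi (renewal_integral T tau g w)))%:E)%E.
    rewrite -ge0_integralZl//.
    - apply: eq_integral => w _; rewrite -EFinM -expRD; congr (expR _)%:E; ring.
    - apply/measurable_EFinP; apply: measurableT_comp; first exact: measurable_expR.
      by apply: measurable_funM => //; exact: measurableT_comp.
  rewrite [leRHS](_ : _ = (expR (- (th * m)))%:E *
     (expR (th * m + \int[mu]_(r in `[0, T]) k r))%:E)%E.
    by rewrite lee_wpmul2l ?lee_fin ?expR_ge0.
  by rewrite -EFinM -expRD addKr.
split.
  apply: (shift phi); first exact: lipschitz1_measurable.
  exact: expR_moment_fixed_point.
under eq_integral do rewrite addrC -[X in - _ + X]opprK.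
apply: (shift (fun x => - phi x) (- v 0 0)).
  by apply: measurable_funN; exact: lipschitz1_measurable.
have Nphi_lip (x y : R) : `|- phi x - - phi y| <= `|x - y|.
  by rewrite -opprD normrN.
apply: (expR_moment_fixed_point (phi := fun x => - phi x) (v := fun s x => - v s x)) => //.
- split.
  + by apply: measurable_funN; exact: adm_measurable av.
  + by move=> s x s0; rewrite -opprD normrN; exact: adm_near av _ _ _.
  + by move=> s x y s0; rewrite -opprD normrN; exact: adm_lip av _ _ _ _.
- move=> s x s0; rewrite v_fix// /value_step opprD; congr (_ + _).
  rewrite -mulN1r -RintegralZl//; last first.
    exact: (integrable_jump f_ge0 mf f_neg t_gt0 f_le T_ge0 mg ig phi_lip x av s0).
  by apply: eq_Rintegral => r _; ring.
Qed.

End exponential_moment.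

(** * Transport on the line *)

Section rays.
Context {R : realType}.

Lemma probability_eq_rays (s1 s2 : probability R R) :
  (forall x : R, s1 `]-oo, x]%classic = s2 `]-oo, x]%classic) ->
  forall A : set R, measurable A -> s1 A = s2 A.
Proof.
move=> s12 A mA.
apply: (@measure_unique _ _ _ (@RGenOInfty.G R) (fun k => `]- k%:R, +oo[%classic)) => //.
- exact: RGenOInfty.measurableE.
- move=> _ _ [x ->] [y ->]; exists (Num.max x y).
  apply/seteqP; split => z /=; rewrite !in_itv/= !andbT gt_max.
    by move=> [-> ->].
  by move=> /andP[].
- by move=> k; exists (- k%:R).
- rewrite -subTset => x _; exists (Num.bound `|x|) => //=.
  rewrite in_itv/= andbT ltrNl (le_lt_trans (ler_norm _))// normrN.
  exact: archi_boundP.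
- move=> _ [x ->]; rewrite -setCitvl.
  have E (s : probability R R) : (s (~` `]-oo, x]) = 1 - s `]-oo, x]%classic)%E.
    exact: probability_setC.
  by apply: (etrans (E s1)); apply/esym/(etrans (E s2)); rewrite s12.
- by move=> k; rewrite (le_lt_trans (probability_le1 _ _))// ltry.
Qed.

End rays.

Section quantile.
Context {R : realType}.
Variable s : probability R R.

Let idR : {mfun R >-> R} := HB.pack (idfun : R -> R)
  (isMeasurableFun.Build _ _ _ _ (idfun : R -> R) (@measurable_id _ _ setT)).

Definition distr_fun (x : R) : R := fine (s `]-oo, x]%classic).

Lemma distr_funE x : (distr_fun x)%:E = s `]-oo, x]%classic.
Proof. by rewrite /distr_fun fineK// fin_num_measure. Qed.

Lemma distr_fun_nd x y : x <= y -> distr_fun x <= distr_fun y.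
Proof.
move=> xy; rewrite -lee_fin !distr_funE le_measure ?inE//.
by apply: subset_itvl; rewrite bnd_simp.
Qed.

Lemma distr_fun_ge0 x : 0 <= distr_fun x.
Proof. by rewrite fine_ge0. Qed.

Lemma distr_fun_le1 x : distr_fun x <= 1.
Proof. by rewrite -lee_fin distr_funE probability_le1. Qed.

Let cvg_distr_fun_y : distr_fun x @[x --> +oo] --> (1 : R).
Proof. exact/fine_cvg/(cvg_cdfy1 idR). Qed.

Let cvg_distr_fun_Ny : distr_fun x @[x --> -oo] --> (0 : R).
Proof. exact/fine_cvg/(cvg_cdfNy0 idR). Qed.

Let distr_fun_right x : distr_fun y @[y --> x^'+] --> distr_fun x.
Proof.
apply: fine_cvg; rewrite distr_funE; have := @cdf_right_continuous _ _ _ _ idR x.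
exact.
Qed.

(** Generalized inverse of the distribution function on the open unit interval, a
set of full mass for the uniform law; [0] is a default value. *)
Definition quantile (u : R) : R :=
  if (0 < u) && (u < 1) then inf [set x | u <= distr_fun x] else 0.

(** The Galois connection with the distribution function; the infimum is attained
by right continuity. *)
Lemma quantile_le u x : 0 < u -> u < 1 -> (quantile u <= x) = (u <= distr_fun x).
Proof.
move=> u0 u1; rewrite /quantile u0 u1/=; set A := [set x | _].
have A0 : A !=set0.
  have : \forall y \near +oo, u < distr_fun y by exact: (cvgr_gt 1 cvg_distr_fun_y u u1).
  by move=> [M [_ MA]]; exists (M + 1); apply/ltW/MA; rewrite ltrDl.
have Alb : has_lbound A.
  have : \forall y \near -oo, distr_fun y < u by exact: (cvgr_lt 0 cvg_distr_fun_Ny u u0).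
  move=> [M [_ MA]]; exists (M - 1) => y Ay; rewrite leNgt; apply/negP => yM.
  have : distr_fun y < u by apply: MA; apply: lt_trans yM _; rewrite ltrBlDr ltrDl.
  by rewrite ltNge (Ay : u <= distr_fun y).
have inA y : inf A < y -> u <= distr_fun y.
  move=> /(inf_lt A0)[z Az zy].
  by apply: le_trans (Az : u <= distr_fun z) _; apply: distr_fun_nd; exact: ltW.
apply/idP/idP => [Ax|ux]; last exact: ge_inf.
apply: le_trans (distr_fun_nd Ax).
apply: (cvgr_to_ge (@distr_fun_right (inf A))).
by near=> y; apply: inA; near: y; exact: nbhs_right_gt.
Unshelve. all: by end_near. Qed.

Lemma measurable_quantile : measurable_fun setT quantile.
Proof.
apply: (measurability (@RGenOInfty.G R)) => [|/= _ [_] [x ->] <-].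
  exact: RGenOInfty.measurableE.
have -> : [set: R] `&` quantile @^-1` `]x, +oo[ =
    (`]0, 1[ `&` ~` `]-oo, distr_fun x]) `|` (~` `]0, 1[ `&` [set _ | x < 0]).
  apply/seteqP; split => u /=; rewrite !in_itv/= !andbT.
    move=> [_]; case: (boolP ((0 < u) && (u < 1))) => [/andP[u0 u1]|u01] h; last first.
      by right; split=> //; move: h; rewrite /quantile (negbTE u01).
    by left; split=> //; move: h; rewrite ltNge quantile_le// => /negP.
  move=> [[/andP[u0 u1] /negP]|[/negP/negbTE u01 x0]]; split => //.
    by rewrite ltNge quantile_le.
  by rewrite /quantile u01.
apply: measurableU.
  by apply: measurableI => //; exact: measurableC.
apply: measurableI; first exact: measurableC.
by case: (x < 0); [rewrite (_ : [set _ | _] = setT)//; apply/seteqP; split|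
  rewrite (_ : [set _ | _] = set0)//; apply/seteqP; split].
Qed.

Lemma quantile_uniform (x : R) :
  uniform_prob (@ltr01 R) (quantile @^-1` `]-oo, x]) = s `]-oo, x]%classic.
Proof.
have mq : measurable (quantile @^-1` `]-oo, x]).
  by rewrite -[X in measurable X]setTI; exact: measurable_quantile.
rewrite (_ : uniform_prob _ _ = \int[uniform_prob (@ltr01 R)]_u
  (\1_(quantile @^-1` `]-oo, x]) u)%:E)%E; last by rewrite integral_indic// setIT.
rewrite integral_uniform//; last exact/measurable_EFinP/measurable_indic.
have cc (u : R -> R) : measurable_fun setT u ->
    (\int[lebesgue_measure]_(y in `[0%R, 1%R]) (u y)%:E =
     \int[lebesgue_measure]_(y in `]0%R, 1%R[) (u y)%:E)%E.
  move=> mu; apply: integral_itv_bndoo.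
  by apply/measurable_EFinP; exact: measurable_funTS.
rewrite subr0 invr1 mul1e cc; last exact: measurable_indic.
transitivity (\int[lebesgue_measure]_(y in `]0%R, 1%R[) (\1_(`]-oo, distr_fun x]) y)%:E)%E.
  apply: eq_integral => u; rewrite inE/= in_itv/= => /andP[u0 u1].
  rewrite !indicE; congr ((_ : bool)%:R)%:E.
  by apply/idP/idP; rewrite !inE/= !in_itv/= quantile_le.
rewrite -cc; last exact: measurable_indic.
rewrite integral_indic// (_ : _ `&` _ = `[0, distr_fun x]%classic); last first.
  apply/seteqP; split => u /=; rewrite !in_itv/=; first by move=> [-> /andP[->]].
  by move=> /andP[u0 ux]; rewrite ux u0 (le_trans ux (distr_fun_le1 x)).
transitivity (lebesgue_measure `[0, distr_fun x]%classic); first by [].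
rewrite lebesgue_measure_itv/= lte_fin.
case: ifPn => [_|]; first by rewrite sube0 distr_funE.
rewrite -leNgt => F0; rewrite -distr_funE; congr (_%:E).
by apply/esym/le_anti; rewrite F0 distr_fun_ge0.
Qed.

End quantile.

Section transport_upper_bound.
Context {R : realType}.
Notation mu := (@lebesgue_measure R).
Variables s1 s2 : probability R R.

Let U := uniform_prob (@ltr01 R).
Let q1 := quantile s1.
Let q2 := quantile s2.

(** The slope of an optimal potential: the sign of [distr_fun s2 - distr_fun s1]. *)
Let slope (x : R) : R := if distr_fun s1 x <= distr_fun s2 x then 1 else -1.

Let mslope : measurable_fun setT slope.
Proof.
apply: measurable_fun_if => //.
by apply: measurable_fun_ler; apply: nondecreasing_measurable => // x y; exact: distr_fun_nd.
Qed.

Let islope (a b : R) : mu.-integrable `[a, b] (EFin \o slope).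
Proof.
apply: measurable_bounded_integrable => //.
- exact: compact_finite_measure (@segment_compact _ _ _).
- exact: measurable_funTS.
exists 1; split => // M M1 x _ /=; rewrite (le_trans _ (ltW M1))//.
by rewrite /slope; case: ifP; rewrite ?normrN normr1.
Qed.

(** The integral of the slope from [0] to [y]; one of the two terms is an integral
over a set with at most one point. *)
Definition kantorovich_potential (y : R) : R :=
  \int[mu]_(x in `[0, y]) slope x - \int[mu]_(x in `[y, 0]) slope x.

Let potentialB (y z : R) : y <= z ->
  kantorovich_potential z - kantorovich_potential y = \int[mu]_(x in `[y, z]) slope x.
Proof.
move=> yz; rewrite /kantorovich_potential.
have E (a b : R) : b < a -> \int[mu]_(x in `[a, b]) slope x = 0.
  by move=> ba; rewrite set_itv_ge ?Rintegral_set0// bnd_simp -ltNge.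
have S (a b c : R) : a <= b -> b <= c -> \int[mu]_(x in `[a, c]) slope x =
    \int[mu]_(x in `[a, b]) slope x + \int[mu]_(x in `[b, c]) slope x.
  by move=> ab bc; exact: Rintegral_itvcc_cat.
have Z (a : R) : \int[mu]_(x in `[a, a]) slope x = 0 by exact: Rintegral_itv1.
have [y0|y0] := leP 0 y; have [z0|z0] := leP 0 z; last 2 first.
- have := S y 0 z (ltW y0) z0; move: z0; rewrite le_eqVlt => /predU1P[<-|z0].
    by rewrite Z (E 0 y)//; lra.
  by rewrite (E 0 y)// (E z 0)//; lra.
- by rewrite (E 0 y)// (E 0 z)// (S y z 0 yz (ltW z0)); lra.
- have := S 0 y z y0 yz; move: y0; rewrite le_eqVlt => /predU1P[<-|y0].
    move: z0; rewrite le_eqVlt => /predU1P[<-|z0]; first by rewrite !Z; lra.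
    by rewrite (E z 0)// Z; lra.
  by rewrite (E y 0)// (E z 0) ?(lt_le_trans y0)//; lra.
- by move: (lt_le_trans z0 (le_trans y0 yz)); rewrite ltxx.
Qed.

Lemma kantorovich_potential_lip (x y : R) :
  `|kantorovich_potential x - kantorovich_potential y| <= `|x - y|.
Proof.
wlog xy : x y / y <= x.
  move=> H; have [yx|/ltW xy] := leP y x; first exact: H.
  by rewrite distrC [leRHS]distrC; exact: H.
rewrite potentialB//; apply: (le_trans (le_normr_Rintegral _ _)) => //.
rewrite (ger0_norm (_ : 0 <= x - y)) ?subr_ge0//.
have -> : x - y = \int[mu]_(z in `[y, x]) (cst 1 z : R).
  rewrite Rintegral_cst//= mul1r lebesgue_measure_itv/= lte_fin.
  by move: xy; rewrite le_eqVlt => /predU1P[->|->]//; rewrite ltxx subrr.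
apply: le_Rintegral => //.
- exact: (integrable_norm (islope _ _)).
- apply: measurable_bounded_integrable => //.
    exact: compact_finite_measure (@segment_compact _ _ _).
  exact: bounded_cst.
- by move=> z _; rewrite /slope /=; case: ifP; rewrite ?normrN normr1.
Qed.

Let potential_const (y z c : R) : y <= z ->
  (forall x, y < x -> x < z -> slope x = c) ->
  kantorovich_potential z - kantorovich_potential y = c * (z - y).
Proof.
move=> yz sc; rewrite potentialB//.
rewrite /Rintegral (@integral_itv_bndoo _ y z (EFin \o slope) true false); last first.
  by apply/measurable_EFinP; exact: measurable_funTS.
rewrite (eq_integral (EFin \o cst c)); last first.
  by move=> x; rewrite inE/= in_itv/= => /andP[yx xz]; rewrite sc.
rewrite -(@integral_itv_bndoo _ y z (EFin \o cst c) true false); last first.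
  by apply/measurable_EFinP; exact: measurable_cst.
rewrite -/(Rintegral mu `[y, z] (cst c)) Rintegral_cst//= lebesgue_measure_itv/= lte_fin.
by move: yz; rewrite le_eqVlt => /predU1P[->|->]//; rewrite ltxx subrr mulr0.
Qed.

(** Between the two quantiles the distribution functions lie on either side of
[u], so the slope is constant there and the potential gains all the distance. *)
Lemma quantile_dist u :
  `|q1 u - q2 u| = kantorovich_potential (q1 u) - kantorovich_potential (q2 u).
Proof.
case: (boolP ((0 < u) && (u < 1))) => [/andP[u0 u1]|u01]; last first.
  by rewrite /q1 /q2 /quantile (negbTE u01) !subrr normr0.
have [q12|q21] := leP (q1 u) (q2 u).
  rewrite ler0_norm ?subr_le0// -[RHS]opprB (@potential_const _ _ (-1))//.
    by lra.
  move=> x q1x xq2; rewrite /slope.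
  have F1 : u <= distr_fun s1 x by rewrite -quantile_le// ltW.
  have F2 : distr_fun s2 x < u by rewrite ltNge -quantile_le// -ltNge.
  by rewrite leNgt (lt_le_trans F2 F1).
rewrite gtr0_norm ?subr_gt0// (@potential_const _ _ 1) ?mul1r//; first exact: ltW.
move=> x q2x xq1; rewrite /slope.
have F2 : u <= distr_fun s2 x by rewrite -quantile_le// ltW.
have F1 : distr_fun s1 x < u by rewrite ltNge -quantile_le// -ltNge.
by rewrite (le_trans (ltW F1) F2).
Qed.

Let pair_fun (u : measurableTypeR R) : R * R := (q1 u, q2 u).

Let mpair : measurable_fun setT pair_fun.
Proof. by apply/measurable_fun_pairP; split; exact: measurable_quantile. Qed.

Let quantile_law (s : probability R R) (A : set R) : measurable A ->
  U (quantile s @^-1` A) = s A.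
Proof.
move=> mA.
pose Q : {mfun measurableTypeR R >-> R} := HB.pack (quantile s : measurableTypeR R -> R)
  (isMeasurableFun.Build _ _ _ _ (quantile s : measurableTypeR R -> R)
    (@measurable_quantile _ s)).
apply: (@probability_eq_rays _ (distribution U Q) s) => // x.
exact: quantile_uniform.
Qed.

(** The equality in [quantile_dist] holds pointwise under the coupling of the two
quantile functions by a uniform variable, and may be integrated. *)
Lemma transport_cost_le :
  s1.-integrable setT (EFin \o kantorovich_potential) ->
  s2.-integrable setT (EFin \o kantorovich_potential) ->
  (transport_cost (fun x y => `|x - y|%R) s1 s2 <=
   \int[s1]_x (kantorovich_potential x)%:E - \int[s2]_x (kantorovich_potential x)%:E)%E.
Proof.
move=> i1 i2.
pose Q : {mfun measurableTypeR R >-> (R * R)%type} := HB.pack pair_fun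
  (isMeasurableFun.Build _ _ _ _ pair_fun mpair).
pose rho : probability (R * R)%type R := distribution U Q.
have mphi := lipschitz1_measurable kantorovich_potential_lip.
have law (s : probability R R) : s.-integrable setT (EFin \o kantorovich_potential) ->
    U.-integrable setT (EFin \o (kantorovich_potential \o quantile s)) /\
    (\int[s]_x (kantorovich_potential x)%:E =
     \int[U]_u (kantorovich_potential (quantile s u))%:E)%E.
  move=> is_.
  pose Qs : {mfun measurableTypeR R >-> R} := HB.pack (quantile s : measurableTypeR R -> R)
    (isMeasurableFun.Build _ _ _ _ (quantile s : measurableTypeR R -> R)
      (@measurable_quantile _ s)).
  have E k : (\int[s]_x k x = \int[distribution U Qs]_x k x)%E.
    by apply: eq_measure_integral => A mA _; exact/esym/(quantile_law s mA).
  have iU : U.-integrable setT (EFin \o (kantorovich_potential \o quantile s)).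
    apply/integrableP; split.
      by apply/measurable_EFinP; apply: measurableT_comp => //; exact: measurable_quantile.
    have /integrableP[_] := is_; rewrite E ge0_integral_distribution//.
    by apply: measurableT_comp => //; exact/measurable_EFinP.
  split=> //; rewrite E.
  have := @integral_distribution _ _ _ _ _ U Qs (EFin \o kantorovich_potential).
  by apply => //; exact/measurable_EFinP.
have [iU1 E1] := law s1 i1; have [iU2 E2] := law s2 i2.
apply: ereal_inf_lbound; exists rho.
  split=> [A mA|B mB].
    rewrite -(quantile_law s1 mA); congr (U _).
    by apply/seteqP; split => u //= [].
  rewrite -(quantile_law s2 mB); congr (U _).
  by apply/seteqP; split => u //= [].
rewrite /rho ge0_integral_distribution//; last first.
  apply/measurable_EFinP; apply: measurableT_comp => //.
  by apply: measurable_funB; [exact: measurable_fst|exact: measurable_snd].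
rewrite E1 E2 -integralB//; apply: eq_integral => u _.
by rewrite /= quantile_dist EFinB.
Qed.

End transport_upper_bound.

(** * Entropy *)

Section donsker_varadhan.
Local Open Scope charge_scope.
Context {R : realType}.

(** [l] need not be integrable: only its negative part is controlled. *)
Lemma le_integral_ae_above d (U : measurableType d) (m : {measure set U -> \bar R})
    (u l : U -> \bar R) :
  m.-integrable setT u -> measurable_fun setT l ->
  {ae m, forall x, (u x <= l x)%E} ->
  (\int[m]_x u x <= \int[m]_x l x)%E.
Proof.
move=> iu ml ul; rewrite [leLHS]integralE [leRHS]integralE; apply: leeB.
- apply: ae_ge0_le_integral => //.
  + by apply: measurable_funepos; exact: measurable_int iu.
  + exact: measurable_funepos.
  + apply: filterS ul => x ulx _; rewrite !funeposE.
    by rewrite ge_max !le_max ulx lexx orbT.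
- apply: ae_ge0_le_integral => //.
  + exact: measurable_funeneg.
  + by apply: measurable_funeneg; exact: measurable_int iu.
  + apply: filterS ul => x ulx _; rewrite !funenegE.
    by rewrite ge_max !le_max leeN2 ulx lexx orbT.
Qed.

Let lne_fine (x : \bar R) : x \is a fin_num ->
  lne x = if (0 < x)%E then (ln (fine x))%:E else -oo%E.
Proof.
case: x => [x| |] // _; case: ifPn => [x0|]; first by rewrite lne_EFin.
by rewrite -leNgt => x0; rewrite le0_lneNy.
Qed.

Let measurable_lne_comp d (U : measurableType d) (r : U -> \bar R) :
  measurable_fun setT r -> (forall x, r x \is a fin_num) ->
  measurable_fun setT (@lne R \o r).
Proof.
move=> mr rfin.
rewrite (_ : @lne R \o r = fun x =>
    if (0 < r x)%E then (ln (fine (r x)))%:E else -oo%E); last first.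
  by apply/funext => x; rewrite /= lne_fine.
apply: measurable_fun_ifT => //.
- exact: measurable_fun_lte.
- by apply/measurable_EFinP; apply: measurableT_comp => //; exact: measurableT_comp.
Qed.

(** With [r] the density of [s], the inequality [psi - ln r + 1 <= e^psi / r] holds
where [r > 0], hence [s]-almost everywhere; the integral of the right-hand side
with respect to [s] is at most that of [e^psi] with respect to [m].  The function
[k] below is [e^psi / r], and [0] where [r = 0]. *)
Lemma donsker_varadhan (s m : probability R R) (psi : R -> R) :
  measurable_fun setT psi -> s.-integrable setT (EFin \o psi) ->
  (\int[m]_x (expR (psi x))%:E <= 1)%E ->
  (\int[s]_x (psi x)%:E <= relative_entropy s m)%E.
Proof.
move=> mpsi ipsi le1; rewrite /relative_entropy; case: asboolP => [sm|_]; last exact: leey.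
pose r := Radon_Nikodym_SigmaFinite.f s m.
have r0 x : (0 <= r x)%E by exact: Radon_Nikodym_SigmaFinite.f_ge0.
have rfin x : r x \is a fin_num by exact: Radon_Nikodym_SigmaFinite.f_fin_num.
have mr : measurable_fun setT r.
  exact: measurable_int (Radon_Nikodym_SigmaFinite.f_integrable sm).
have null A : measurable A -> m A = 0%E -> s A = 0%E.
  by move=> mA; exact: (null_content_dominatesP _ _).1 sm A mA.
have rE : ae_eq s setT (@lne R \o ('d (charge_of_finite_measure s) '/d m)) (@lne R \o r).
  have [N [mN N0 H]] := ae_eq_Radon_Nikodym_SigmaFinite sm measurableT.
  exists N; split => //; first exact: null.
  move=> x nx; apply: H => /= h; apply: nx => /= _.
  by rewrite -h.
have rpos : {ae s, forall x, (0 < r x)%E}.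
  exists [set x | r x = 0%E]; split.
  - by rewrite -[X in measurable X]setTI; exact: measurable_eqe.
  - rewrite (Radon_Nikodym_SigmaFinite.f_integral sm)//.
      by rewrite integral0_eq.
    by rewrite -[X in measurable X]setTI; exact: measurable_eqe.
  - move=> x /= /negP; rewrite -leNgt => rx.
    by apply/eqP; rewrite eq_le rx r0.
have mfr : measurable_fun setT (fine \o r) by exact: measurableT_comp.
have mlr := measurable_lne_comp mr rfin.
rewrite (@ae_eq_integral _ _ _ _ _ (@lne R \o r) _ _ _ _ rE)//; last first.
  by apply: measurable_lne_comp => // x; exact: Radon_Nikodym_fin_num.
pose k x := if 0 < fine (r x) then expR (psi x - ln (fine (r x))) else 0.
have k0 x : 0 <= k x by rewrite /k; case: ifP => // _; exact: expR_ge0.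
have mk : measurable_fun setT k.
  apply: measurable_fun_ifT => //.
    by apply: measurable_fun_ltr => //; exact: measurable_cst.
  apply: measurableT_comp; first exact: measurable_expR.
  by apply: measurable_funB => //; exact: measurableT_comp.
have ik1 : (\int[s]_x (k x)%:E <= 1)%E.
  rewrite -(Radon_Nikodym_SigmaFinite.change_of_variables sm)//; last first.
  - exact/measurable_EFinP.
  apply: le_trans le1; apply: ge0_le_integral => //.
  - by move=> x _; rewrite mule_ge0// lee_fin.
  - by apply: emeasurable_funM => //; exact/measurable_EFinP.
  - by apply/measurable_EFinP; apply: measurableT_comp => //; exact: measurable_expR.
  - move=> x _; rewrite -/r -[X in (_ * X)%E](fineK (rfin x)) -EFinM lee_fin.
    rewrite /k; case: ifPn => rx; last by rewrite mul0r expR_ge0.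
    by rewrite expRD expRN lnK// divfK// gt_eqF.
have ik : s.-integrable setT (EFin \o k).
  apply/integrableP; split; first exact/measurable_EFinP.
  apply: (le_lt_trans _ (ltry 1)); apply: le_trans ik1.
  rewrite le_eqVlt; apply/orP; left; apply/eqP; apply: eq_integral => x _.
  by rewrite /= ger0_norm.
have ic : s.-integrable setT (EFin \o cst 1).
  exact: finite_measure_integrable_cst.
have i1 : s.-integrable setT (EFin \o (fun x => psi x + 1)) by exact: (integrableD _ ipsi ic).
have iu : s.-integrable setT (EFin \o (fun x => psi x + 1 - k x)) by exact: (integrableB _ i1 ik).
apply: (@le_trans _ _ (\int[s]_x (psi x + 1 - k x)%:E)%E).
  rewrite integralB_EFin// integralD_EFin//.
  have -> : (\int[s]_x (cst 1 x)%:E = 1)%E.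
    rewrite [LHS](_ : _ = \int[s]_x cst 1%E x)%E// integral_cst// mul1e.
    exact: probability_setT.
  have : (\int[s]_x (k x)%:E)%E \is a fin_num by exact: integrable_fin_num ik.
  have : (\int[s]_x (psi x)%:E)%E \is a fin_num by exact: integrable_fin_num ipsi.
  move: ik1; case: (\int[s]_x (k x)%:E)%E => // y; case: (\int[s]_x (psi x)%:E)%E => // z.
  by rewrite !lee_fin => y1 _ _; lra.
apply: le_integral_ae_above => //.
apply: filterS rpos => x rx; rewrite /= lne_fine// rx lee_fin /k.
have fr : 0 < fine (r x) by rewrite fine_gt0// rx ltey_eq rfin.
rewrite fr; have := expR_ge1Dx (psi x - ln (fine (r x))); lra.
Qed.

End donsker_varadhan.

Section transport_entropy.
Context {R : realType}.

(** By [expR x >= 1 + x] the second bound gives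
[1 + e * th * (c - mean) <= expR (e ^+ 2 * L)], which for small [e] is impossible
unless [c <= mean]. *)
Lemma le_mean_of_expR_bounds (m : probability R R) (phi : R -> R) (c th L : R) :
  measurable_fun setT phi -> 0 < th -> 0 <= L ->
  (forall e, 0 <= e -> e <= 1 ->
    (\int[m]_x (expR (e * th * (phi x - c)))%:E <= (expR (e ^+ 2 * L))%:E)%E /\
    (\int[m]_x (expR (e * th * (c - phi x)))%:E <= (expR (e ^+ 2 * L))%:E)%E) ->
  m.-integrable setT (EFin \o phi) /\ (c%:E <= \int[m]_x (phi x)%:E)%E.
Proof.
move=> mphi th0 L0 H.
have mexp (u : R -> R) : measurable_fun setT u ->
    measurable_fun setT (fun x => (expR (u x))%:E).
  by move=> mu; apply/measurable_EFinP; apply: measurableT_comp => //; exact: measurable_expR.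
have mlin (a : R) : measurable_fun setT (fun x => a * (phi x - c)).
  by apply: measurable_funM => //; exact: measurable_funB.
have mlin' (a : R) : measurable_fun setT (fun x => a * (c - phi x)).
  by apply: measurable_funM => //; exact: measurable_funB.
have ic (a : R) : m.-integrable setT (EFin \o cst a).
  exact: finite_measure_integrable_cst.
have iexp (u : R -> R) (a : R) : measurable_fun setT u ->
    (\int[m]_x (expR (u x))%:E <= a%:E)%E ->
    m.-integrable setT (EFin \o (fun x => expR (u x))).
  move=> mu le; apply/integrableP; split; first exact: mexp.
  apply: (le_lt_trans _ (ltry a)); apply: le_trans le.
  rewrite le_eqVlt; apply/orP; left; apply/eqP; apply: eq_integral => x _.
  by rewrite /= ger0_norm ?expR_ge0.
have [] := H 1 ler01 (lexx _); rewrite mul1r expr1n mul1r => H1 H2.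
have i1 := iexp _ _ (mlin th) H1; have i2 := iexp _ _ (mlin' th) H2.
have iW : m.-integrable setT (EFin \o (fun x => th * (phi x - c))).
  apply: (le_integrable _ _ _ (integrableD _ i1 i2)) => //.
    by apply/measurable_EFinP; exact: mlin.
  move=> x _ /=; rewrite lee_fin.
  rewrite [leRHS]ger0_norm ?addr_ge0 ?expR_ge0//.
  have -> : th * (c - phi x) = - (th * (phi x - c)) by ring.
  have := expR_ge1Dx (th * (phi x - c)); have := expR_ge1Dx (- (th * (phi x - c))).
  have := expR_gt0 (th * (phi x - c)); have := expR_gt0 (- (th * (phi x - c))).
  by case: (ger0P (th * (phi x - c))) => _; lra.
have iphi : m.-integrable setT (EFin \o phi).
  apply: eq_integrable (integrableD _ (integrableZl _ th^-1 iW) (ic c)) => // x _ /=.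
  rewrite -EFinM -EFinD; congr (_%:E); field; exact: lt0r_neq0.
split=> //.
have fphi : (\int[m]_x (phi x)%:E)%E \is a fin_num by exact: integrable_fin_num iphi.
rewrite -(fineK fphi) lee_fin; set a := fine _.
rewrite leNgt; apply/negP => ac.
pose w := th * (c - a); have w0 : 0 < w by rewrite mulr_gt0// subr_gt0.
have mom (e : R) : 0 <= e -> e <= 1 -> 1 + e * w <= expR (e ^+ 2 * L).
  move=> e0 e1; have [_ He] := H e e0 e1; rewrite -lee_fin; apply: le_trans He.
  have iL : m.-integrable setT (EFin \o (fun x => 1 + e * th * c - e * th * phi x)).
    exact: (integrableB _ (ic (1 + e * th * c)) (integrableZl _ (e * th) iphi)).
  have -> : ((1 + e * w)%:E = \int[m]_x (1 + e * th * c - e * th * phi x)%:E)%E.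
    have iZ : m.-integrable setT (EFin \o (fun x => e * th * phi x)).
      exact: (integrableZl _ (e * th) iphi).
    rewrite (integralB_EFin _ (ic (1 + e * th * c)) iZ)//.
    have -> : (\int[m]_x (cst (1 + e * th * c)%R x)%:E = (1 + e * th * c)%R%:E)%E.
      rewrite [LHS](_ : _ = \int[m]_x cst (1 + e * th * c)%:E x)%E// integral_cst//.
      by rewrite [X in (_ * X)%E](_ : _ = 1%E) ?mule1//; exact: probability_setT.
    have -> : (\int[m]_x (e * th * phi x)%R%:E = (e * th * a)%R%:E)%E.
      rewrite EFinM /a fineK// -integralZl//.
    by rewrite -EFinB /w; congr (_%:E); ring.
  apply: le_integral_ae_above => //; first exact: mexp.
  apply: aeW => x; rewrite lee_fin.
  by have := expR_ge1Dx (e * th * (c - phi x)); lra.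
(* Small enough for [e * L * (1 + w) <= w / 2] and [e <= 1]. *)
pose e := w / (2 * (1 + w) * (1 + L)).
have D0 : 0 < 2 * (1 + w) * (1 + L) by rewrite !mulr_gt0//; lra.
have e0 : 0 < e by exact: divr_gt0.
have eD : e * (2 * (1 + w) * (1 + L)) = w by rewrite /e divfK// gt_eqF.
have e1 : e <= 1.
  rewrite ler_pdivrMr// mul1r; have := mulr_ge0 (ltW w0) L0; lra.
have := mom e (ltW e0) e1.
have := expR_ge1Dx (- (e ^+ 2 * L)).
have : expR (- (e ^+ 2 * L)) * expR (e ^+ 2 * L) = 1 by rewrite -expRD addNr expR0.
have := expR_gt0 (e ^+ 2 * L).
move: (expR (- _)) (expR _) => B A A0 BA B1 A1.
have eLw : e * L * (1 + w) <= w / 2.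
  have := mulr_ge0 (ltW e0) (addr_ge0 ler01 (ltW w0)); move: eD; lra.
have eL1 : e * L <= e * L * (1 + w).
  by have := mulr_ge0 (mulr_ge0 (ltW e0) L0) (ltW w0); lra.
have h1 : (1 - e ^+ 2 * L) * A <= 1 by rewrite -BA ler_wpM2r ?(ltW A0)//; lra.
have e2 : 0 <= e ^+ 2 * L by rewrite mulr_ge0 ?sqr_ge0.
have h2 : 1 + e * w - e ^+ 2 * L * A <= 1 by lra.
have h3 : (1 - e ^+ 2 * L) * (1 + e * w) <= 1.
  have [p|n] := leP 0 (1 - e ^+ 2 * L).
    by apply: le_trans h1; rewrite ler_wpM2l.
  apply: (le_trans _ ler01); rewrite nmulr_rle0//.
    by have := mulr_ge0 (ltW e0) (ltW w0); lra.
have h4 : e * w <= e * (e * L * (1 + e * w)) by lra.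
move: h4; rewrite ler_pM2l// => h4.
have h5 : e * L * (1 + e * w) <= e * L * (1 + w).
  have eL0 := mulr_ge0 (ltW e0) L0; apply: ler_wpM2l => //.
  by have := ler_wpM2r (ltW w0) e1; rewrite mul1r; lra.
lra.
Qed.

(** The Donsker-Varadhan inequality is applied to [th * (phi - c) - L], with [phi]
the Kantorovich potential of [s] and [m]. *)
Lemma transport_entropy_le (s m : probability R R) (th L : R) :
  finite_first_moment (fun x y => `|x - y|) s -> 0 < th -> 0 <= L ->
  (forall phi : R -> R, (forall x y : R, `|phi x - phi y| <= `|x - y|) ->
    exists c : R, forall e, 0 <= e -> e <= 1 ->
    (\int[m]_x (expR (e * th * (phi x - c)))%:E <= (expR (e ^+ 2 * L))%:E)%E /\
    (\int[m]_x (expR (e * th * (c - phi x)))%:E <= (expR (e ^+ 2 * L))%:E)%E) ->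
  (th%:E * transport_cost (fun x y => `|x - y|%R) s m - L%:E <= relative_entropy s m)%E.
Proof.
move=> [x0 s1] th0 L0 H.
pose phi := kantorovich_potential s m.
have phi_lip : forall x y : R, `|phi x - phi y| <= `|x - y| := @kantorovich_potential_lip _ s m.
have mphi := lipschitz1_measurable phi_lip.
have [c Hc] := H phi phi_lip.
have [im cm] := le_mean_of_expR_bounds mphi th0 L0 Hc.
have ic (a : R) : s.-integrable setT (EFin \o cst a).
  exact: finite_measure_integrable_cst.
have i0 : s.-integrable setT (EFin \o (fun x => x0 - x)).
  apply/integrableP; split; last exact: s1.
  by apply/measurable_EFinP; exact: measurable_funB.
have is_ : s.-integrable setT (EFin \o phi).
  apply: (le_integrable _ _ _ (integrableD _ (ic `|phi x0|) (integrable_norm i0))) => //.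
    exact/measurable_EFinP.
  move=> x _ /=; rewrite lee_fin [leRHS]ger0_norm ?addr_ge0//.
  rewrite (_ : phi x = phi x0 - (phi x0 - phi x)); last by lra.
  by rewrite (le_trans (ler_normB _ _))// lerD2l.
have fm := integrable_fin_num measurableT im; have fs := integrable_fin_num measurableT is_.
have tc := transport_cost_le is_ im.
have ithphi : s.-integrable setT (EFin \o (fun x => th * phi x)).
  exact: (integrableZl _ th is_).
have ipsi : s.-integrable setT (EFin \o (fun x => th * phi x - (th * c + L))).
  exact: (integrableB _ ithphi (ic (th * c + L))).
have mpsi : measurable_fun setT (fun x => th * phi x - (th * c + L)).
  by apply: measurable_funB => //; exact: measurable_funM.
apply: le_trans (donsker_varadhan mpsi ipsi _); last first.
  have [] := Hc 1 ler01 (lexx _); rewrite mul1r expr1n mul1r => H1 _.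
  have -> : (\int[m]_x (expR (th * phi x - (th * c + L)))%:E =
      (expR (- L))%:E * \int[m]_x (expR (th * (phi x - c)))%:E)%E.
    rewrite -ge0_integralZl//.
    - apply: eq_integral => x _; rewrite -EFinM -expRD; congr (expR _)%:E; ring.
    - apply/measurable_EFinP; apply: measurableT_comp; first exact: measurable_expR.
      by apply: measurable_funM => //; exact: measurable_funB.
  apply: (@le_trans _ _ ((expR (- L))%:E * (expR L)%:E)%E).
    by rewrite lee_wpmul2l ?lee_fin ?expR_ge0.
  by rewrite -EFinM -expRD addNr expR0.
rewrite (integralB_EFin _ ithphi (ic (th * c + L)))//.
have -> : (\int[s]_x (cst (th * c + L)%R x)%:E = (th * c + L)%R%:E)%E.
  rewrite [LHS](_ : _ = \int[s]_x cst (th * c + L)%:E x)%E// integral_cst//.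
  by rewrite [X in (_ * X)%E](_ : _ = 1%E) ?mule1//; exact: probability_setT.
have -> : (\int[s]_x (th * phi x)%R%:E =
    th%:E * \int[s]_x (phi x)%:E)%E.
  by rewrite -integralZl.
apply: (@le_trans _ _ (th%:E * (\int[s]_x (phi x)%:E - \int[m]_x (phi x)%:E) - L%:E)%E).
  by rewrite leeB// lee_wpmul2l// lee_fin ltW.
move: fm fs cm; rewrite /comp.
case: (\int[m]_x (phi x)%:E)%E => // u; case: (\int[s]_x (phi x)%:E)%E => // z _ _.
rewrite !lee_fin => cu.
have := ler_wpM2l (ltW th0) cu; lra.
Qed.

Lemma relative_entropy_ge0 (s m : probability R R) : (0 <= relative_entropy s m)%E.
Proof.
have := @donsker_varadhan _ s m (cst 0); rewrite integral0 /=; apply => //.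
- exact: finite_measure_integrable_cst.
- rewrite expR0 [leLHS](_ : _ = \int[m]_x cst 1%E x)%E// integral_cst// mul1e.
  exact: probability_le1.
Qed.

End transport_entropy.

(** * The conjugate of the exponential moment bound *)

Section bennett.
Context {R : realType}.
Notation mu := (@lebesgue_measure R).

Lemma Lambda_ge0 (h : R -> R) (beta : \bar R) (T theta : R) :
  (0 <= beta)%E -> (0 <= Lambda h beta T theta)%E.
Proof.
by move=> b0; apply: integral_ge0 => t _; rewrite mule_ge0// lee_fin; exact: kappa_ge0.
Qed.

Lemma Lambda_le_variance (h : R -> R) (beta : \bar R) (T M theta : R) :
  measurable_fun setT h -> (0 <= beta)%E -> 0 < M -> 0 <= theta ->
  {ae mu, forall t, t \in `[0, T] -> 0 <= h t <= M} ->
  (Lambda h beta T theta <=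
   variance_bound h beta T * (M ^- 2 * kappa (theta * M))%:E)%E.
Proof.
move=> mh b0 M0 th0 hM.
have K0 : 0 <= M ^- 2 * kappa (theta * M).
  by rewrite mulr_ge0 ?kappa_ge0// invr_ge0 exprn_ge0// ltW.
rewrite /Lambda /variance_bound -ge0_integralZr//; last first.
- by move=> t _; rewrite mule_ge0// lee_fin sqr_ge0.
- apply: emeasurable_funM => //; apply/measurable_EFinP.
  exact/measurable_funTS/measurable_funX.
have mth : measurable_fun setT (fun t => theta * h t) by exact: measurable_funM.
have mk : measurable_fun setT (fun t => kappa (theta * h t)).
  exact: (measurableT_comp measurable_kappa mth).
apply: ae_ge0_le_integral => //.
- by move=> t _; rewrite mule_ge0// lee_fin; exact: kappa_ge0.
- by apply: emeasurable_funM => //; apply/measurable_EFinP; exact: measurable_funTS mk.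
- by move=> t _; rewrite !mule_ge0// lee_fin ?sqr_ge0.
- apply: emeasurable_funM => //; apply: emeasurable_funM => //; apply/measurable_EFinP.
  exact/measurable_funTS/measurable_funX.
- apply: (@filterS _ _ (ae_filter_ringOfSetsType mu) _ _ _ hM) => t htM tT; have /andP[h0 hM'] := htM tT.
  rewrite muleAC lee_wpmul2r// -EFinM lee_fin -[leLHS]/(kappa (theta * h t)).
  have e1 : h t / M <= 1 by rewrite ler_pdivrMr ?mul1r.
  have -> : theta * h t = h t / M * (theta * M) by field; exact: lt0r_neq0.
  have e0 : 0 <= h t / M by rewrite divr_ge0// ltW.
  apply: le_trans (kappaM_le e0 e1 (mulr_ge0 th0 (ltW M0))) _.
  by rewrite expr_div_n mulrA.
Qed.

(** With [theta = ln (1 + x M / V) / M], the Legendre transform of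
[V * kappa (theta * M) / M ^+ 2] is attained.  If [V] is infinite the left-hand
side is [- x / M] and [theta = 0] suffices; if [V = 0] then [k <= 0], so the
conjugate is infinite at every [x > 0]. *)
Lemma bennett_le_conjugate (k : R -> \bar R) (V : \bar R) (M x : R) :
  (0 <= V)%E -> 0 < M -> 0 <= x ->
  (forall theta, 0 <= theta -> (k theta <= V * (M ^- 2 * kappa (theta * M))%:E)%E) ->
  ((x%:E + M^-1%:E * V) / M%:E * lne (1 + x%:E / (M^-1%:E * V)) - (x / M)%:E
     <= monotone_conjugate k x%:E)%E.
Proof.
move=> V0 M0 x0 kV.
have low theta : 0 <= theta ->
    (theta%:E * x%:E - V * (M ^- 2 * kappa (theta * M))%:E <= monotone_conjugate k x%:E)%E.
  move=> th0; apply: (@le_trans _ _ (theta%:E * x%:E - k theta)%E).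
    by rewrite leeB// kV.
  by apply: ereal_sup_ubound; exists theta.
have c0 : (0 <= monotone_conjugate k x%:E)%E.
  by have := low 0 (lexx _); rewrite mul0r kappa0 mulr0 mule0 mul0e sube0.
have iM0 : 0 < M^-1 by rewrite invr_gt0.
move: V0 low kV; case: V => [v| |//].
- rewrite lee_fin le_eqVlt => /predU1P[<-|v0] low _.
    have [x_0|xn0] := eqVneq x 0.
      by move: c0; rewrite x_0 mule0 adde0 !mul0e mul0r sube0.
    have xp : 0 < x by rewrite lt_def xn0.
    suff -> : monotone_conjugate k x%:E = +oo%E by rewrite leey.
    apply/eqyP => A A0; have := low (A / x) (divr_ge0 (ltW A0) x0).
    by rewrite mul0e sube0 -EFinM divfK.
  have q0 : 0 < v / M by exact: divr_gt0.
  have X0 : 0 <= x / (v / M) by exact: divr_ge0 x0 (ltW q0).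
  have X1 : 0 < 1 + x / (v / M) by lra.
  pose th := ln (1 + x / (v / M)) / M.
  have l0 : 0 <= ln (1 + x / (v / M)) by rewrite ln_ge0// lerDl.
  have th0 : 0 <= th by exact: divr_ge0 l0 (ltW M0).
  apply: le_trans (low th th0).
  have -> : (x%:E / (M^-1%:E * v%:E) = (x / (v / M))%:E)%E.
    by rewrite -EFinM inver mulrC gt_eqF// EFinM.
  rewrite -EFinD lne_EFin// inver gt_eqF// -!EFinM -!EFinD lee_fin.
  rewrite /kappa divfK ?gt_eqF// lnK ?posrE// /th.
  rewrite le_eqVlt; apply/orP; left; apply/eqP.
  by field; rewrite !gt_eqF.
- move=> _ _; rewrite mulry gtr0_sg// mul1e addey// invey mule0 adde0 lne1 mule0 sub0e => _.
  by apply: le_trans c0; rewrite leeNl oppe0 lee_fin divr_ge0// ltW.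
Qed.

(** If [T = 0] the norm is [0] by convention, but the interval is negligible. *)
Lemma ae_le_Lnormy (h : R -> R) (T M : R) : measurable_fun setT h ->
  ('N[lebesgue_on T]_+oo[EFin \o h] <= M%:E)%E ->
  {ae mu, forall t, t \in `[0, T] -> h t <= M}.
Proof.
move=> mh; rewrite unlock; case: ifPn => [T0|].
  move=> hM.
  have : {ae lebesgue_on T, forall t, ((abse \o (EFin \o h)) t <= M%:E)%E}.
    apply: (@filterS _ _ (ae_filter_ringOfSetsType _) _ _ _ (ess_sup_ge _ _)) => t.
    by move=> /le_trans; apply.
  move=> [A [mA A0 sA]]; exists (A `&` `[0, T]); split=> //.
    exact: measurableI.
  move=> t /= /not_implyP[tT hMt]; split; last by rewrite inE in tT.
  apply: sA => /=; rewrite lee_fin => hle; apply: hMt.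
  exact: le_trans (ler_norm _) hle.
rewrite -leNgt measure_le0 => /eqP T0 _.
exists `[0, T]%classic; split=> //.
  by move: T0; rewrite /= /mrestr setTI.
by move=> t /= /not_implyP[].
Qed.
End bennett.

(** * The spacing density and its constants *)

Section square_integrable.
Context {R : realType}.
Notation mu := (@lebesgue_measure R).

Lemma integrable_lebesgue_on (T : R) (u : R -> R) :
  (lebesgue_on T).-integrable setT (EFin \o u) -> mu.-integrable `[0, T] (EFin \o u).
Proof.
move=> iu.
have iS : (lebesgue_on T).-integrable `[0, T] (EFin \o u) by exact: integrableS iu.
move/integrableP : (iS) => [mu_ fin]; apply/integrableP; split => //.
rewrite (@eq_measure_integral _ _ _ _ (lebesgue_on T))//.
by move=> A mA AT; rewrite /lebesgue_on/= /mrestr setIidl.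
Qed.

Lemma Lfun2_lebesgue_on (T : R) (g : {mfun R >-> R}) :
  (g : R -> R) \in Lfun (lebesgue_on T) 2%:E ->
  mu.-integrable `[0, T] (EFin \o g) /\
  mu.-integrable `[0, T] (EFin \o (fun r => g r ^+ 2)).
Proof.
move=> g2; split; apply: integrable_lebesgue_on; last exact: Lfun2_integrable_sqr.
apply/Lfun1_integrable; apply: Lfun_subset12 => //.
rewrite /= /mrestr setTI lebesgue_measure_itv/= -EFinB.
by case: ifP.
Qed.

End square_integrable.

Section spacing_density.
Context {R : realType}.
Notation mu := (@lebesgue_measure R).
Variables (f : R -> R) (nu : probability R R).
Hypothesis hf : {within `[0, +oo[, continuous f}.
Hypothesis dens : has_density_on_nneg nu f.

(** The given density constrains [f] on the half-line only; extending by zero yields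
a density on the whole line. *)
Definition nneg_density : R -> R := f \_ `[0, +oo[.
Notation f0 := nneg_density.

Lemma nneg_densityE x : 0 <= x -> f0 x = f x.
Proof. by move=> x0; rewrite /f0 patchE mem_setE in_itv/= x0. Qed.

Lemma nneg_density_neg x : x < 0 -> f0 x = 0.
Proof. by move=> x0; rewrite /f0 patchE mem_setE in_itv/= leNgt x0. Qed.

Lemma nneg_density_ge0 x : 0 <= f0 x.
Proof.
have [x0|x0] := leP 0 x; last by rewrite nneg_density_neg.
by rewrite nneg_densityE//; exact: dens.1.
Qed.

Lemma measurable_nneg_density : measurable_fun setT f0.
Proof.
apply/(measurable_restrict f) => //; rewrite setTI.
exact: subspace_continuous_measurable_fun.
Qed.

Lemma integral_nneg_density (A : set R) : measurable A ->
  nu A = (\int[mu]_(x in A) (f0 x)%:E)%E.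
Proof.
move=> mA; rewrite dens.2// [LHS]integral_mkcond [RHS]integral_mkcond.
apply: eq_integral => x _; rewrite !patchE in_setI.
case: (x \in A) => //=; rewrite mem_setE in_itv/= andbT.
by rewrite /f0 patchE mem_setE in_itv/= andbT; case: (0 <= x).
Qed.

Variables (T a : R) (C : \bar R).
Hypothesis ha : a \in `[0, T].
Hypothesis hC : (T%:E < C)%E.
Hypothesis hf0 : forall x : R, a < x -> (x%:E < C)%E -> 0 < f x.

Let T0 : 0 <= T. Proof. by move: ha; rewrite in_itv/= => /andP[/le_trans]; apply. Qed.
Let aT : a <= T. Proof. by move: ha; rewrite in_itv/= => /andP[]. Qed.

Let tail_itv : exists2 I : set R, measurable I &
  [set x | (T%:E < x%:E < C)%E] = I /\ exists2 u, T < u & `]T, u[ `<=` I.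
Proof.
move: hC; case: C => [c| |//] Tc.
- exists `]T, c[%classic => //; split; last by exists c.
  by apply/seteqP; split=> x /=; rewrite in_itv/= !lte_fin.
- exists `]T, +oo[%classic => //; split.
    by apply/seteqP; split=> x /=; rewrite in_itv/= lte_fin ?ltry andbT.
  exists (T + 1); first by rewrite ltrDl.
  by move=> x /=; rewrite !in_itv/= => /andP[->].
Qed.

Lemma tail_massE : tail_mass f T C = nu [set x | (T%:E < x%:E < C)%E].
Proof.
have [I mI [E _]] := tail_itv.
rewrite integral_nneg_density ?E// /tail_mass E.
apply: eq_integral => x; rewrite -E inE/= lte_fin => /andP[Tx _].
by rewrite nneg_densityE// (le_trans T0)// ltW.
Qed.

(** Otherwise [f] would vanish almost everywhere on an interval of positive length,
where it is positive. *)
Lemma tail_mass_gt0 : (0 < tail_mass f T C)%E.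
Proof.
have [I mI [E [u Tu sI]]] := tail_itv.
have f_gt0 x : I x -> 0 < f x.
  rewrite -E /= lte_fin => /andP[Tx xC]; apply: hf0 => //.
  exact: le_lt_trans Tx.
have I0 x : I x -> 0 <= x.
  by rewrite -E /= lte_fin => /andP[Tx _]; rewrite (le_trans T0)// ltW.
rewrite lt_def; apply/andP; split; last first.
  by apply: integral_ge0 => x; rewrite E lee_fin => /f_gt0/ltW.
apply/eqP; rewrite /tail_mass E => int0.
have : ae_eq mu I (EFin \o f0) (cst 0%E).
  apply/ae_eq_integral_abs => //.
    by apply/measurable_EFinP/measurable_funTS; exact: measurable_nneg_density.
  rewrite -[RHS]int0; apply: eq_integral => x; rewrite inE => Ix.
  by rewrite /= ger0_norm ?nneg_density_ge0// nneg_densityE// I0.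
move=> [N [mN N0 sN]].
have : (0 < mu `]T, u[)%E.
  by rewrite lebesgue_measure_itv/= lte_fin Tu -EFinB lte_fin subr_gt0.
apply/negP; rewrite -leNgt -N0; apply: le_measure; rewrite ?inE//.
move=> x /sI Ix; apply: sN => /= /(_ Ix) [].
by rewrite nneg_densityE ?I0// => fx; have := f_gt0 _ Ix; rewrite fx ltxx.
Qed.

Lemma tail_mass_fin : tail_mass f T C = (fine (tail_mass f T C))%:E.
Proof.
have [I mI [E _]] := tail_itv.
by rewrite fineK// tail_massE E fin_num_measure.
Qed.

Lemma nneg_density_tail : \int[mu]_(x in `[0, T]) f0 x <= 1 - fine (tail_mass f T C).
Proof.
have [I mI [E _]] := tail_itv.
rewrite /Rintegral -integral_nneg_density// -lee_fin EFinB -tail_mass_fin.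
rewrite fineK ?fin_num_measure// leeBrDr ?tail_massE ?E ?fin_num_measure//.
rewrite -measureU//; last first.
  apply/seteqP; split=> // x [/=]; rewrite in_itv/= -E /= lte_fin => /andP[_ xT].
  by move=> /andP[/le_lt_trans]; move=> /(_ _ xT); rewrite ltxx.
exact: probability_le1 (measurableU _ _ _ mI).
Qed.

Lemma density_max : exists2 S : R, 0 <= S /\ (forall x, 0 <= x <= T -> f x <= S) &
  ereal_sup [set (f x)%:E | x in `[0%R, T]] = S%:E.
Proof.
have [||c cT cmax] := @EVT_max R f 0 T.
- exact: T0.
- apply: continuous_subspaceW hf => x /=; rewrite !in_itv/= => /andP[-> _]//.
exists (f c); first split.
- by apply: dens.1; move: cT; rewrite in_itv/= => /andP[].
- by move=> x xT; apply: cmax; rewrite in_itv.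
- apply/eqP; rewrite eq_le; apply/andP; split.
    by apply: ge_ereal_sup => _ [x xT <-]; rewrite lee_fin cmax.
  by apply: ereal_sup_ubound; exists c.
Qed.

(** This is the first term of the maximum that defines [beta]. *)
Lemma density_max_le_beta : exists b : R, [/\ 0 <= b,
  forall x, 0 <= x <= T -> f x <= b * fine (tail_mass f T C) &
  (b%:E <= renewal_beta f a T C)%E].
Proof.
have [S [S0 Sle] E] := density_max.
have t0 : 0 < fine (tail_mass f T C) by rewrite -lte_fin -tail_mass_fin tail_mass_gt0.
exists (S / fine (tail_mass f T C)); split.
- exact: divr_ge0 (ltW t0).
- by move=> x xT; rewrite divfK ?gt_eqF//; exact: Sle.
- rewrite /renewal_beta E le_max; apply/orP; left.
  by rewrite tail_mass_fin inver gt_eqF// EFinM.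
Qed.

(** If [f x = 0] the ratio is [+oo] unless [f (x - z) = 0] too. *)
Lemma ratio_le (hbar : R) : (sup_ratio f T <= hbar%:E)%E ->
  forall x z : R, 0 <= z -> z <= x -> x <= T -> f0 (x - z) <= hbar * f0 x.
Proof.
move=> hr x z z0 zx xT.
have x0 : 0 <= x by exact: le_trans zx.
rewrite !nneg_densityE ?subr_ge0//.
have : ((f (x - z))%:E / (f x)%:E <= hbar%:E)%E.
  apply: le_trans hr.
  apply: (@le_trans _ _ (ereal_sup [set ((f (x - z))%:E / (f x)%:E)%E | x in `[z, T]])).
    by apply: ereal_sup_ubound; exists x => //=; rewrite in_itv/= zx.
  by apply: ereal_sup_ubound; exists z => //=; rewrite in_itv/= z0 (le_trans zx).
have := dens.1 _ x0; rewrite le_eqVlt => /predU1P[<-|fx].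
  rewrite mulr0 inve0; have : 0 <= f (x - z) by apply: dens.1; rewrite subr_ge0.
  rewrite le_eqVlt => /predU1P[<-//|p].
  by rewrite mulry gtr0_sg// mul1e.
by rewrite inver gt_eqF// -EFinM lee_fin ler_pdivrMr.
Qed.

End spacing_density.

(** * The transport-entropy inequality *)

Section assembly.
Context {R : realType}.
Notation mu := (@lebesgue_measure R).

(** The lower bound on [g2] increases with [beta], which may be infinite; the moment
bound is its value at [b]. *)
Lemma second_moment_le_g2_lower_bound (f : R -> R) (g : {mfun R >-> R})
    (hbar T t b r : R) (C beta : \bar R) :
  0 < t -> t <= 1 -> tail_mass f T C = t%:E -> 0 <= b -> (b%:E <= beta)%E ->
  mu.-integrable `[0, T] (EFin \o g) ->
  mu.-integrable `[0, T] (EFin \o (fun s => g s ^+ 2)) -> 0 <= r ->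
  ((Num.sqrt ((hbar ^+ 2 + t ^- 2 - 1) * second_moment T b g r))%:E <=
   g2_lower_bound f g hbar beta T C r)%E.
Proof.
move=> t0 t1 tE b0 bbeta ig ig2 r0.
have sub : `[r, T] `<=` `[0, T].
  by move=> x /=; rewrite !in_itv/= => /andP[/(le_trans r0)-> ->].
have ir2 : mu.-integrable `[r, T] (EFin \o (fun s => g s ^+ 2)) by exact: integrableS ig2.
have ir : mu.-integrable `[r, T] (EFin \o (fun s => `|g s|)).
  by apply: (@integrable_norm _ _ _ mu _ g); exact: integrableS ig.
rewrite /g2_lower_bound /second_moment tE.
have -> : (\int[mu]_(s in `[r, T]) (g s ^+ 2)%:E =
    (\int[mu]_(s in `[r, T]) g s ^+ 2)%:E)%E by rewrite fineK//; exact: integrable_fin_num.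
have -> : (\int[mu]_(s in `[r, T]) (`|g s|)%:E =
    (\int[mu]_(s in `[r, T]) `|g s|)%:E)%E by rewrite fineK//; exact: integrable_fin_num.
set A := \int[mu]_(s in `[r, T]) g s ^+ 2; set B := \int[mu]_(s in `[r, T]) `|g s|.
have A0 : 0 <= A by apply: Rintegral_ge0 => x _; exact: sqr_ge0.
have B0 : 0 <= B by apply: Rintegral_ge0 => x _.
have iv : 1 <= t ^- 2.
  by rewrite invf_ge1 ?exprn_gt0// expr_le1// ltW.
have c0 : 0 <= 2 * (hbar ^+ 2 + t ^- 2 - 1) by have := sqr_ge0 hbar; lra.
have -> : (hbar%:E ^+ 2 + ((t%:E ^+ 2)^-1) - 1 = (hbar ^+ 2 + t ^- 2 - 1)%:E :> \bar R)%E.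
  by rewrite -!EFin_expe inver gt_eqF ?exprn_gt0// -EFinD -EFinB.
rewrite -EFinM.
apply: (@le_trans _ _ (sqrte (2 * (hbar ^+ 2 + t ^- 2 - 1))%:E *
    sqrte (b * A + b ^+ 2 * B ^+ 2)%:E)%E).
  rewrite /sqrte/= -EFinM -sqrtrM// lee_fin; apply: ler_wsqrtr.
  by rewrite exprMn; lra.
rewrite lee_wpmul2l ?sqrte_ge0//.
have beta0 : (0 <= beta)%E by apply: le_trans bbeta; rewrite lee_fin.
have B2 : (0 <= B%:E ^+ 2 :> \bar R)%E by rewrite expe_ge0// lee_fin.
have b2 : (0 <= beta ^+ 2 :> \bar R)%E by rewrite expe_ge0.
rewrite lee_sqrt; last by rewrite adde_ge0 ?mule_ge0// lee_fin.
rewrite EFinD !EFinM; apply: leeD; first by rewrite lee_wpmul2r// lee_fin.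
rewrite -expe2 -[in X in (X <= _)%E]expe2 lee_wpmul2r//.
by rewrite !expe2; apply: lee_pmul; rewrite ?lee_fin.
Qed.

(** The scaling [kappa (e y) <= e^2 kappa y] turns the moment bounds into the
quadratic ones that compare the centring constant with the mean.  If [Lambda] is infinite at
[theta], the left-hand side is [-oo]. *)
Lemma theta_transport_le (h : R -> R) (T b theta : R) (beta : \bar R)
    (s m : probability R R) :
  measurable_fun setT h -> (forall t, 0 <= t -> t <= T -> 0 <= h t) ->
  0 <= b -> (b%:E <= beta)%E ->
  finite_first_moment (fun x y => `|x - y|) s ->
  (forall phi : R -> R, (forall x y : R, `|phi x - phi y| <= `|x - y|) ->
    exists c : R, forall (k : R -> R) (th : R), 0 <= th ->
    measurable_fun setT k -> mu.-integrable `[0, T] (EFin \o k) ->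
    (forall r : R, 0 <= r -> r <= T -> b * kappa (th * h r) <= k r) ->
    (\int[m]_x (expR (th * (phi x - c)))%:E <= (expR (\int[mu]_(r in `[0, T]) k r))%:E)%E /\
    (\int[m]_x (expR (th * (c - phi x)))%:E <= (expR (\int[mu]_(r in `[0, T]) k r))%:E)%E) ->
  0 <= theta ->
  (theta%:E * transport_cost (fun x y => `|x - y|%R) s m - Lambda h beta T theta
   <= relative_entropy s m)%E.
Proof.
move=> mh h0 b0 bbeta s1 H.
have beta0 : (0 <= beta)%E by apply: le_trans bbeta; rewrite lee_fin.
have L0 := Lambda_ge0 h T theta beta0.
rewrite le_eqVlt => /predU1P[<-|th0].
  rewrite mul0e sub0e; apply: le_trans (relative_entropy_ge0 s m).
  by rewrite leeNl oppe0 Lambda_ge0.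
pose k r := b * kappa (theta * h r).
have mk : measurable_fun setT k.
  apply: measurable_funM => //; apply: (measurableT_comp measurable_kappa).
  exact: measurable_funM.
have k0 r : 0 <= k r by rewrite mulr_ge0 ?kappa_ge0.
have kL : (\int[mu]_(r in `[0%R, T]) (k r)%:E <= Lambda h beta T theta)%E.
  apply: ge0_le_integral => //.
  - by move=> r _; rewrite lee_fin.
  - by apply/measurable_EFinP; exact: measurable_funTS.
  - apply: emeasurable_funM => //; apply/measurable_EFinP/measurable_funTS.
    by apply: (measurableT_comp measurable_kappa); exact: measurable_funM.
  - move=> r _; rewrite /k mulrC EFinM lee_wpmul2l// lee_fin; exact: kappa_ge0.
move: L0 kL; case: (Lambda h beta T theta) => [l| |//] L0 kL; last first.
  by rewrite addeNy leNye.
have ik : mu.-integrable `[0, T] (EFin \o k).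
  apply/integrableP; split; first by apply/measurable_EFinP; exact: measurable_funTS.
  under eq_integral do rewrite /= ger0_norm//.
  exact: le_lt_trans kL (ltry _).
have kE : (\int[mu]_(r in `[0%R, T]) (k r)%:E = (\int[mu]_(r in `[0, T]) k r)%:E)%E.
  by rewrite fineK//; exact: integrable_fin_num.
move: kL; rewrite kE => kL.
apply: (@le_trans _ _ (theta%:E * transport_cost (fun x y => `|x - y|%R) s m -
    (\int[mu]_(r in `[0, T]) k r)%:E)%E); first by rewrite leeB.
apply: transport_entropy_le => //; first exact: Rintegral_ge0.
move=> phi phi_lip; have [c Hc] := H phi phi_lip; exists c => e e0 e1.
rewrite -RintegralZl//.
apply: (Hc (fun r => e ^+ 2 * k r) (e * theta)).
- exact: mulr_ge0 e0 (ltW th0).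
- exact: measurable_funM.
- exact: (integrableZl _ (e ^+ 2) ik).
- move=> r r0 rT; rewrite /k mulrCA ler_wpM2l// -mulrA kappaM_le// mulr_ge0 ?(ltW th0)//.
  exact: h0.
Qed.

End assembly.

Theorem corollary3p10 (R : realType) (d : measure_display)
    (Omega : measurableType d) (P : probability Omega R)
    (T a : R) (C : \bar R) (f : R -> R) (tau : nat -> {RV P >-> R})
    (g g1 g2 : {mfun R >-> R}) (hbar : R)
    (ha : a \in `[0, T]) (hC : (T%:E < C)%E)
    (htau : iid_spacings f tau)
    (hf : {within `[0, +oo[, continuous f})
    (hf0 : forall x : R, a < x -> (x%:E < C)%E -> 0 < f x)
    (hg : (g : R -> R) \in Lfun (lebesgue_on T) 2%:E)
    (hg1 : (g1 : R -> R) \in Lfun (lebesgue_on T) 2%:E)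
    (hg2 : (g2 : R -> R) \in Lfun (lebesgue_on T) 2%:E)
    (hbar0 : 0 < hbar) (hratio : (sup_ratio f T <= hbar%:E)%E) :
  let beta := renewal_beta f a T C in
  let h := fun t => g1 t + g2 t in
  let G := renewal_integral T tau g : {RV P >-> R} in
  let c := monotone_conjugate (Lambda h beta T) in
  let V := variance_bound h beta T in
  let dist := fun x y : R => `|x - y| in
  (forall t, t \in `[0, T] -> `|g t| <= g1 t) ->
  (forall t, t \in `[0, T] ->
    (g2_lower_bound f g hbar beta T C t <= (g2 t)%:E)%E) ->
  (forall sigma : probability R R, finite_first_moment dist sigma ->
    (c (transport_cost dist sigma (distribution P G))
     <= relative_entropy sigma (distribution P G))%E) /\
  (forall M : R, 0 < M ->
    ('N[lebesgue_on T]_+oo[EFin \o h] <= M%:E)%E ->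
    forall x : R, 0 <= x ->
    ((x%:E + M^-1%:E * V) / M%:E * lne (1 + x%:E / (M^-1%:E * V)) - (x / M)%:E
     <= c x%:E)%E).
Proof.
move=> beta h G c V dist g_le g2_ge.
have [ind dens] := htau; have dens0 := dens 0%N.
have T0 : 0 <= T by move: ha; rewrite in_itv/= => /andP[/le_trans]; apply.
have tE := tail_mass_fin dens0 ha hC.
have tgt0 := tail_mass_gt0 hf dens0 ha hC hf0.
have tail := nneg_density_tail dens0 ha hC.
have [b [b0 f_le b_beta]] := density_max_le_beta hf dens0 ha hC hf0.
set t := fine (tail_mass f T C) in tE tail f_le.
have t0 : 0 < t by rewrite -lte_fin -tE.
have t1 : t <= 1.
  have : 0 <= \int[@lebesgue_measure R]_(x in `[0, T]) nneg_density f x.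
    by apply: Rintegral_ge0 => x _; exact: nneg_density_ge0 dens0 _.
  by lra.
have [ig ig2] := Lfun2_lebesgue_on hg.
have beta0 : (0 <= beta)%E by apply: le_trans b_beta; rewrite lee_fin.
have mh : measurable_fun setT h by apply: measurable_funD; exact: measurable_funPT.
have h_ge r : 0 <= r -> r <= T ->
    `|g r| + Num.sqrt ((hbar ^+ 2 + t ^- 2 - 1) * second_moment T b g r) <= h r.
  move=> r0 rT; have rT' : r \in `[0, T] by rewrite in_itv/= r0.
  apply: lerD; first exact: g_le.
  rewrite -lee_fin; apply: le_trans (g2_ge r rT').
  exact: second_moment_le_g2_lower_bound.
have h0 r : 0 <= r -> r <= T -> 0 <= h r.
  by move=> r0 rT; apply: le_trans (h_ge r r0 rT); rewrite addr_ge0// sqrtr_ge0.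
split=> [sigma s1|M M0 hM x x0]; last first.
  apply: bennett_le_conjugate => //.
    by apply: integral_ge0 => r _; rewrite mule_ge0// lee_fin sqr_ge0.
  move=> theta th0; apply: Lambda_le_variance => //.
  apply: (@filterS _ _ (ae_filter_ringOfSetsType _) _ _ _ (ae_le_Lnormy mh hM)) => r hrM rT.
  by rewrite hrM// andbT; move: rT; rewrite in_itv/= => /andP[]; exact: h0.
apply: ge_ereal_sup => _ [theta th0 <-].
apply: (theta_transport_le mh h0 b0 b_beta s1 _ th0) => phi phi_lip.
have f0_dens n A mA := integral_nneg_density (dens n) mA (A := A).
have f0_le x : 0 <= x <= T -> nneg_density f x <= b * t.
  by move=> /[dup] /andP[x0 _] xT; rewrite nneg_densityE//; exact: f_le.
have [m Hm] := @expR_moment_two_sided _ Omega R P (nneg_density f) T t b tau g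
  (nneg_density_ge0 dens0) (measurable_nneg_density hf) (@nneg_density_neg _ f) t0 tail
  f0_le T0 ig ig2 hbar hbar0 (ratio_le dens0 hratio) ind f0_dens h h_ge phi phi_lip.
exists m => k th th0' mk ik k_ge.
have mphi := lipschitz1_measurable phi_lip.
have mexp (u : R -> R) : measurable_fun setT u ->
    measurable_fun setT (fun y => (expR (th * u y))%:E).
  move=> mu_; apply/measurable_EFinP; apply: measurableT_comp; first exact: measurable_expR.
  exact: measurable_funM.
rewrite !ge0_integral_distribution//; first exact: (Hm k th th0' mk ik k_ge).
- by apply: mexp; exact: measurable_funB.
- by apply: mexp; exact: measurable_funB.
Qed.
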